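(* Let $Z^\epsilon$ denote the performance of the periodic switching policy with period $\epsilon>0$, i.e. $$Z^\epsilon=\limsup_{T\to\infty}\frac1T\int_0^T\sum_{i=1}^N\Big(\mathrm{Tr}(T_i\Sigma_i^\epsilon(t))+\sum_{j=1}^M\kappa_{ij}\pi_{ij}^\epsilon(t)\Big)dt.$$ Then $Z^\epsilon-Z^*=O(\epsilon)$ as $\epsilon\to0$. Hence the switching policy approaches the lower bound $Z^*$ arbitrarily closely as the period $\epsilon$ tends to $0$.
   Context: There are $N$ systems with state dimensions $n_i$ and $M$ sensors. Data: real matrices $A_i\in\mathbb{R}^{n_i\times n_i}$, symmetric positive semidefinite $W_i$ and $T_i$, matrices $C_{ij}$, symmetric positive definite $V_{ij}$, real costs $\kappa_{ij}$, and initial covariances $\Sigma_{i,0}$ ($1\le i\le N$, $1\le j\le M$). Standing assumptions: (1) each $\Sigma_{i,0}$ is positive definite; (2) for each $i$ there exist sensor indices $j_1,\dots,j_m\in\{1,\dots,M\}$ ($m$ depending on $i$) such that $(A_i,\tilde C_i)$ is detectable, where $\tilde C_i=[C_{ij_1}^T,\dots,C_{ij_m}^T]^T$; (3) for each $i$, $(A_i,W_i^{1/2})$ is controllable. Performance bound. $Z^*$ is the optimal value of the program (equivalently expressible with linear matrix inequalities) $$Z^*=\min_{Q_i,p_{ij}}\ \sum_{i=1}^N\Big\{\mathrm{Tr}(T_iQ_i^{-1})+\sum_{j=1}^M\kappa_{ij}p_{ij}\Big\}$$ over symmetric $n_i\times n_i$ matrices $Q_i$ and reals $p_{ij}$ subject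 to $Q_iA_i+A_i^TQ_i+Q_iW_iQ_i-\sum_{j=1}^Mp_{ij}C_{ij}^TV_{ij}^{-1}C_{ij}\preceq0$, $Q_i\succ0$ for all $i$; $0\le p_{ij}\le1$; $\sum_{i=1}^Np_{ij}\le1$ for all $j$; $\sum_{j=1}^Mp_{ij}\le1$ for all $i$. It is a lower bound on the average cost of every observation policy. Let $P=[p_{ij}]$ be the matrix of optimal parameters, i.e. the $p$-part of an optimal solution $(Q_i,p_{ij})$ of this program. Periodic switching policy. Let $n=\max(M,N)$ and let $\tilde P$ be the $n\times n$ matrix obtained from $P$ by adding zero columns or zero rows (dummy sensors or dummy systems, which are never used). Then $\tilde P$ is doubly substochastic, so one can fix a decomposition $\tilde P=\sum_{k=1}^K\phi_kP_k$ with $\phi_k>0$, $\sum_{k=1}^K\phi_k=1$, each $P_k$ being an $n\times n$ $0/1$ matrix with at most one $1$ in each row and column. The decomposition does not depend on $\epsilon$. For $\epsilon>0$, the periodic switching policy $\pi^\epsilon$ of period $\epsilon$ is: for every $l\in\mathbb{N}=\{0,1,\dots\}$ and $k=1,\dots,K$, during the interval $[(l+\phi_1+\dots+\phi_{k-1})\epsilon,(l+\phi_1+\dots+\phi_k)\epsilon)$ sensor $j$ observes system $i$ if and only if $(P_k)_{ij}=1$, i.e. $\pi_{ij}^\epsilon(t)=(P_k)_{ij}$ for $1\le i\le N$, $1\le j\le M$. The resulting error covariance $\Sigma_i^\epsilon(t)$ of the Kalman-Bucy filter for system $i$ solves $$\dot\Sigma_i^\epsilon=A_i\Sigma_i^\epsilon+\Sigma_i^\epsilon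 A_i^T+W_i-\Sigma_i^\epsilon\Big(\sum_{j=1}^M\pi_{ij}^\epsilon(t)C_{ij}^TV_{ij}^{-1}C_{ij}\Big)\Sigma_i^\epsilon,\qquad\Sigma_i^\epsilon(0)=\Sigma_{i,0}.$$ *)

(* Defs.v *)
From HB Require Import structures.
From mathcomp Require Import all_boot all_order all_algebra.
From mathcomp Require Import complex.
From mathcomp Require Import all_classical all_reals all_analysis.

Set Implicit Arguments.
Unset Strict Implicit.
Unset Printing Implicit Defensive.

Import Order.TTheory GRing.Theory Num.Theory.
Import numFieldNormedType.Exports.

Local Open Scope classical_set_scope.
Local Open Scope ring_scope.

Definition psd (R : realType) (n : nat) (X : 'M[R]_n) : Prop :=
  X^T = X /\ forall x : 'cV[R]_n, 0 <= (x^T *m X *m x) ord0 ord0.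

Definition posdef (R : realType) (n : nat) (X : 'M[R]_n) : Prop :=
  X^T = X /\ forall x : 'cV[R]_n, x != 0 -> 0 < (x^T *m X *m x) ord0 ord0.

Definition loewner_le (R : realType) (n : nat) (X Y : 'M[R]_n) : Prop :=
  psd (Y - X).

(* H is the (unique) positive semidefinite square root W^{1/2}. *)
Definition is_psd_sqrt (R : realType) (n : nat) (W H : 'M[R]_n) : Prop :=
  psd H /\ H *m H = W.

Definition hurwitz (R : realType) (n : nat) (A : 'M[R]_n) : Prop :=
  forall z : R[i], eigenvalue (map_mx (real_complex R) A) z ->
    complex.Re z < 0.

Definition detectable (R : realType) (n q : nat)
    (A : 'M[R]_n) (C : 'M[R]_(q, n)) : Prop :=
  exists L : 'M[R]_(n, q), hurwitz (A - L *m C).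

(* x' = A x + B u can be steered between any two states in finite time. *)
Definition controllable (R : realType) (n m : nat)
    (A : 'M[R]_n) (B : 'M[R]_(n, m)) : Prop :=
  forall x0 x1 : 'cV[R]_n,
  exists (tf : R) (u : R -> 'cV[R]_m) (x : R -> 'cV[R]_n),
    [/\ 0 < tf,
        {within `[0, tf], continuous u},
        {within `[0, tf], continuous x},
        x 0 = x0 /\ x tf = x1
      & forall t : R, 0 < t < tf -> is_derive t 1 x (A *m x t + B *m u t)].

(* Information rate sum_j w_j C_j^T V_j^{-1} C_j for sensor weights w. *)
Definition info (R : realType) (n M : nat) (q : 'I_M -> nat)
    (C : forall j, 'M[R]_(q j, n)) (V : forall j, 'M[R]_(q j))
    (w : 'I_M -> R) : 'M[R]_n :=
  \sum_(j < M) w j *: ((C j)^T *m invmx (V j) *m C j).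

Definition feasible (R : realType) (N M : nat) (n : 'I_N -> nat)
    (q : 'I_N -> 'I_M -> nat)
    (A W : forall i, 'M[R]_(n i)) (C : forall i j, 'M[R]_(q i j, n i))
    (V : forall i j, 'M[R]_(q i j))
    (Q : forall i, 'M[R]_(n i)) (P : 'M[R]_(N, M)) : Prop :=
  [/\ forall i, loewner_le
        (Q i *m A i + (A i)^T *m Q i + Q i *m W i *m Q i
           - info (C i) (V i) (P i)) 0,
      forall i, posdef (Q i),
      forall i j, 0 <= P i j <= 1,
      forall j, \sum_(i < N) P i j <= 1
    & forall i, \sum_(j < M) P i j <= 1].

Definition objective (R : realType) (N M : nat) (n : 'I_N -> nat)
    (T : forall i, 'M[R]_(n i)) (kappa : 'M[R]_(N, M))
    (Q : forall i, 'M[R]_(n i)) (P : 'M[R]_(N, M)) : R :=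
  \sum_(i < N) (\tr (T i *m invmx (Q i)) + \sum_(j < M) kappa i j * P i j).

(* Under the hypotheses that T_i and Q_i are positive semidefinite and
   0 <= p_ij <= 1 the set is bounded below, so inf is not a default value as
   soon as the program is feasible. *)
Definition optimal_value (R : realType) (N M : nat) (n : 'I_N -> nat)
    (q : 'I_N -> 'I_M -> nat)
    (A W T : forall i, 'M[R]_(n i)) (C : forall i j, 'M[R]_(q i j, n i))
    (V : forall i j, 'M[R]_(q i j)) (kappa : 'M[R]_(N, M)) : R :=
  inf [set z | exists Q P, feasible A W C V Q P /\ z = objective T kappa Q P].

Definition is_optimal (R : realType) (N M : nat) (n : 'I_N -> nat)
    (q : 'I_N -> 'I_M -> nat)
    (A W T : forall i, 'M[R]_(n i)) (C : forall i j, 'M[R]_(q i j, n i))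
    (V : forall i j, 'M[R]_(q i j)) (kappa : 'M[R]_(N, M))
    (Q : forall i, 'M[R]_(n i)) (P : 'M[R]_(N, M)) : Prop :=
  feasible A W C V Q P /\
  forall Q' P', feasible A W C V Q' P' ->
    objective T kappa Q P <= objective T kappa Q' P'.

Definition pad_mx (R : realType) (N M : nat) (P : 'M[R]_(N, M)) :
    'M[R]_(maxn M N) :=
  \matrix_(i, j)
    match insub (i : nat) : option 'I_N, insub (j : nat) : option 'I_M with
    | Some i', Some j' => P i' j'
    | _, _ => 0
    end.

Definition partial_perm_mx (R : realType) (n : nat) (P : 'M[R]_n) : Prop :=
  [/\ forall i j, P i j = 0 \/ P i j = 1,
      forall i j j', P i j = 1 -> P i j' = 1 -> j = j'
    & forall i i' j, P i j = 1 -> P i' j = 1 -> i = i'].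

Definition is_decomposition (R : realType) (N M K : nat) (P : 'M[R]_(N, M))
    (phi : 'I_K -> R) (Pk : 'I_K -> 'M[R]_(maxn M N)) : Prop :=
  [/\ forall k, 0 < phi k,
      \sum_(k < K) phi k = 1,
      forall k, partial_perm_mx (Pk k)
    & pad_mx P = \sum_(k < K) phi k *: Pk k].

(* The times at which P_k is in use. *)
Definition slot (R : realType) (K : nat) (phi : 'I_K -> R) (eps : R)
    (k : 'I_K) : set R :=
  \bigcup_(l in [set: nat])
    `[(l%:R + \sum_(h < K | (h < k)%N) phi h) * eps,
      (l%:R + \sum_(h < K | (h <= k)%N) phi h) * eps[%classic.

(* For t >= 0 exactly one slot contains t, so this is the N x M corner of the
   active P_k; the dummy rows and columns are dropped. *)
Definition switching_policy (R : realType) (N M K : nat)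
    (phi : 'I_K -> R) (Pk : 'I_K -> 'M[R]_(maxn M N)) (eps : R) (t : R) :
    'M[R]_(N, M) :=
  \sum_(k < K) (\1_(slot phi eps k) t : R) *:
    mxsub (widen_ord (leq_maxr M N)) (widen_ord (leq_maxl M N)) (Pk k).

(* Covariance of the Kalman-Bucy filter of system i under the policy pi: a
   continuous function on [0, +oo[ which solves the Riccati equation away from
   the switching times, where pi is discontinuous. *)
Definition filter_covariance (R : realType) (N M : nat) (i : 'I_N) (n : nat)
    (q : 'I_M -> nat) (A W : 'M[R]_n) (C : forall j, 'M[R]_(q j, n))
    (V : forall j, 'M[R]_(q j)) (Sigma0 : 'M[R]_n)
    (pi : R -> 'M[R]_(N, M)) (Sigma : R -> 'M[R]_n) : Prop :=
  [/\ Sigma 0 = Sigma0,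
      {within `[0, +oo[, continuous Sigma}
    & forall t : R, 0 < t -> {for t, continuous pi} ->
        is_derive t 1 Sigma
          (A *m Sigma t + Sigma t *m A^T + W
             - Sigma t *m info C V (pi t i) *m Sigma t)].

Definition performance (R : realType) (N M : nat) (n : 'I_N -> nat)
    (T : forall i, 'M[R]_(n i)) (kappa : 'M[R]_(N, M))
    (pi : R -> 'M[R]_(N, M)) (Sigma : forall i, R -> 'M[R]_(n i)) : \bar R :=
  limf_esup (fun tf : R =>
    ((tf^-1)%:E * \int[lebesgue_measure]_(t in `[0%R, tf])
       (\sum_(i < N) (\tr (T i *m Sigma i t)
                      + \sum_(j < M) kappa i j * pi t i j))%:E)%E) +oo.

(* Main.v *)
Require Import Defs.
From HB Require Import structures.
From mathcomp Require Import all_boot all_order all_algebra.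
From mathcomp Require Import complex.
From mathcomp Require Import all_classical all_reals all_analysis.
From mathcomp Require Import ring lra.

(* Write S(t) for the information rate of one system under the periodic policy,
   Sb for its mean (the rate prescribed by the optimal P), and X = Q^-1.

   Upper bound. The matrix inequality makes F = A - X Sb stable: a marginal mode
   of F would be a mode of A that W does not excite. Hence F^T Pi + Pi F = - T has
   a solution Pi >= 0, and completing the square at X bounds the derivative of
   tr (Pi Sigma) by tr (T X) - tr (T Sigma) plus terms linear in S - Sb. The
   primitive of S - Sb is eps-periodic and O(eps), so these terms are, up to
   O(eps), the derivative of a correction of tr (Pi Sigma), provided Sigma stays
   bounded uniformly in eps; this is obtained from the same estimate with T = I
   by a bootstrap argument. Integrating gives the average cost tr (T X) + O(eps).

   Lower bound. Averaging the equation of Y = Sigma^-1 over whole periods and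
   using convexity of Q |-> Q W Q and Q |-> tr (T Q^-1), the average of Y is
   feasible up to O(1/t) and at most as expensive as the policy. A convex
   combination with a strictly feasible point restores feasibility at the price
   of O(1/t), so no period gives an average cost below the optimal value. *)

Set Implicit Arguments.
Unset Strict Implicit.
Unset Printing Implicit Defensive.

Import Order.TTheory GRing.Theory Num.Theory.
Import numFieldNormedType.Exports.

Local Open Scope classical_set_scope.
Local Open Scope ring_scope.

(** * Quadratic forms and Lyapunov equations *)

(** Stability of [F] is carried by a positive definite solution of a Lyapunov equation instead of
    eigenvalues. Solvability comes from injectivity of a linear map in finite dimension, positivity
    from a first-contact argument, and controllability enters as the absence of a nonzero space of
    row vectors that is invariant under [A] and annihilated by [W]. The covariance is differentiable
    only off the switching times, so integral inequalities take the form of monotonicity of a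
    continuous function whose derivative has a sign off a locally finite set; Jensen's inequality
    becomes a tangent taken at the final average. The obstacle in the upper bound is that the
    derivative of the correction is quadratic in [Sigma]: its error is of order [eps] only once
    [Sigma] is bounded uniformly, which is not known beforehand. In the lower bound the usage over
    whole periods is exactly [P], so only the [Q] part of the program varies, and the limit superior
    is tested at the times [l * eps] alone. This bound holds for every [eps > 0]; only the upper
    bound restricts [eps]. *)

Section Bilinear.
Variables (R : realType) (n : nat).
Implicit Types (M N : 'M[R]_n) (x y z : 'cV[R]_n).

Definition bil M x y : R := (x^T *m M *m y) 0 0.

Lemma bilDl M x y z : bil M (x + y) z = bil M x z + bil M y z.
Proof. by rewrite /bil linearD /= !mulmxDl mxE. Qed.
Lemma bilDr M x y z : bil M x (y + z) = bil M x y + bil M x z.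
Proof. by rewrite /bil mulmxDr mxE. Qed.
Lemma bilZl M a x y : bil M (a *: x) y = a * bil M x y.
Proof. by rewrite /bil linearZ /= -!scalemxAl mxE. Qed.
Lemma bilZr M a x y : bil M x (a *: y) = a * bil M x y.
Proof. by rewrite /bil -scalemxAr mxE. Qed.
Lemma bilD M N x y : bil (M + N) x y = bil M x y + bil N x y.
Proof. by rewrite /bil mulmxDr mulmxDl mxE. Qed.
Lemma bilZ a M x y : bil (a *: M) x y = a * bil M x y.
Proof. by rewrite /bil -scalemxAr -scalemxAl mxE. Qed.
Lemma bilN M x y : bil (- M) x y = - bil M x y.
Proof. by rewrite -scaleN1r bilZ mulN1r. Qed.
Lemma bilB M N x y : bil (M - N) x y = bil M x y - bil N x y.
Proof. by rewrite bilD bilN. Qed.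
Lemma bil0 x y : bil 0 x y = 0.
Proof. by rewrite /bil mulmx0 mul0mx mxE. Qed.
Lemma bil0r M x : bil M x 0 = 0.
Proof. by rewrite /bil mulmx0 mxE. Qed.
Lemma bil0l M x : bil M 0 x = 0.
Proof. by rewrite /bil trmx0 !mul0mx mxE. Qed.
Lemma bil_tr M x y : bil M^T x y = bil M y x.
Proof.
rewrite /bil -[in RHS](trmxK (y^T *m M *m x)) [in RHS]mxE.
by rewrite !trmx_mul trmxK mulmxA.
Qed.
Lemma bil_mulr M N x y : bil (M *m N) x y = bil M x (N *m y).
Proof. by rewrite /bil !mulmxA. Qed.
Lemma bil_mull M N x y : bil (M *m N) x y = bil N (M^T *m x) y.
Proof. by rewrite /bil trmx_mul trmxK !mulmxA. Qed.
Lemma bil_sum M x y : bil M x y = \sum_i \sum_j x i 0 * M i j * y j 0.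
Proof.
rewrite /bil mxE exchange_big /=; apply: eq_bigr => j _.
rewrite mxE big_distrl /=; apply: eq_bigr => i _; by rewrite mxE.
Qed.
Lemma bil1E x y : bil 1%:M x y = \sum_i x i 0 * y i 0.
Proof. by rewrite /bil mulmx1 mxE; apply: eq_bigr => i _; rewrite mxE. Qed.
Lemma bil_delta M i j : bil M (delta_mx i 0) (delta_mx j 0) = M i j.
Proof. by rewrite /bil trmx_delta -rowE -colE !mxE. Qed.

Lemma bil11_ge0 x : 0 <= bil 1%:M x x.
Proof. by rewrite bil1E; apply: sumr_ge0 => i _; rewrite -expr2 sqr_ge0. Qed.
Lemma bil11_eq0 x : bil 1%:M x x = 0 -> x = 0.
Proof.
rewrite bil1E => /eqP; rewrite psumr_eq0; last by move=> i _; rewrite -expr2 sqr_ge0.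
move/allP => h; apply/matrixP => i j; rewrite ord1 mxE.
by have := h i (mem_index_enum _); rewrite -expr2 sqrf_eq0 => /eqP.
Qed.
Lemma bil11_gt0 x : x != 0 -> 0 < bil 1%:M x x.
Proof.
move=> x0; rewrite lt_neqAle bil11_ge0 andbT eq_sym.
by apply: contra x0 => /eqP /bil11_eq0 ->.
Qed.

Lemma psdP M : psd M <-> M^T = M /\ forall x, 0 <= bil M x x.
Proof. by []. Qed.
Lemma posdefP M : posdef M <-> M^T = M /\ forall x, x != 0 -> 0 < bil M x x.
Proof. by []. Qed.

Lemma psd0 : psd (0 : 'M[R]_n).
Proof. by split=> [|x]; rewrite ?trmx0// -/(bil 0 x x) bil0. Qed.
Lemma psd1 : psd (1%:M : 'M[R]_n).
Proof. by split=> [|x]; [rewrite trmx1|exact: bil11_ge0]. Qed.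
Lemma posdef1 : posdef (1%:M : 'M[R]_n).
Proof. by split=> [|x]; [rewrite trmx1|exact: bil11_gt0]. Qed.
Lemma psdD M N : psd M -> psd N -> psd (M + N).
Proof.
move=> /psdP[M1 M2] /psdP[N1 N2]; apply/psdP; split=> [|x].
  by rewrite linearD /= M1 N1.
by rewrite bilD addr_ge0.
Qed.
Lemma psdZ a M : 0 <= a -> psd M -> psd (a *: M).
Proof.
move=> a0 /psdP[M1 M2]; apply/psdP; split=> [|x].
  by rewrite linearZ /= M1.
by rewrite bilZ mulr_ge0.
Qed.
Lemma posdefZ a M : 0 < a -> posdef M -> posdef (a *: M).
Proof.
move=> a0 /posdefP[M1 M2]; apply/posdefP; split=> [|x x0].
  by rewrite linearZ /= M1.
by rewrite bilZ mulr_gt0 // M2.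
Qed.
Lemma posdefDpsd M N : posdef M -> psd N -> posdef (M + N).
Proof.
move=> /posdefP[M1 M2] /psdP[N1 N2]; apply/posdefP; split=> [|x x0].
  by rewrite linearD /= M1 N1.
by rewrite bilD ltr_wpDr // M2.
Qed.
Lemma posdef_psd M : posdef M -> psd M.
Proof.
move=> /posdefP[M1 M2]; apply/psdP; split=> // x.
have [->|/M2 /ltW //] := eqVneq x 0.
by rewrite /bil mulmx0 mxE.
Qed.
Lemma posdefD M N : posdef M -> posdef N -> posdef (M + N).
Proof. by move=> ? /posdef_psd; exact: posdefDpsd. Qed.

(** The form is evaluated at [c *: x - b *: y], where [b] and [c] are its values at [(x, y)] and
    [(y, y)]. A semidefinite form may have [c = 0], and then [b = 0] has to be forced separately. *)
Lemma psd_cs M x y : psd M -> bil M x y ^+ 2 <= bil M x x * bil M y y.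
Proof.
move=> /psdP[Ms M0].
have sym : bil M y x = bil M x y by rewrite -bil_tr Ms.
have E a b : bil M (a *: x + b *: y) (a *: x + b *: y) =
    a ^+ 2 * bil M x x + 2 * a * b * bil M x y + b ^+ 2 * bil M y y.
  rewrite !(bilDl, bilDr, bilZl, bilZr) sym; ring.
have H a b := M0 (a *: x + b *: y); move: H.
set a := bil M x x in E *; set b := bil M x y in E *; set c := bil M y y in E *.
move=> H; have H' s t : 0 <= s ^+ 2 * a + 2 * s * t * b + t ^+ 2 * c by rewrite -E.
have c0 : 0 <= c by apply: M0.
move: c0; rewrite le_eqVlt => /predU1P[c0|c0]; last first.
  have := H' c (- b).
  have -> : c ^+ 2 * a + 2 * c * (- b) * b + (- b) ^+ 2 * c = c * (a * c - b ^+ 2) by ring.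
  by rewrite pmulr_rge0 // subr_ge0.
rewrite -c0 mulr0.
have [->|b0] := eqVneq b 0; first by rewrite expr0n.
(* For [c = 0] and [b] nonzero this combination has the value [a - (a + 1) = -1]. *)
have := H' 1 (- ((a + 1) / (2 * b))).
rewrite -c0 (_ : _ + _ = -1); first lra.
field; exact: b0.
Qed.

Lemma psd_ker M x : psd M -> bil M x x = 0 -> M *m x = 0.
Proof.
move=> Mp x0; apply: bil11_eq0; apply/eqP; rewrite -sqrf_eq0 eq_le sqr_ge0 andbT.
rewrite -bil_mulr mul1mx.
by have := psd_cs (M *m x) x Mp; rewrite x0 mulr0.
Qed.

End Bilinear.

Section PosDef.
Variables (R : realType).

Lemma psd_congr n m (M : 'M[R]_n) (B : 'M[R]_(n, m)) : psd M -> psd (B^T *m M *m B).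
Proof.
move=> [Ms M0]; split=> [|x].
  by rewrite !trmx_mul Ms trmxK mulmxA.
have := M0 (B *m x); by rewrite trmx_mul !mulmxA.
Qed.

Lemma psd_congr_sym n (M B : 'M[R]_n) : B^T = B -> psd M -> psd (B *m M *m B).
Proof. by move=> Bs /(psd_congr B); rewrite Bs. Qed.

Lemma posdef_unit n (M : 'M[R]_n) : posdef M -> M \in unitmx.
Proof.
move=> Mp; rewrite -row_free_unit; apply: inj_row_free => v vM.
have [Ms Mx] := Mp.
have [/eqP|v0] := eqVneq v^T 0; first by rewrite -trmx0 (inj_eq trmx_inj) => /eqP.
by have := Mx _ v0; rewrite trmxK vM mul0mx mxE ltxx.
Qed.

Lemma posdef_congr n (M B : 'M[R]_n) : B \in unitmx -> posdef M ->
  posdef (B^T *m M *m B).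
Proof.
move=> Bu Mp; have [Bs B0] := psd_congr B (posdef_psd Mp).
split=> // x x0; have [_ Mx] := Mp.
have := Mx (B *m x); rewrite trmx_mul !mulmxA; apply.
apply: contra x0 => /eqP Bx; by rewrite -(mulKmx Bu x) Bx mulmx0.
Qed.

Lemma invmx_sym n (M : 'M[R]_n) : M^T = M -> (invmx M)^T = invmx M.
Proof. by move=> Ms; rewrite trmx_inv Ms. Qed.

Lemma posdef_inv n (M : 'M[R]_n) : posdef M -> posdef (invmx M).
Proof.
move=> Mp; have Mu := posdef_unit Mp.
have := posdef_congr (B := invmx M) _ Mp; rewrite unitmx_inv => /(_ Mu).
by rewrite invmx_sym ?Mp.1 // mulVmx // mul1mx.
Qed.

Lemma psd_diag_ge0 n (M : 'M[R]_n) i : psd M -> 0 <= M i i.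
Proof. by case=> _ /(_ (delta_mx i 0)); rewrite -/(bil _ _ _) bil_delta. Qed.

Lemma psd_entry n (M : 'M[R]_n) i j : psd M -> `|M i j| <= \tr M.
Proof.
move=> Mp; have Mii k := psd_diag_ge0 k Mp.
have diag k : M k k <= \tr M.
  by rewrite /mxtrace (bigD1 k) //= lerDl sumr_ge0.
have := psd_cs (delta_mx i 0) (delta_mx j 0) Mp; rewrite !bil_delta => H.
have t0 : 0 <= \tr M by apply: sumr_ge0.
rewrite -(@ler_pXn2r _ 2) ?nnegrE // real_normK ?num_real //.
apply: le_trans H _; rewrite expr2; exact: ler_pM.
Qed.

(** Symmetric elimination in place of the spectral theorem: subtracting the rank one matrix of a
    column with positive diagonal entry leaves a Schur complement, again semidefinite. The induction
    is on the number of nonzero diagonal entries; a semidefinite matrix with zero diagonal is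
    zero. *)
Lemma psd_decomp n (M : 'M[R]_n) : psd M ->
  exists s : seq 'cV[R]_n, M = \sum_(a <- s) a *m a^T.
Proof.
move: {2}(#|[pred i | M i i != 0]|) (leqnn #|[pred i | M i i != 0]|) => k.
elim: k M => [|k IH] M.
  rewrite leqn0 => /eqP c0 Mp; exists [::]; rewrite big_nil.
  have d0 i : M i i = 0.
    have /pred0P/(_ i)/= := introT eqP c0.
    by move/negbFE/eqP.
  apply/matrixP => i j; rewrite mxE; apply/eqP; rewrite -normr_eq0 eq_le normr_ge0 andbT.
  apply: le_trans (psd_entry i j Mp) _.
  by rewrite /mxtrace big1.
move=> cM Mp.
have [/existsP[i Mi]|/existsPn h] := boolP [exists i, M i i != 0]; last first.
  apply: IH Mp; rewrite (_ : #|_| = 0)%N //.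
  by apply/eqP/pred0P => i /=; apply/negbTE/h.
have Mi0 : 0 < M i i by rewrite lt_neqAle eq_sym Mi psd_diag_ge0.
have Ms := Mp.1.
have Msij a b : M a b = M b a by rewrite -{1}Ms mxE.
pose c := col i M.
pose N := M - (M i i)^-1 *: (c *m c^T).
have Np : psd N.
  apply/psdP; split=> [|x].
    by rewrite /N linearB linearZ /= trmx_mul trmxK Ms.
  rewrite /N bilB bilZ subr_ge0 ler_pdivrMl //.
  have -> : bil (c *m c^T) x x = bil M x (delta_mx i 0) ^+ 2.
    rewrite /bil -[x^T *m M *m _]mulmxA -colE mulmxA -[x^T *m c *m _ *m _]mulmxA.
    rewrite mxE big_ord1 expr2; congr (_ * _).
    by rewrite -[c^T *m x]trmxK mxE trmx_mul trmxK.
  by have := psd_cs x (delta_mx i 0) Mp; rewrite bil_delta mulrC.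
have Nii : N i i = 0.
  by rewrite !mxE big_ord1 !mxE mulKf ?subrr.
have [s Ns] : exists s : seq 'cV[R]_n, N = \sum_(a <- s) a *m a^T.
  apply: IH Np; rewrite -ltnS; apply: leq_trans cM.
  apply: proper_card; apply/properP; split.
    (* A zero diagonal entry stays zero, because semidefiniteness makes its whole row vanish; so the
       count drops. *)
    apply/fintype.subsetP => j; rewrite !inE; apply: contra => /eqP Mj.
    rewrite !mxE big_ord1 !mxE Mj.
    have -> : M j i = 0.
      apply/eqP; rewrite -sqrf_eq0 eq_le sqr_ge0 andbT.
      have := psd_cs (delta_mx j 0) (delta_mx i 0) Mp; rewrite !bil_delta Mj.
      by rewrite mul0r.
    by rewrite mul0r mulr0 subr0.
  by exists i; rewrite !inE ?Nii ?eqxx.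
exists ((Num.sqrt (M i i))^-1 *: c :: s); rewrite big_cons -Ns /N.
rewrite linearZ /= -scalemxAl -scalemxAr scalerA -invfM -expr2 sqr_sqrtr ?ltW //.
by rewrite addrC subrK.
Qed.

Lemma psd_tr_ge0 n (M N : 'M[R]_n) : psd M -> psd N -> 0 <= \tr (M *m N).
Proof.
move=> /psd_decomp[s ->] [_ N0]; rewrite mulmx_suml raddf_sum /=.
apply: sumr_ge0 => a _.
rewrite -mulmxA mxtrace_mulC; have := N0 a.
by rewrite /mxtrace big_ord1.
Qed.

Lemma mx_entry_norm m n (M : 'M[R]_(m, n)) i j : `|M i j| <= `|M|.
Proof.
rewrite [leRHS]mx_normrE /=.
exact: (le_bigmax _ (fun ij : 'I_m * 'I_n => `|M ij.1 ij.2|) (i, j)).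
Qed.

Lemma mx_norm_le m n (M : 'M[R]_(m, n)) c : 0 <= c ->
  (forall i j, `|M i j| <= c) -> `|M| <= c.
Proof. by move=> c0 h; rewrite [leLHS]mx_normrE; apply: bigmax_le => // -[i j] _; exact: h. Qed.

Lemma mulmx_norm m n p (M : 'M[R]_(m, n)) (N : 'M[R]_(n, p)) :
  `|M *m N| <= n%:R * `|M| * `|N|.
Proof.
apply: mx_norm_le => [|i j]; first by rewrite !mulr_ge0.
rewrite mxE; apply: le_trans (ler_norm_sum _ _ _) _.
apply: (@le_trans _ _ (\sum_(k < n) `|M| * `|N|)).
  apply: ler_sum => k _; rewrite normrM; apply: ler_pM => //; exact: mx_entry_norm.
by rewrite sumr_const card_ord -mulrA mulr_natl.
Qed.

Lemma trmx_norm m n (M : 'M[R]_(m, n)) : `|M^T| = `|M|.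
Proof.
apply/le_anti/andP; split; apply: mx_norm_le => // i j.
  by rewrite mxE mx_entry_norm.
by have := mx_entry_norm M^T j i; rewrite mxE.
Qed.

Lemma mxtrace_norm n (M : 'M[R]_n) : `|\tr M| <= n%:R * `|M|.
Proof.
apply: le_trans (ler_norm_sum _ _ _) _.
apply: (@le_trans _ _ (\sum_(k < n) `|M|)).
  by apply: ler_sum => k _; exact: mx_entry_norm.
by rewrite sumr_const card_ord mulr_natl.
Qed.

Lemma psd_norm n (M : 'M[R]_n) : psd M -> `|M| <= \tr M.
Proof.
move=> Mp; apply: mx_norm_le => [|i j]; last exact: psd_entry.
by apply: sumr_ge0 => i _; exact: psd_diag_ge0.
Qed.

Lemma bil_norm n (M : 'M[R]_n) x : `|bil M x x| <= n%:R * `|M| * bil 1%:M x x.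
Proof.
rewrite bil_sum.
apply: (@le_trans _ _ (\sum_(i < n) \sum_(j < n) `|M| * ((x i 0 ^+ 2 + x j 0 ^+ 2) / 2))).
  apply: le_trans (ler_norm_sum _ _ _) _; apply: ler_sum => i _.
  apply: le_trans (ler_norm_sum _ _ _) _; apply: ler_sum => j _.
  rewrite -mulrA mulrCA normrM; apply: ler_pM => //; first exact: mx_entry_norm.
  have := sqr_ge0 (x i 0 + x j 0); have := sqr_ge0 (x i 0 - x j 0).
  by rewrite !expr2 ler_norml => ? ?; apply/andP; split; lra.
rewrite le_eqVlt; apply/orP; left; apply/eqP.
transitivity (`|M| * \sum_(i < n) \sum_(j < n) (x i 0 ^+ 2 + x j 0 ^+ 2) / 2).
  by rewrite big_distrr; apply: eq_bigr => i _; rewrite big_distrr.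
have e : \sum_(i < n) \sum_(j < n) (x i 0 ^+ 2 + x j 0 ^+ 2) / 2 =
   n%:R * bil 1%:M x x.
  rewrite bil1E; under eq_bigr do under eq_bigr do rewrite mulrDl.
  under eq_bigr do rewrite big_split /=.
  rewrite big_split /= exchange_big -big_split /=.
  under eq_bigr do rewrite -big_split /=.
  rewrite sumr_const card_ord [RHS]mulr_natl; congr (_ *+ _).
  by apply: eq_bigr => i _; rewrite -expr2; field.
by rewrite e mulrCA mulrA.
Qed.

(** Cauchy-Schwarz for [x] and [M^-1 x] gives [|x|^4 <= (x^T M x) (x^T M^-1 x)], so an upper bound
    on the form of [M^-1] yields an explicit [m] without a compactness argument. *)
Lemma posdef_coercive n (M : 'M[R]_n) : posdef M ->
  exists2 m, 0 < m & psd (M - m%:M).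
Proof.
move=> Mp; have Mu := posdef_unit Mp; have Mpsd := posdef_psd Mp.
pose c := n%:R * `|invmx M| + 1.
have c0 : 0 < c by rewrite ltr_wpDl // mulr_ge0.
exists c^-1; first by rewrite invr_gt0.
apply/psdP; split=> [|x]; first by rewrite linearB /= tr_scalar_mx Mp.1.
rewrite -[c^-1%:M]scalemx1 bilB bilZ subr_ge0 ler_pdivrMl //.
have := psd_cs x (invmx M *m x) Mpsd.
have -> : bil M x (invmx M *m x) = bil 1%:M x x by rewrite -bil_mulr mulmxV.
have -> : bil M (invmx M *m x) (invmx M *m x) = bil (invmx M) x x.
  by rewrite -bil_mulr mulmxV // /bil trmx_mul invmx_sym ?Mp.1 // mulmx1.
have := bil_norm (invmx M) x; rewrite ler_norml => /andP[_].
have := bil11_ge0 x; have := Mpsd.2 x; rewrite -/(bil M x x) => Mx x0 h1 h2.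
have h3 : bil (invmx M) x x <= c * bil 1%:M x x.
  by apply: le_trans h1 _; rewrite ler_wpM2r // lerDl.
have [->|x0'] := eqVneq (bil 1%:M x x) 0; first by rewrite mulr_ge0 // ltW.
have x1 : 0 < bil 1%:M x x by rewrite lt_neqAle eq_sym x0'.
rewrite -(ler_pM2r x1) -expr2; apply: le_trans h2 _.
apply: le_trans (ler_wpM2l Mx h3) _.
by rewrite mulrA [_ * c]mulrC.
Qed.

Lemma psd_sub_scalar n (M : 'M[R]_n) m x : psd (M - m%:M) ->
  m * bil 1%:M x x <= bil M x x.
Proof.
by move=> /psdP[_ /(_ x)]; rewrite -[m%:M]scalemx1 bilB bilZ subr_ge0.
Qed.

(** Moving from [D] in the direction [X], the infimum of the [eta] that make the sum semidefinite is
    a point of contact with the boundary of the cone: still semidefinite, but singular. *)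
Lemma psd_boundary n (X D : 'M[R]_n) : posdef X -> D^T = D -> ~ psd D ->
  exists2 eta, 0 < eta &
    psd (D + eta *: X) /\ exists2 v : 'cV_n, v != 0 & (D + eta *: X) *m v = 0.
Proof.
move=> Xp Ds nD; have Xpsd := posdef_psd Xp.
have [m m0 Xm] := posdef_coercive Xp.
have bilm x : m * bil 1%:M x x <= bil X x x.
  exact: psd_sub_scalar.
pose E := [set eta | psd (D + eta *: X)].
have Esym eta : (D + eta *: X)^T = D + eta *: X.
  by rewrite linearD linearZ /= Ds Xp.1.
have E0 : E !=set0.
  (* [m] bounds the form of [X] from below, so this multiple of [X] outweighs [D]. *)
  exists (n%:R * `|D| / m); apply/psdP; split=> // x.
  rewrite bilD bilZ; have := bil_norm D x; rewrite ler_norml => /andP[+ _].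
  have := bilm x => h1 h2.
  have : n%:R * `|D| / m * (m * bil 1%:M x x) <= n%:R * `|D| / m * bil X x x.
    by apply: ler_wpM2l => //; rewrite mulr_ge0 ?mulr_ge0 // invr_ge0 ltW.
  rewrite mulrA divfK ?gt_eqF // => h3; lra.
have Epos eta : E eta -> 0 < eta.
  move=> Eeta; rewrite ltNge; apply/negP => eta0; apply: nD.
  have -> : D = (D + eta *: X) + (- eta) *: X by rewrite scaleNr addrK.
  by apply: psdD => //; apply: psdZ => //; rewrite oppr_ge0.
have Elb : has_inf E by split=> //; exists 0 => eta /Epos /ltW.
have Einf : E (inf E).
  apply/psdP; split=> // x; rewrite bilD bilZ.
  have Xx : 0 <= bil X x x by apply: Xpsd.2.
  have : forall d, 0 < d -> 0 <= bil D x x + (inf E + d) * bil X x x.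
    move=> d d0; have [eta Eeta etad] := inf_adherent d0 Elb.
    have := ((psdP _).1 Eeta).2 x; rewrite bilD bilZ => h.
    by apply: le_trans h _; rewrite lerD2l; apply: ler_wpM2r => //; exact: ltW.
  move=> h; rewrite leNgt; apply/negP => neg.
  (* This [d] raises the negative value by less than half of its size. *)
  have d0 : 0 < - (bil D x x + inf E * bil X x x) / (2 * (bil X x x + 1)).
    by rewrite divr_gt0 ?oppr_gt0 // mulr_gt0 // ltr_wpDl.
  have {h d0} := h _ d0.
  set u := bil X x x in Xx neg *; set w := bil D x x in neg *; set e := inf E in neg *.
  have k : u / (2 * (u + 1)) <= 1 / 2.
    by rewrite ler_pdivrMr ?mulr_gt0 ?ltr_wpDl // ; lra.
  have -> : w + (e + - (w + e * u) / (2 * (u + 1))) * u =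
     (w + e * u) * (1 - u / (2 * (u + 1))).
     by field; rewrite gt_eqF // ltr_wpDl.
  move=> h'; have := nmulr_rge0 (1 - u / (2 * (u + 1))) neg; rewrite h'; lra.
exists (inf E); first exact: Epos.
split=> //.
have [//|nk] := pselect (exists2 v : 'cV_n, v != 0 & (D + inf E *: X) *m v = 0).
exfalso.
have pos : posdef (D + inf E *: X).
  apply/posdefP; split=> // x x0.
  have := ((psdP _).1 Einf).2 x; rewrite le_eqVlt => /predU1P[/esym e|//].
  by exfalso; apply: nk; exists x => //; exact: psd_ker.
have [m' m'0 pos'] := posdef_coercive pos.
pose c := n%:R * `|X| + 1.
have c0 : 0 < c by rewrite ltr_wpDl // mulr_ge0.
(* Without a kernel the matrix at the infimum has a margin [m']; as [c] bounds the form of [X], a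
   smaller [eta] would still do. *)
have : E (inf E - m' / c).
  apply/psdP; split=> // x; rewrite scalerBl addrA bilB bilZ.
  have h := psd_sub_scalar x pos'.
  rewrite subr_ge0; apply: le_trans h.
  rewrite -mulrA ler_pM2l // ler_pdivrMl //.
  have := bil_norm X x; rewrite ler_norml => /andP[_ h]; apply: le_trans h _.
  by rewrite ler_wpM2r ?bil11_ge0 // lerDl.
move=> /(ge_inf Elb.2); rewrite leNgt ltrBlDr ltrDl => /negP; apply.
by rewrite divr_gt0.
Qed.

Lemma bil_congr n m (M : 'M[R]_n) (B : 'M[R]_(n, m)) x y :
  bil (B^T *m M *m B) x y = bil M (B *m x) (B *m y).
Proof. by rewrite /bil trmx_mul !mulmxA. Qed.

Lemma psd_ker_mx n m (M : 'M[R]_n) (Z : 'M[R]_(m, n)) : psd M ->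
  Z *m M *m Z^T = 0 -> Z *m M = 0.
Proof.
move=> Mp H; apply: trmx_inj; rewrite trmx0 trmx_mul Mp.1.
apply/matrixP => i j; have -> : (M *m Z^T) i j = (M *m (Z^T *m (delta_mx j 0 : 'cV_m))) i 0.
  by rewrite mulmxA -colE [RHS]mxE.
rewrite psd_ker ?mxE // -bil_congr trmxK H bil0 //.
Qed.

Lemma psd_addr_eq0 n m (M N : 'M[R]_n) (Z : 'M[R]_(m, n)) : psd M -> psd N ->
  Z *m (M + N) *m Z^T = 0 -> Z *m M = 0 /\ Z *m N = 0.
Proof.
move=> Mp Np H.
have key (M' N' : 'M[R]_n) : psd M' -> psd N' -> Z *m (M' + N') *m Z^T = 0 ->
    Z *m M' = 0.
  move=> M'p N'p H'; apply: psd_ker_mx => //.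
  have := psd_congr Z^T M'p; have := psd_congr Z^T N'p; rewrite trmxK => N1 M1.
  have S0 : Z *m M' *m Z^T + Z *m N' *m Z^T = 0 by rewrite -mulmxDl -mulmxDr.
  have e : Z *m N' *m Z^T = - (Z *m M' *m Z^T).
    by apply/eqP; rewrite -addr_eq0 addrC S0.
  have z x : bil (Z *m M' *m Z^T) x x = 0.
    apply/eqP; rewrite eq_le; apply/andP; split; last exact: M1.2.
    by rewrite -oppr_ge0 -bilN -e; exact: N1.2.
  apply/matrixP => i j; rewrite [RHS]mxE -bil_delta; apply/eqP.
  rewrite -sqrf_eq0 eq_le sqr_ge0 andbT; apply: le_trans (psd_cs _ _ M1) _.
  by rewrite z mul0r.
split; first exact: key Mp Np H.
by apply: key Np Mp _; rewrite addrC.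
Qed.

End PosDef.

(** * Solvability of Lyapunov equations by linear algebra *)

Section Lyapunov.
Variables (R : realType) (n : nat).

(* The last summand makes the operator injective on all matrices, not only on the
   symmetric ones, and forces the solutions for a symmetric right-hand side to be
   symmetric. *)
Definition lyap_op (F D : 'M[R]_n) : 'M[R]_n :=
  F *m (D + D^T) + (D + D^T) *m F^T + (D - D^T).

Lemma lyap_op_is_linear F : linear (lyap_op F).
Proof.
move=> a u v; rewrite /lyap_op !linearP /= !linearD /= !linearZ /=.
by rewrite !(mulmxDl, mulmxDr, scalerDr, scalerBr, scalerN, opprD, linearZ) /=
  -?scalemxAl -?scalemxAr; apply/matrixP => i j; rewrite !mxE; ring.
Qed.
HB.instance Definition _ F :=
  GRing.isLinear.Build R 'M[R]_n 'M[R]_n _ (lyap_op F) (lyap_op_is_linear F).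

Lemma inj_linear_surj (f : {linear 'M[R]_n -> 'M[R]_n}) :
  (forall D, f D = 0 -> D = 0) -> forall T, exists D, f D = T.
Proof.
move=> inj T.
have : row_free (lin_mx f).
  apply: inj_row_free => v vf.
  have : f (vec_mx v) = 0.
    by apply: (can_inj mxvecK); rewrite -mul_vec_lin vec_mxK vf linear0.
  by move/inj/(congr1 mxvec); rewrite vec_mxK linear0.
rewrite row_free_unit => fu.
exists (vec_mx (mxvec T *m invmx (lin_mx f))).
by apply: (can_inj mxvecK); rewrite -mul_vec_lin vec_mxK mulmxKV.
Qed.

Variables (F X G : 'M[R]_n).
Hypotheses (Xp : posdef X) (Gp : psd G) (FX : F *m X + X *m F^T = - G).
(* [(F, G)] is controllable in the sense of the Hautus test: the rows of [Z]
   span an invariant subspace for [F] that [G] annihilates. *)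
Hypothesis noinv : forall Z L : 'M[R]_n, Z *m F = L *m Z -> Z *m G = 0 -> Z = 0.

(** If [D] were not semidefinite, a multiple of [X] would bring it to a singular semidefinite [E].
    Pairing the equation of [E] with its kernel rows [Z] gives [Z *m T = 0] and [Z *m G = 0], and
    then [Z *m F *m E = 0]: the kernel is invariant under [F] and annihilated by [G], hence zero. *)
Lemma lyap_psd (T D : 'M[R]_n) : psd T -> D^T = D ->
  F *m D + D *m F^T = - T -> psd D.
Proof.
move=> Tp Ds FD; have [//|nD] := pselect (psd D).
have [eta eta0 [Ep [v v0 Ev]]] := psd_boundary Xp Ds nD.
set E := D + eta *: X in Ep Ev.
have etap : psd (eta *: G) by apply: psdZ => //; exact: ltW.
have FE : F *m E + E *m F^T = - (T + eta *: G).
  rewrite /E mulmxDr mulmxDl addrACA FD -scalemxAr -scalemxAl -scalerDr FX.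
  by rewrite scalerN opprD.
set Z := kermx E.
have ZE : Z *m E = 0 by exact: mulmx_ker.
have EZ : E *m Z^T = 0 by rewrite -{1}Ep.1 -trmx_mul ZE trmx0.
have ZGZ : Z *m (T + eta *: G) *m Z^T = 0.
  apply: oppr_inj; rewrite oppr0 -mulNmx -mulmxN -FE mulmxDr mulmxDl.
  by rewrite !mulmxA ZE !mul0mx addr0 -!mulmxA EZ !mulmx0.
have [ZT ZG] := psd_addr_eq0 Tp etap ZGZ.
have ZG0 : Z *m G = 0.
  move: ZG; rewrite -scalemxAr => /eqP; rewrite scaler_eq0 gt_eqF //= => /eqP //.
have : (Z *m F <= Z)%MS.
  apply/sub_kermxP; rewrite -mulmxA; move/(congr1 (mulmx Z)): FE.
  rewrite mulmxDr [Z *m (E *m _)]mulmxA ZE mul0mx addr0 => ->.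
  by rewrite mulmxN mulmxDr ZT ZG addr0 oppr0.
case/submxP => L ZF; have Z0 := noinv ZF ZG0.
have : row_free E by rewrite -kermx_eq0 -/Z Z0.
rewrite row_free_unit => Eu; case/eqP: v0.
by rewrite -(mulKmx Eu v) Ev mulmx0.
Qed.

(** For [T = 0] positivity applies to a symmetric solution and to its negative, which makes
    [lyap_op F] injective, hence surjective. *)
Lemma lyap_solve (T : 'M[R]_n) : T^T = T ->
  exists2 D : 'M[R]_n, D^T = D & F *m D + D *m F^T = - T.
Proof.
move=> Ts.
(* In [lyap_op] the first two summands add up to a symmetric matrix and the last is skew, so an
   equation with symmetric right-hand side splits into two. *)
have parity (S K : 'M[R]_n) : S^T = S -> K^T = - K -> forall U, U^T = U ->
    S + K = U -> S = U /\ K = 0.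
  move=> Ss Ks U Us SKU; have := congr1 trmx SKU; rewrite linearD /= Ss Ks Us => SKU'.
  have K0 : K = 0.
    apply/matrixP => i j; move/matrixP/(_ i j): SKU; move/matrixP/(_ i j): SKU'.
    rewrite !mxE; lra.
  by rewrite -SKU K0 addr0.
have symS (D : 'M[R]_n) : (D + D^T)^T = D + D^T by rewrite linearD /= trmxK addrC.
have symF (D : 'M[R]_n) : D^T = D -> (F *m D + D *m F^T)^T = F *m D + D *m F^T.
  by move=> Ds; rewrite linearD /= !trmx_mul trmxK Ds addrC.
have asym (D : 'M[R]_n) : (D - D^T)^T = - (D - D^T) by rewrite linearB /= trmxK opprB.
have inj D : lyap_op F D = 0 -> D = 0.
  rewrite /lyap_op => H.
  have [H1 H2] := parity _ _ (symF _ (symS D)) (asym D) 0 (trmx0 _ _ _) H.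
  have DD : D^T = D by apply/esym/eqP; rewrite -subr_eq0 H2.
  rewrite DD in H1.
  have DDs : (D + D)^T = D + D by rewrite linearD /= DD.
  have P1 : psd (D + D) by apply: (@lyap_psd 0) => //; rewrite ?oppr0 //; exact: psd0.
  have P2 : psd (- (D + D)).
    apply: (@lyap_psd 0) => //; first exact: psd0.
      by rewrite linearN /= DDs.
    by rewrite mulmxN mulNmx -opprD H1.
  have z x : bil (D + D) x x = 0.
    by apply/eqP; rewrite eq_le -oppr_ge0 -bilN P2.2 P1.2.
  apply/matrixP => i j; rewrite mxE.
  have := psd_cs (delta_mx i 0) (delta_mx j 0) P1; rewrite bil_delta z mul0r mxE.
  by rewrite -[_ + _]mulr2n exprn_even_le0 //= mulrn_eq0 /= => /eqP.
have [D DT] := inj_linear_surj inj (- T).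
have Tns : (- T)^T = - T by rewrite linearN /= Ts.
have [H1 H2] := parity _ _ (symF _ (symS D)) (asym D) _ Tns DT.
by exists (D + D^T).
Qed.

Lemma lyap_posdef (T D : 'M[R]_n) : posdef T -> D^T = D ->
  F *m D + D *m F^T = - T -> posdef D.
Proof.
move=> Tp Ds FD; have Dp := lyap_psd (posdef_psd Tp) Ds FD.
apply/posdefP; split=> // x x0; have := Dp.2 x; rewrite -/(bil D x x).
rewrite le_eqVlt => /predU1P[/esym /(psd_ker Dp) Dx|//].
have := Tp.2 _ x0; have /(congr1 (fun M => bil M x x)) := FD.
rewrite bilN bilD bil_mulr Dx bil_mull Ds Dx -/(bil T x x).
by rewrite bil0r bil0l addr0 => /esym/eqP; rewrite oppr_eq0 => /eqP ->; rewrite ltxx.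
Qed.

End Lyapunov.

(** Congruence by [invmx D] passes from [F] to its transpose, so a certificate for one becomes a
    certificate for the other. *)
Lemma lyap_inv (R : realType) n (F D : 'M[R]_n) : posdef D ->
  F *m D + D *m F^T = - 1%:M ->
  F^T *m invmx D + invmx D *m F^T^T = - (invmx D *m invmx D).
Proof.
move=> Dp FD; have Du := posdef_unit Dp; rewrite trmxK.
transitivity (invmx D *m (F *m D + D *m F^T) *m invmx D).
  rewrite mulmxDr mulmxDl addrC !mulmxA mulVmx // mul1mx -[_ *m D *m _]mulmxA.
  by rewrite mulmxV // mulmx1.
by rewrite FD mulmxN mulmx1 mulNmx.
Qed.

(** * Stability of the closed loop of a Riccati inequality *)

Section RiccatiInequality.
Variables (R : realType) (n : nat) (A W S X E : 'M[R]_n).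
Hypotheses (Wp : psd W) (Sp : psd S) (Xp : posdef X) (Ep : psd E).
Hypothesis ric : A *m X + X *m A^T + W - X *m S *m X = - E.
Hypothesis ctrl : forall Z L : 'M[R]_n, Z *m A = L *m Z -> Z *m W = 0 -> Z = 0.

Let F := A - X *m S.

Lemma riccati_closed_loop : F *m X + X *m F^T = - (W + (X *m S *m X + E)).
Proof.
rewrite -[E in RHS]opprK -ric /F linearB /= trmx_mul Sp.1 Xp.1.
rewrite mulmxBl mulmxBr !mulmxA.
by apply/matrixP => i j; rewrite !mxE; ring.
Qed.

(** A row space invariant under [F] and killed by [W + X S X + E] is killed by each summand; then
    [Z *m X *m S = 0], so [F] and [A] agree on it and [ctrl] applies. *)
Lemma stable_lyap : exists2 D, posdef D & F *m D + D *m F^T = - 1%:M.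
Proof.
have XSXp : psd (X *m S *m X) by apply: psd_congr_sym => //; exact: Xp.1.
have Gp : psd (W + (X *m S *m X + E)) by exact: psdD Wp (psdD XSXp Ep).
have noinv (Z L : 'M[R]_n) : Z *m F = L *m Z ->
    Z *m (W + (X *m S *m X + E)) = 0 -> Z = 0.
  move=> ZF ZG.
  have ZGZ : Z *m (W + (X *m S *m X + E)) *m Z^T = 0 by rewrite ZG mul0mx.
  have [ZW ZSE] := psd_addr_eq0 Wp (psdD XSXp Ep) ZGZ.
  have ZSEZ : Z *m (X *m S *m X + E) *m Z^T = 0 by rewrite ZSE mul0mx.
  have [ZS _] := psd_addr_eq0 XSXp Ep ZSEZ.
  have ZXS : Z *m X *m S = 0.
    apply: psd_ker_mx => //; rewrite trmx_mul Xp.1.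
    by move/(congr1 (mulmxr Z^T)): ZS; rewrite /= mul0mx !mulmxA.
  apply: (@ctrl Z L) => //; rewrite -ZF /F mulmxBr mulmxA ZXS subr0 //.
have [D Ds FD] := lyap_solve Xp Gp riccati_closed_loop noinv (trmx1 R n).
exists D => //.
exact: (lyap_posdef Xp Gp riccati_closed_loop noinv (posdef1 R n) Ds FD).
Qed.

(** The equation is solved for [F^T] with [Y = D^-1] as the reference solution. Its right-hand side
    [Y *m Y] is invertible, so the condition on invariant subspaces is immediate. *)
Lemma stable_lyap_adj T : psd T ->
  exists2 D, psd D & F^T *m D + D *m F = - T.
Proof.
move=> Tp; have [D Dp FD] := stable_lyap; have Du := posdef_unit Dp.
pose Y := invmx D; have Yp : posdef Y by exact: posdef_inv.
have YFY := lyap_inv Dp FD.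
have YYp : posdef (Y *m Y).
  by have := posdef_congr (posdef_unit Yp) (posdef1 R n); rewrite Yp.1 mulmx1.
have noinv (Z L : 'M[R]_n) : Z *m F^T = L *m Z -> Z *m (Y *m Y) = 0 -> Z = 0.
  by move=> _ ZY; rewrite -(mulmxK (posdef_unit YYp) Z) ZY mul0mx.
have [P Ps FP] := lyap_solve Yp (posdef_psd YYp) YFY noinv Tp.1.
exists P; last by rewrite trmxK in FP.
exact: (lyap_psd Yp (posdef_psd YYp) YFY noinv Tp Ps).
Qed.

Lemma stable_lyap_adj1 : exists2 D, posdef D & F^T *m D + D *m F = - 1%:M.
Proof.
have [D Dp FD] := stable_lyap_adj (psd1 R n); exists D => //.
apply/posdefP; split=> [|x x0]; first exact: Dp.1.
have := Dp.2 x; rewrite -/(bil D x x) le_eqVlt => /predU1P[/esym /(psd_ker Dp) Dx|//].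
have := bil11_gt0 x0; have /(congr1 (fun M => bil M x x)) := FD.
rewrite bilN bilD bil_mulr Dx [bil (D *m F) x x]bil_mull Dp.1 Dx bil0r bil0l addr0.
by move=> /esym/eqP; rewrite oppr_eq0 => /eqP ->; rewrite ltxx.
Qed.

End RiccatiInequality.

(** * Calculus of matrix-valued functions *)

Section ScalarCalculus.
Variable R : realType.
Implicit Types (f g : R -> R) (t : R).

Lemma is_derive_add f g t df dg : is_derive t 1 f df -> is_derive t 1 g dg ->
  is_derive t 1 (fun s => f s + g s) (df + dg).
Proof. exact: is_deriveD. Qed.

Lemma is_derive_opp f t df : is_derive t 1 f df -> is_derive t 1 (fun s => - f s) (- df).
Proof. exact: is_deriveN. Qed.

Lemma is_derive_mul f g t df dg : is_derive t 1 f df -> is_derive t 1 g dg ->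
  is_derive t 1 (fun s => f s * g s) (df * g t + f t * dg).
Proof.
move=> hf hg; have H := is_deriveM hf hg; apply: (is_derive_eq H).
by rewrite /GRing.scale /= addrC mulrC.
Qed.

Lemma is_derive_const (c : R) t : is_derive t 1 (fun _ : R => c) 0.
Proof. exact: is_derive_cst. Qed.

Lemma is_derive_bigsum (I : Type) (r : seq I) (P : pred I) (F : I -> R -> R) t (dF : I -> R) :
  (forall i, P i -> is_derive t 1 (F i) (dF i)) ->
  is_derive t 1 (fun s => \sum_(i <- r | P i) F i s) (\sum_(i <- r | P i) dF i).
Proof.
move=> h; elim: r => [|i r IH].
  by under eq_fun do rewrite big_nil; rewrite big_nil; exact: is_derive_const.
under eq_fun do rewrite big_cons; rewrite big_cons.
by case: (boolP (P i)) => // Pi; apply: is_derive_add => //; exact: h.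
Qed.

Lemma continuous_add f g : continuous f -> continuous g ->
  continuous (fun s => f s + g s).
Proof. by move=> hf hg t; apply: cvgD; [exact: hf|exact: hg]. Qed.

Lemma continuous_opp f : continuous f -> continuous (fun s => - f s).
Proof. by move=> hf t; apply: cvgN; exact: hf. Qed.

Lemma continuous_mul f g : continuous f -> continuous g ->
  continuous (fun s => f s * g s).
Proof. by move=> hf hg t; apply: cvgM; [exact: hf|exact: hg]. Qed.

Lemma continuous_const (c : R) : continuous (fun _ : R => c).
Proof. by move=> t; exact: cvg_cst. Qed.

Lemma continuous_bigsum (I : Type) (r : seq I) (P : pred I) (F : I -> R -> R) :
  (forall i, P i -> continuous (F i)) ->
  continuous (fun s => \sum_(i <- r | P i) F i s).
Proof.
move=> h; elim: r => [|i r IH].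
  by under eq_fun do rewrite big_nil; exact: continuous_const.
under eq_fun do rewrite big_cons.
by case: (boolP (P i)) => // Pi; apply: continuous_add => //; exact: h.
Qed.

Lemma continuous_bigprod (I : Type) (r : seq I) (P : pred I) (F : I -> R -> R) :
  (forall i, P i -> continuous (F i)) ->
  continuous (fun s => \prod_(i <- r | P i) F i s).
Proof.
move=> h; elim: r => [|i r IH].
  by under eq_fun do rewrite big_nil; exact: continuous_const.
under eq_fun do rewrite big_cons.
by case: (boolP (P i)) => // Pi; apply: continuous_mul => //; exact: h.
Qed.

Lemma derivable_bigsum (I : Type) (r : seq I) (P : pred I) (F : I -> R -> R) t :
  (forall i, P i -> derivable (F i) t 1) ->
  derivable (fun s => \sum_(i <- r | P i) F i s) t 1.
Proof.
move=> h; elim: r => [|i r IH].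
  by under eq_fun do rewrite big_nil; exact: derivable_cst.
under eq_fun do rewrite big_cons.
by case: (boolP (P i)) => // Pi; apply: derivableD => //; exact: h.
Qed.

Lemma derivable_bigprod (I : Type) (r : seq I) (P : pred I) (F : I -> R -> R) t :
  (forall i, P i -> derivable (F i) t 1) ->
  derivable (fun s => \prod_(i <- r | P i) F i s) t 1.
Proof.
move=> h; elim: r => [|i r IH].
  by under eq_fun do rewrite big_nil; exact: derivable_cst.
under eq_fun do rewrite big_cons.
by case: (boolP (P i)) => // Pi; apply: derivableM => //; exact: h.
Qed.

Definition locally_finite (sw : set R) := forall T : R, exists D : seq R,
  forall t, 0 < t < T -> sw t -> t \in D.

(** Continuity carries the inequality across the exceptional points, where nothing is assumed of the
    derivative; the interval is split at each of them in turn. *)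
Lemma nonincreasing_finite (D : seq R) f a b : a <= b -> continuous f ->
  (forall t, a < t < b -> t \notin D -> exists2 d, is_derive t 1 f d & d <= 0) ->
  f b <= f a.
Proof.
move=> + cf; elim: D a b => [|d D IH] a b ab h.
  have hd t : t \in `]a, b[%R -> exists2 d, is_derive t 1 f d & d <= 0.
    by rewrite in_itv /= => tab; apply: h.
  apply: (@ler0_derive1_le_cc _ f a b) => //; rewrite ?in_itv /= ?lexx ?ab //.
  - by move=> t /hd[d [? _]].
  - by move=> t /hd[d [? e]]; rewrite derive1E e.
  - exact: continuous_subspaceT.
have [/andP[ad db]|dab] := boolP (a < d < b).
  apply: (@le_trans _ _ (f d)); apply: IH; rewrite ?ltW // => t /andP[at' tb] tD.
    apply: h; first by rewrite tb (lt_trans ad).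
    by rewrite inE negb_or tD gt_eqF.
  apply: h; first by rewrite at' (lt_trans tb).
  by rewrite inE negb_or tD lt_eqF.
apply: IH => // t tab tD; apply: h => //; rewrite inE negb_or tD andbT.
by apply: contraNneq dab => <-.
Qed.

Lemma nonincreasing_off (sw : set R) f a b : locally_finite sw -> 0 <= a -> a <= b ->
  continuous f ->
  (forall t, a < t < b -> ~ sw t -> exists2 d, is_derive t 1 f d & d <= 0) ->
  f b <= f a.
Proof.
move=> /(_ b)[D hD] a0 ab cf h; apply: (@nonincreasing_finite D) => // t tab tD.
apply: h => // swt; case/negP: tD; apply: hD => //.
by case/andP: tab => at' ->; rewrite (le_lt_trans a0).
Qed.

Lemma constant_off (sw : set R) f a b : locally_finite sw -> 0 <= a -> a <= b ->
  continuous f -> (forall t, a < t < b -> ~ sw t -> is_derive t 1 f 0) ->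
  f b = f a.
Proof.
move=> swf a0 ab cf h; apply/eqP; rewrite eq_le; apply/andP; split.
  apply: (nonincreasing_off swf) => // t tab swt; exists 0 => //; exact: h.
rewrite -lerN2.
apply: (@nonincreasing_off _ (fun s => - f s) _ _ swf) => //.
  exact: continuous_opp.
move=> t tab swt; exists (- 0); rewrite ?oppr0 //.
by rewrite -[X in is_derive _ _ _ X]oppr0; apply: is_derive_opp; exact: h.
Qed.

Lemma gronwall0 (sw : set R) f K b : locally_finite sw -> 0 <= b ->
  continuous f -> f 0 <= 0 ->
  (forall t, 0 < t < b -> ~ sw t -> exists2 d, is_derive t 1 f d & d <= K * f t) ->
  f b <= 0.
Proof.
move=> swf b0 cf f0 h.
pose E s : R := expR (- K * s).
have dl t : is_derive t 1 (fun s : R => - K * s) (- K).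
  have H := is_derive_mul (is_derive_const (- K) t) (is_derive_id t 1).
  by apply: (is_derive_eq H); rewrite mul0r add0r mulr1.
have dE t : is_derive t 1 E (- K * E t).
  have H := is_derive1_comp (is_derive_expR (- K * t)) (dl t).
  by apply: (is_derive_eq H); rewrite mulrC.
have cE : continuous E.
  move=> t; apply: differentiable_continuous; apply/derivable1_diffP.
  by case: (dE t).
have Ef : E b * f b <= E 0 * f 0.
  apply: (@nonincreasing_off sw (fun s => E s * f s)) => //.
    exact: continuous_mul.
  move=> t tb swt; have [d fd dK] := h t tb swt.
  exists (- K * E t * f t + E t * d); first exact: is_derive_mul.
  have -> : - K * E t * f t + E t * d = E t * (d - K * f t) by ring.
  by rewrite pmulr_rle0 ?expR_gt0 // subr_le0.
have : E b * f b <= 0.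
  by apply: le_trans Ef _; rewrite pmulr_rle0 ?expR_gt0.
by rewrite pmulr_rle0 ?expR_gt0.
Qed.

Lemma continuous_bounded f T : 0 <= T -> continuous f ->
  exists c, forall t, 0 <= t <= T -> `|f t| <= c.
Proof.
move=> T0 cf; have cn : {within `[0, T], continuous (fun s => `|f s|)}.
  apply: continuous_subspaceT => t; apply: cvg_norm; exact: cf.
have [c _ h] := EVT_max T0 cn; exists `|f c| => t tT; apply: h.
by rewrite in_itv.
Qed.

End ScalarCalculus.

Section MatrixCalculus.
Variable R : realType.

(* Entrywise, so that the rectangular product rule needs no bilinear maps. *)
Definition mx_derive m n (M : R -> 'M[R]_(m, n)) (t : R) (M' : 'M[R]_(m, n)) :=
  forall i j, is_derive t 1 (fun s => M s i j) (M' i j).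

Definition mx_continuous m n (M : R -> 'M[R]_(m, n)) :=
  forall i j, continuous (fun s => M s i j).

Lemma is_derive_mx_derive m n (M : R -> 'M[R]_(m, n)) (t : R) (M' : 'M[R]_(m, n)) :
  is_derive t 1 M M' -> mx_derive M t M'.
Proof.
move=> [dM <-] i j; apply: DeriveDef; first by move/derivable_mxP: dM.
by rewrite derive_mx // mxE.
Qed.

Lemma continuous_mx m n (M : R -> 'M[R]_(m, n)) : continuous M -> mx_continuous M.
Proof.
move=> cM i j t; apply: (@continuous_comp _ _ _ M (fun Z : 'M[R]_(m, n) => Z i j)).
  exact: cM.
exact: coord_continuous.
Qed.

Lemma mx_derive_eq m n (M : R -> 'M[R]_(m, n)) t M' M'' :
  mx_derive M t M' -> M' = M'' -> mx_derive M t M''.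
Proof. by move=> ? <-. Qed.

Lemma mx_derive_add m n (M N : R -> 'M[R]_(m, n)) t M' N' :
  mx_derive M t M' -> mx_derive N t N' ->
  mx_derive (fun s => M s + N s) t (M' + N').
Proof.
move=> hM hN i j; rewrite mxE; under eq_fun do rewrite mxE; exact: is_derive_add.
Qed.

Lemma mx_derive_opp m n (M : R -> 'M[R]_(m, n)) t M' :
  mx_derive M t M' -> mx_derive (fun s => - M s) t (- M').
Proof.
move=> hM i j; rewrite mxE; under eq_fun do rewrite mxE; exact: is_derive_opp.
Qed.

Lemma mx_derive_sub m n (M N : R -> 'M[R]_(m, n)) t M' N' :
  mx_derive M t M' -> mx_derive N t N' ->
  mx_derive (fun s => M s - N s) t (M' - N').
Proof. by move=> hM hN; apply: mx_derive_add => //; exact: mx_derive_opp. Qed.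

Lemma mx_derive_const m n (M : 'M[R]_(m, n)) t : mx_derive (fun _ => M) t 0.
Proof. move=> i j; rewrite mxE; exact: is_derive_const. Qed.

Lemma mx_derive_tr m n (M : R -> 'M[R]_(m, n)) t M' :
  mx_derive M t M' -> mx_derive (fun s => (M s)^T) t M'^T.
Proof. by move=> hM i j; rewrite mxE; under eq_fun do rewrite mxE; exact: hM. Qed.

Lemma mx_derive_mul m n p (M : R -> 'M[R]_(m, n)) (N : R -> 'M[R]_(n, p)) t M' N' :
  mx_derive M t M' -> mx_derive N t N' ->
  mx_derive (fun s => M s *m N s) t (M' *m N t + M t *m N').
Proof.
move=> hM hN i j; rewrite !mxE; under eq_fun do rewrite mxE.
rewrite -big_split /=; apply: is_derive_bigsum => k _; exact: is_derive_mul.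
Qed.

Lemma mx_derive_mull m n p (M : 'M[R]_(m, n)) (N : R -> 'M[R]_(n, p)) t N' :
  mx_derive N t N' -> mx_derive (fun s => M *m N s) t (M *m N').
Proof.
move=> hN; apply: mx_derive_eq; first exact: (mx_derive_mul (mx_derive_const M t) hN).
by rewrite mul0mx add0r.
Qed.

Lemma mx_derive_mulr m n p (M : R -> 'M[R]_(m, n)) (N : 'M[R]_(n, p)) t M' :
  mx_derive M t M' -> mx_derive (fun s => M s *m N) t (M' *m N).
Proof.
move=> hM; apply: mx_derive_eq; first exact: (mx_derive_mul hM (mx_derive_const N t)).
by rewrite mulmx0 addr0.
Qed.

Lemma mx_derive_scale m n (f : R -> R) (N : R -> 'M[R]_(m, n)) (t df : R) N' :
  is_derive t 1 f df -> mx_derive N t N' ->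
  mx_derive (fun s => f s *: N s) t (df *: N t + f t *: N').
Proof.
move=> hf hN i j; rewrite !mxE; under eq_fun do rewrite mxE; exact: is_derive_mul.
Qed.

Lemma mx_derive_scalel m n (f : R -> R) (N : 'M[R]_(m, n)) (t df : R) :
  is_derive t 1 f df -> mx_derive (fun s => f s *: N) t (df *: N).
Proof.
move=> hf; apply: mx_derive_eq; first exact: (mx_derive_scale hf (mx_derive_const N t)).
by rewrite scaler0 addr0.
Qed.

Lemma mx_derive_sum m n (I : Type) (r : seq I) (P : pred I)
    (F : I -> R -> 'M[R]_(m, n)) t (dF : I -> 'M[R]_(m, n)) :
  (forall i, P i -> mx_derive (F i) t (dF i)) ->
  mx_derive (fun s => \sum_(i <- r | P i) F i s) t (\sum_(i <- r | P i) dF i).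
Proof.
move=> h i j; rewrite summxE; under eq_fun do rewrite summxE.
by apply: is_derive_bigsum => k Pk; exact: h.
Qed.

Lemma is_derive_mxtrace n (M : R -> 'M[R]_n) (t : R) M' :
  mx_derive M t M' -> is_derive t 1 (fun s => \tr (M s)) (\tr M').
Proof. by move=> hM; apply: is_derive_bigsum => i _; exact: hM. Qed.

Lemma is_derive_bil n (M : R -> 'M[R]_n) x y (t : R) M' :
  mx_derive M t M' -> is_derive t 1 (fun s => bil (M s) x y) (bil M' x y).
Proof.
move=> hM; apply: (mx_derive_mulr (M := fun s => x^T *m M s)).
exact: mx_derive_mull.
Qed.

Lemma mx_continuous_add m n (M N : R -> 'M[R]_(m, n)) :
  mx_continuous M -> mx_continuous N -> mx_continuous (fun s => M s + N s).
Proof. by move=> ? ? i j; under eq_fun do rewrite mxE; exact: continuous_add. Qed.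

Lemma mx_continuous_opp m n (M : R -> 'M[R]_(m, n)) :
  mx_continuous M -> mx_continuous (fun s => - M s).
Proof. by move=> ? i j; under eq_fun do rewrite mxE; exact: continuous_opp. Qed.

Lemma mx_continuous_sub m n (M N : R -> 'M[R]_(m, n)) :
  mx_continuous M -> mx_continuous N -> mx_continuous (fun s => M s - N s).
Proof. by move=> ? ?; apply: mx_continuous_add => //; exact: mx_continuous_opp. Qed.

Lemma mx_continuous_const m n (M : 'M[R]_(m, n)) : mx_continuous (fun _ => M).
Proof. by move=> i j; exact: continuous_const. Qed.

Lemma mx_continuous_tr m n (M : R -> 'M[R]_(m, n)) :
  mx_continuous M -> mx_continuous (fun s => (M s)^T).
Proof. by move=> h i j; under eq_fun do rewrite mxE; exact: h. Qed.

Lemma mx_continuous_mul m n p (M : R -> 'M[R]_(m, n)) (N : R -> 'M[R]_(n, p)) :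
  mx_continuous M -> mx_continuous N -> mx_continuous (fun s => M s *m N s).
Proof.
move=> hM hN i j; under eq_fun do rewrite mxE.
by apply: continuous_bigsum => k _; exact: continuous_mul.
Qed.

Lemma mx_continuous_scale m n (f : R -> R) (N : R -> 'M[R]_(m, n)) :
  continuous f -> mx_continuous N -> mx_continuous (fun s => f s *: N s).
Proof. by move=> ? ? i j; under eq_fun do rewrite mxE; exact: continuous_mul. Qed.

Lemma mx_continuous_sum m n (I : Type) (r : seq I) (P : pred I)
    (F : I -> R -> 'M[R]_(m, n)) :
  (forall i, P i -> mx_continuous (F i)) ->
  mx_continuous (fun s => \sum_(i <- r | P i) F i s).
Proof.
move=> h i j; under eq_fun do rewrite summxE.
by apply: continuous_bigsum => k Pk; exact: h.
Qed.

Lemma continuous_mxtrace n (M : R -> 'M[R]_n) :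
  mx_continuous M -> continuous (fun s => \tr (M s)).
Proof. by move=> hM; apply: continuous_bigsum => i _; exact: hM. Qed.

Lemma continuous_bil n (M : R -> 'M[R]_n) x y :
  mx_continuous M -> continuous (fun s => bil (M s) x y).
Proof.
move=> hM; have cx := mx_continuous_mul (mx_continuous_const (M := x^T)) hM.
exact: (mx_continuous_mul cx (mx_continuous_const (M := y))).
Qed.

Lemma mx_continuous_bounded m n (M : R -> 'M[R]_(m, n)) T : 0 <= T ->
  mx_continuous M -> exists2 c, 0 <= c & forall t, 0 <= t <= T -> `|M t| <= c.
Proof.
move=> T0 hM.
have /choice[b hb] : forall ij : 'I_m * 'I_n, exists c, forall t, 0 <= t <= T ->
    `|M t ij.1 ij.2| <= c.
  by move=> ij; exact: continuous_bounded T0 (hM _ _).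
have c0 : 0 <= \sum_ij `|b ij| by apply: sumr_ge0.
exists (\sum_ij `|b ij|) => // t tT.
apply: mx_norm_le => // i j; apply: le_trans (hb (i, j) t tT) _.
apply: le_trans (ler_norm _) _.
by rewrite (bigD1 (i, j)) //= lerDl sumr_ge0.
Qed.

Lemma continuous_det n (M : R -> 'M[R]_n) :
  mx_continuous M -> continuous (fun s => \det (M s)).
Proof.
move=> hM; apply: continuous_bigsum => s _; apply: continuous_mul.
  exact: continuous_const.
by apply: continuous_bigprod => i _; exact: hM.
Qed.

Lemma derivable_det n (M : R -> 'M[R]_n) (t : R) :
  (forall i j, derivable (fun s => M s i j) t 1) ->
  derivable (fun s => \det (M s)) t 1.
Proof.
move=> hM; apply: derivable_bigsum => s _; apply: derivableM.
  exact: derivable_cst.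
by apply: derivable_bigprod => i _; exact: hM.
Qed.

Lemma invmx_entry n (M : 'M[R]_n) i j : M \in unitmx ->
  invmx M i j = (\det M)^-1 * cofactor M j i.
Proof. by rewrite /invmx => ->; rewrite !mxE. Qed.

Lemma mx_continuous_inv n (M : R -> 'M[R]_n) : (forall t, M t \in unitmx) ->
  mx_continuous M -> mx_continuous (fun s => invmx (M s)).
Proof.
move=> uM hM i j; under eq_fun do rewrite invmx_entry //.
apply: continuous_mul.
  move=> t; apply: cvgV; last exact: continuous_det.
  by rewrite -unitfE -unitmxE.
apply: continuous_mul; first exact: continuous_const.
by apply: continuous_det => k l; under eq_fun do rewrite !mxE; exact: hM.
Qed.

(** The cofactor formula shows that the entries are differentiable; the value then follows by
    differentiating [M^-1 M = 1]. *)
Lemma mx_derive_inv n (M : R -> 'M[R]_n) (t : R) M' : (forall t, M t \in unitmx) ->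
  mx_derive M t M' ->
  mx_derive (fun s => invmx (M s)) t (- (invmx (M t) *m M' *m invmx (M t))).
Proof.
move=> uM hM.
have dM i j : derivable (fun s => M s i j) t 1 by case: (hM i j).
pose Y' : 'M[R]_n := \matrix_(i, j) 'D_1 (fun s => invmx (M s) i j) t.
have hY : mx_derive (fun s => invmx (M s)) t Y'.
  move=> i j; rewrite mxE; apply: derivableP.
  under eq_fun do rewrite invmx_entry //.
  apply: derivableM.
    apply: derivableV; last exact: derivable_det.
    by rewrite -unitfE -unitmxE.
  apply: derivableM; first exact: derivable_cst.
  by apply: derivable_det => k l; under eq_fun do rewrite !mxE; exact: dM.
apply: (mx_derive_eq hY).
have H : Y' *m M t + invmx (M t) *m M' = 0.
  apply/matrixP => i j.
  have := mx_derive_mul hY hM i j; under eq_fun do rewrite mulVmx //.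
  move=> [_ <-]; have [_ ->] := is_derive_const ((1%:M : 'M[R]_n) i j) t.
  by rewrite mxE.
rewrite -mulNmx; apply: (canRL (mulmxK (uM t))).
by apply/eqP; rewrite -addr_eq0 H.
Qed.

End MatrixCalculus.

(** * Primitives, uniqueness and positivity *)

Section Primitive.
Variable R : realType.
Notation mu := (@lebesgue_measure R).

(** The integral over [[0, t]] is zero for [t <= 0], so for locally integrable [f] this is
    continuous on the whole line, as the monotonicity lemmas require. *)
Definition primitive (f : R -> R) (t : R) : R := parameterized_integral mu 0 t f.

Definition locally_integrable0 (f : R -> R) :=
  forall T : R, mu.-integrable `[0, T] (EFin \o f).

Lemma primitive_le0 f t : t <= 0 -> primitive f t = 0.
Proof.
rewrite /primitive /parameterized_integral le_eqVlt => /predU1P[->|t0].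
  by rewrite set_itv1 Rintegral_set1.
by rewrite set_itv_ge ?Rintegral_set0 // bnd_simp -ltNge.
Qed.

Lemma primitive_continuous f : locally_integrable0 f -> continuous (primitive f).
Proof.
move=> fi t; have [t0|t0|->] := ltgtP t 0.
- rewrite /continuous_at primitive_le0 ?ltW //.
  apply: cvg_near_cst; near=> s; rewrite primitive_le0 // ltW //.
  by near: s; exact: lt_nbhsl.
- have ab : 0 < t + 1 by rewrite ltr_wpDl // ltW.
  have := parameterized_integral_continuous (ltW ab) (fi _).
  move/(continuous_within_itvP _ ab) => [h _ _]; apply: h.
  by rewrite in_itv /= t0 ltrDl ltr01.
- have := parameterized_integral_continuous ler01 (fi 1).
  move/(continuous_within_itvP _ ltr01) => [_ h _].
  apply/left_right_continuousP; split => //.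
  rewrite primitive_le0 //; apply: cvg_near_cst; near=> s.
  by rewrite primitive_le0.
Unshelve. all: by end_near. Qed.

Lemma is_derive_primitive f t : locally_integrable0 f -> 0 < t ->
  {for t, continuous f} -> is_derive t 1 (primitive f) (f t).
Proof.
move=> fi t0 cf; have tu : t < t + 1 by rewrite ltrDl.
have [h <-] := continuous_FTC1_closed tu (fi _) t0 cf.
by rewrite derive1E; apply: derivableP.
Qed.

Lemma continuous_locally_integrable0 f : continuous f -> locally_integrable0 f.
Proof.
move=> cf T; apply: continuous_compact_integrable; first exact: segment_compact.
exact: continuous_subspaceT.
Qed.

End Primitive.

Section Extension.
Variable R : realType.

(** The filter is given on [[0, +oo[] only; extended by its initial value it can be handled as a
    continuous function on the whole line. *)
Lemma continuous_max0 (V : pseudoMetricNormedZmodType R) (f : R -> V) :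
  {within `[0, +oo[, continuous f} -> continuous (fun t : R => f (Num.max 0 t)).
Proof.
move=> /continuous_within_itvcyP[cf f0] t; have [t0|t0|->] := ltgtP t 0.
- rewrite /continuous_at (max_idPl (ltW t0)).
  apply: cvg_near_cst; near=> s.
  rewrite (max_idPl (ltW _)) //; near: s; exact: lt_nbhsl.
- rewrite /continuous_at (max_idPr (ltW t0)).
  have := cf t; rewrite in_itv /= t0 => /(_ isT); apply: cvg_trans.
  apply: near_eq_cvg; near=> s.
  rewrite (max_idPr (ltW _)) //; near: s; exact: lt_nbhsr.
- apply/left_right_continuousP; split; rewrite maxxx.
    apply: cvg_near_cst; near=> s.
    have h : s <= 0 by near: s; exact: nbhs_left_le.
    by rewrite (max_idPl h).
  move: f0; apply: cvg_trans; apply: near_eq_cvg; near=> s.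
    have h : 0 <= s by near: s; exact: nbhs_right_ge.
    by rewrite (max_idPr h).
Unshelve. all: by end_near. Qed.

Lemma continuous_clamp (V : pseudoMetricNormedZmodType R) (f : R -> V) b : 0 < b ->
  {within `[0, b], continuous f} ->
  continuous (fun t : R => f (Num.min b (Num.max 0 t))).
Proof.
move=> b0 /(continuous_within_itvP _ b0)[cf f0 fb] t.
apply: (@continuous_max0 _ (fun t : R => f (Num.min b t))).
apply/continuous_within_itvcyP; split=> [s|]; last first.
  rewrite (min_idPr (ltW b0)); move: f0; apply: cvg_trans; apply: near_eq_cvg.
  near=> s.
    have h : s <= b by near: s; exact: nbhs_right_le.
    by rewrite (min_idPr h).
rewrite in_itv /= andbT => s0; have [sb|sb|->] := ltgtP s b.
- rewrite /continuous_at (min_idPr (ltW sb)).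
  have := cf s; rewrite in_itv /= s0 sb => /(_ isT); apply: cvg_trans.
  apply: near_eq_cvg; near=> u.
  rewrite (min_idPr (ltW _)) //; near: u; exact: lt_nbhsl.
- rewrite /continuous_at (min_idPl (ltW sb)).
  apply: cvg_near_cst; near=> u.
  rewrite (min_idPl (ltW _)) //; near: u; exact: lt_nbhsr.
- apply/left_right_continuousP; split; rewrite minxx.
    move: fb; apply: cvg_trans; apply: near_eq_cvg; near=> u.
    have h : u <= b by near: u; exact: nbhs_left_le.
    by rewrite (min_idPr h).
  apply: cvg_near_cst; near=> u.
    have h : b <= u by near: u; exact: nbhs_right_ge.
    by rewrite (min_idPl h).
Unshelve. all: by end_near. Qed.

Lemma is_derive_max0 (V : normedModType R) (f : R -> V) (t : R) df : 0 < t ->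
  is_derive t 1 f df -> is_derive t 1 (fun t : R => f (Num.max 0 t)) df.
Proof.
move=> t0; apply: near_eq_is_derive; near=> s; rewrite (max_idPr _) // ltW //.
by near: s; exact: lt_nbhsr.
Unshelve. all: by end_near. Qed.

Lemma is_derive_clamp (V : normedModType R) (f : R -> V) (t b : R) df : 0 < t < b ->
  is_derive t 1 f df ->
  is_derive t 1 (fun t : R => f (Num.min b (Num.max 0 t))) df.
Proof.
move=> /andP[t0 tb]; apply: near_eq_is_derive; near=> s.
rewrite (max_idPr _) ?(min_idPr _) // ltW //.
  by near: s; exact: lt_nbhsl.
by near: s; exact: lt_nbhsr.
Unshelve. all: by end_near. Qed.

End Extension.

(** * Uniqueness for linear equations and the invariant subspace test *)

Section Uniqueness.
Variable R : realType.

Lemma trmx_mul_tr m n (D : 'M[R]_(m, n)) : \tr (D^T *m D) = \sum_j \sum_i D i j ^+ 2.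
Proof.
by apply: eq_bigr => j _; rewrite mxE; apply: eq_bigr => i _; rewrite mxE expr2.
Qed.

Lemma norm_sq_tr m n (D : 'M[R]_(m, n)) : `|D| ^+ 2 <= \tr (D^T *m D).
Proof.
have t0 : 0 <= \tr (D^T *m D).
  rewrite trmx_mul_tr; apply: sumr_ge0 => j _; apply: sumr_ge0 => i _.
  exact: sqr_ge0.
rewrite -(sqr_sqrtr t0) ler_pXn2r ?nnegrE ?sqrtr_ge0 //.
apply: mx_norm_le => [|i j]; first exact: sqrtr_ge0.
rewrite -sqrtr_sqr ler_wsqrtr // trmx_mul_tr (bigD1 j) //= (bigD1 i) //=.
rewrite -addrA lerDl addr_ge0 ?sumr_ge0 // => k _; first exact: sqr_ge0.
by apply: sumr_ge0 => l _; exact: sqr_ge0.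
Qed.

(** The maximum norm need not be differentiable, but the trace of [D^T D] is; it dominates the
    square of that norm and obeys a scalar Gronwall inequality. *)
Lemma mx_gronwall0 (sw : set R) m n (D : R -> 'M[R]_(m, n)) K b :
  locally_finite sw -> 0 <= K -> 0 <= b -> mx_continuous D -> D 0 = 0 ->
  (forall t, 0 < t < b -> ~ sw t ->
     exists2 D', mx_derive D t D' & `|D'| <= K * `|D t|) ->
  D b = 0.
Proof.
move=> swf K0 b0 cD D0 h.
pose f t := \tr ((D t)^T *m D t).
have fb : f b <= 0.
  apply: (@gronwall0 _ sw _ (2 * (n%:R * m%:R * K))) => //.
  - apply: continuous_mxtrace; apply: mx_continuous_mul => //.
    exact: mx_continuous_tr.
  - by rewrite /f D0 mulmx0 mxtrace0.
  move=> t tb swt; have [D' dD D'K] := h t tb swt.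
  eexists; first exact: (is_derive_mxtrace (mx_derive_mul (mx_derive_tr dD) dD)).
  rewrite mxtraceD.
  have -> : \tr (D'^T *m D t) = \tr ((D t)^T *m D').
    by rewrite -mxtrace_tr trmx_mul trmxK.
  suff : \tr ((D t)^T *m D') <= n%:R * m%:R * K * f t by lra.
  apply: le_trans (ler_norm _) _; apply: le_trans (mxtrace_norm _) _.
  rewrite -!mulrA; apply: ler_wpM2l => //.
  apply: le_trans (mulmx_norm _ _) _; rewrite trmx_norm -mulrA.
  apply: ler_wpM2l => //; apply: (@le_trans _ _ (K * `|D t| ^+ 2)).
    by rewrite expr2 mulrCA; apply: ler_wpM2l.
  by apply: ler_wpM2l => //; exact: norm_sq_tr.
apply/eqP; rewrite -normr_eq0 -sqrf_eq0 eq_le sqr_ge0 andbT.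
exact: le_trans (norm_sq_tr _) fb.
Qed.

Lemma locally_finite0 : locally_finite (set0 : set R).
Proof. by move=> T; exists [::]. Qed.

(** [Z W Z^T] is the Gram matrix of [H Z^T], so [Z] annihilates the input matrix [H]. Along a
    trajectory from [0] the product [Z x] then solves [y' = L y] with [y 0 = 0], so [Z] annihilates
    every reachable state, that is, every vector. *)
Lemma controllable_noinv n (A W H : 'M[R]_n) : is_psd_sqrt W H -> controllable A H ->
  forall Z L : 'M[R]_n, Z *m A = L *m Z -> Z *m W = 0 -> Z = 0.
Proof.
move=> [Hp HW] ctrl Z L ZA ZW.
have ZH : Z *m H = 0.
  have e : (H *m Z^T)^T *m (H *m Z^T) = 0.
    by rewrite trmx_mul trmxK Hp.1 -mulmxA [H *m (H *m _)]mulmxA HW mulmxA ZW mul0mx.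
  have : `|H *m Z^T| = 0.
    apply/eqP; rewrite -sqrf_eq0 eq_le sqr_ge0 andbT.
    by apply: le_trans (norm_sq_tr _) _; rewrite e mxtrace0.
  by move/normr0_eq0/(congr1 trmx); rewrite trmx_mul trmxK Hp.1 trmx0.
suff Zx (x1 : 'cV_n) : Z *m x1 = 0.
  apply/matrixP => i j; rewrite [RHS]mxE -bil_delta /bil -mulmxA Zx mulmx0 mxE //.
have [tf [u [x [tf0 _ cx [x0 <-] dx]]]] := ctrl 0 x1.
pose y t := Z *m x (Num.min tf (Num.max 0 t)).
have cy : mx_continuous y.
  apply: mx_continuous_mul; first exact: mx_continuous_const.
  by apply: continuous_mx; exact: continuous_clamp.
have dy t : 0 < t < tf -> mx_derive y t (L *m y t).
  move=> tb; have h := is_derive_mx_derive (is_derive_clamp tb (dx t tb)).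
  apply: (mx_derive_eq (mx_derive_mull Z h)); case/andP: tb => t0 tb.
  rewrite /y (max_idPr (ltW t0)) (min_idPr (ltW tb)).
  by rewrite mulmxDr !mulmxA ZA ZH mul0mx addr0.
have -> : Z *m x tf = y tf by rewrite /y (max_idPr (ltW tf0)) minxx.
have y0 : y 0 = 0 by rewrite /y maxxx (min_idPr (ltW tf0)) x0 mulmx0.
apply: (@mx_gronwall0 _ _ _ y (n%:R * `|L|) tf locally_finite0 _ (ltW tf0) cy y0).
  by rewrite mulr_ge0.
move=> t tb _; exists (L *m y t); first exact: dy.
exact: mulmx_norm.
Qed.

End Uniqueness.

Section Near.
Variable R : realType.

Lemma continuous_lt (f : R -> R) x c : continuous f -> f x < c ->
  exists2 d, 0 < d & forall y, `|y - x| < d -> f y < c.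
Proof.
move=> cf fx; have : nbhs x [set y | f y < c] by exact: (cvgr_lt (f x) (cf x)).
move=> /nbhs_ballP[d /= d0 hd].
by exists d => // y yx; apply: hd; rewrite /ball /= distrC.
Qed.

Lemma mx_continuous_near m n (M : R -> 'M[R]_(m, n)) x e : mx_continuous M ->
  0 < e -> exists2 d, 0 < d & forall y, `|y - x| < d -> `|M y - M x| <= e.
Proof.
move=> cM e0; pose f y := \sum_(ij : 'I_m * 'I_n) `|M y ij.1 ij.2 - M x ij.1 ij.2|.
have cf : continuous f.
  apply: continuous_bigsum => -[i j] _ t; apply: cvg_norm.
  by apply: cvgB; [exact: cM|exact: cvg_cst].
have fx : f x < e by rewrite /f big1 // => ij _; rewrite subrr normr0.
have [d d0 hd] := continuous_lt cf fx; exists d => // y /hd /ltW; apply: le_trans.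
apply: mx_norm_le => [|i j]; first by apply: sumr_ge0.
rewrite /f (bigD1 (i, j)) //= !mxE lerDl; exact: sumr_ge0.
Qed.

End Near.

(** Half of the quadratic term goes to each side, which leaves a Lyapunov equation with drift [G].
    With [e' = - K e] the shifted matrix [Z - e I] satisfies one too, with the extra term
    [e (G + G^T + K)], positive for large [K]. *)
Lemma riccati_shift (R : realType) n (A W S Z : 'M[R]_n) (e K : R) :
  Z^T = Z -> S^T = S -> let G := A - 2^-1 *: (Z *m S) in
  A *m Z + Z *m A^T + W - Z *m S *m Z - (- K * e) *: 1%:M =
  G *m (Z - e *: 1%:M) + (Z - e *: 1%:M) *m G^T + W + e *: (G + G^T + K%:M).
Proof.
move=> Zs Ss /=; rewrite -[K%:M]scalemx1.
have -> : (A - 2^-1 *: (Z *m S))^T = A^T - 2^-1 *: (S *m Z).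
  by rewrite linearB /= linearZ /= trmx_mul Zs Ss.
rewrite !(mulmxDr, mulmxDl, mulmxN, mulNmx) -!scalemxAl -!scalemxAr !mulmx1 !mul1mx.
rewrite !mulmxA.
by apply/matrixP => i j; rewrite !mxE; field.
Qed.

(** * Symmetry and positivity of Riccati solutions *)

Section Riccati.
Variables (R : realType) (n : nat) (sw : set R) (A W : 'M[R]_n).
Variables (S Sigma : R -> 'M[R]_n) (cS : R).
Hypothesis swf : locally_finite sw.
Hypothesis Wp : psd W.
Hypothesis Sp : forall t : R, 0 < t -> psd (S t).
Hypothesis Sb : forall t : R, 0 < t -> `|S t| <= cS.
Hypothesis cSigma : mx_continuous Sigma.
Hypothesis Sigma0 : posdef (Sigma 0).
Hypothesis dSigma : forall t : R, 0 < t -> ~ sw t ->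
  mx_derive Sigma t (A *m Sigma t + Sigma t *m A^T + W - Sigma t *m S t *m Sigma t).

(** The difference of [Sigma] and its transpose solves a homogeneous linear equation with bounded
    coefficients and starts at zero. *)
Lemma riccati_sym (t : R) : 0 <= t -> (Sigma t)^T = Sigma t.
Proof.
move=> t0.
have [c c0 hc] := mx_continuous_bounded t0 cSigma.
pose D (t : R) := Sigma t - (Sigma t)^T.
suff : D t = 0 by move/eqP; rewrite subr_eq0 => /eqP <-.
pose K := 2 * (n%:R * `|A|) + 2 * (n%:R * (n%:R * `|cS| * c)).
apply: (@mx_gronwall0 _ sw _ _ D K) => //.
- by rewrite addr_ge0 // ?mulr_ge0.
- by apply: mx_continuous_sub => //; exact: mx_continuous_tr.
- by rewrite /D Sigma0.1 subrr.
move=> s /andP[s0 st] sws.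
have ds := dSigma s0 sws.
exists (A *m D s + D s *m A^T - (D s *m (S s *m Sigma s) + ((Sigma s)^T *m S s) *m D s)).
  apply: (mx_derive_eq (mx_derive_sub ds (mx_derive_tr ds))).
  rewrite /D linearB /= !linearD /= !trmx_mul !trmxK.
  rewrite (Sp s0).1 Wp.1 !(mulmxDr, mulmxDl, mulmxN, mulNmx) !mulmxA.
  by apply/matrixP => i j; rewrite !mxE; ring.
have sT : 0 <= s <= t by rewrite !ltW.
have nS := hc _ sT.
have nSS : `|S s *m Sigma s| <= n%:R * `|cS| * c.
  apply: le_trans (mulmx_norm _ _) _; apply: ler_pM => //.
  by apply: ler_wpM2l => //; apply: le_trans (Sb s0) (ler_norm _).
have nSS' : `|(Sigma s)^T *m S s| <= n%:R * `|cS| * c.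
  by rewrite -(trmx_norm (_ *m _)) trmx_mul trmxK (Sp s0).1.
have n1 : `|A *m D s| <= n%:R * `|A| * `|D s| by exact: mulmx_norm.
have n2 : `|D s *m A^T| <= n%:R * `|A| * `|D s|.
  by rewrite mulrAC; apply: le_trans (mulmx_norm _ _) _; rewrite trmx_norm.
have n3 : `|D s *m (S s *m Sigma s)| <= n%:R * (n%:R * `|cS| * c) * `|D s|.
  rewrite mulrAC; apply: le_trans (mulmx_norm _ _) _.
  by apply: ler_wpM2l => //; exact: mulr_ge0.
have n4 : `|(Sigma s)^T *m S s *m D s| <= n%:R * (n%:R * `|cS| * c) * `|D s|.
  apply: le_trans (mulmx_norm _ _) _.
  by apply: ler_wpM2r => //; exact: ler_wpM2l.
have := ler_normD (A *m D s) (D s *m A^T).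
have := ler_normD (D s *m (S s *m Sigma s)) ((Sigma s)^T *m S s *m D s).
by move=> h1 h2; apply: le_trans (ler_normB _ _) _; rewrite /K; lra.
Qed.

(* At the first time at which [Sigma t - eta e^(-Kt) I] becomes singular, its
   derivative along the kernel is positive because [K] dominates the drift. *)
Lemma riccati_posdef (t : R) : 0 <= t -> posdef (Sigma t).
Proof.
move=> b0; have [//|nb] := pselect (posdef (Sigma t)); exfalso.
move: t b0 nb => b b0 nb.
have [c c0 hc] := mx_continuous_bounded b0 cSigma.
pose G (s : R) := A - 2^-1 *: (Sigma s *m S s).
pose g := `|A| + 2^-1 * (n%:R * c * `|cS|).
have g0 : 0 <= g by rewrite addr_ge0 // !mulr_ge0 // invr_ge0.
have Gg s : 0 < s <= b -> `|G s| <= g.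
  move=> /andP[s0 sb]; apply: le_trans (ler_normB _ _) _; apply: lerD => //.
  rewrite normrZ ger0_norm; last by rewrite invr_ge0.
  apply: ler_wpM2l; first by rewrite invr_ge0.
  apply: le_trans (mulmx_norm _ _) _; apply: ler_pM; rewrite ?mulr_ge0 //.
    by apply: ler_wpM2l => //; apply: hc; rewrite sb ltW.
  by apply: le_trans (Sb s0) (ler_norm _).
have GE s : G s = A - 2^-1 *: (Sigma s *m S s) by [].
clearbody G.
(* [n%:R * g] bounds the form of [G s], so [G s + (G s)^T + K%:M] is at least the identity. *)
pose K : R := 2 * (n%:R * g) + 1.
have [m m0 hm] := posdef_coercive Sigma0.
pose eta := m / 2.
have eta0 : 0 < eta by rewrite divr_gt0.
pose E (s : R) : R := eta * expR (- K * s).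
have E0 s : 0 < E s by rewrite mulr_gt0 // expR_gt0.
have dE (s : R) : is_derive s 1 E (- K * E s).
  have H1 := is_derive_mul (is_derive_const (- K) s) (is_derive_id s 1).
  have H2 := is_derive1_comp (is_derive_expR (- K * s)) H1.
  have H3 := is_derive_mul (is_derive_const eta s) H2.
  by apply: (is_derive_eq H3); rewrite /E; ring.
have cE : continuous E.
  move=> s; apply: differentiable_continuous; apply/derivable1_diffP.
  by case: (dE s).
have E00 : E 0 = eta by rewrite /E mulr0 expR0 mulr1.
have Emono s : s <= b -> E b <= E s.
  move=> sb; rewrite /E ler_pM2l // ler_expR !mulNr lerN2 ler_pM2l //.
  by rewrite ltr_wpDl // !mulr_ge0.
have meta : m = eta + eta by rewrite /eta; lra.
have Keq : K = 2 * (n%:R * g) + 1 by [].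
clearbody E eta K.
pose L (s : R) := Sigma s - (E s)%:M.
have LE s : L s = Sigma s - E s *: 1%:M by rewrite scalemx1.
have cL : mx_continuous L.
  move=> i j; under eq_fun do rewrite LE.
  apply: mx_continuous_sub => //; apply: mx_continuous_scale => //.
  exact: mx_continuous_const.
have Ls s : 0 <= s -> (L s)^T = L s.
  by move=> s0; rewrite linearB /= tr_scalar_mx riccati_sym.
have L0 : posdef (L 0).
  have -> : L 0 = eta%:M + (Sigma 0 - m%:M).
    rewrite /L E00 meta.
    by apply/matrixP => i j; rewrite !mxE mulrnDl; ring.
  by apply: posdefDpsd => //; rewrite -scalemx1; apply: posdefZ => //; exact: posdef1.
have LEb : Sigma b = L b + E b *: 1%:M by rewrite LE subrK.
clearbody L.
pose B := [set s | 0 <= s <= b /\ ~ posdef (L s)].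
have Bb : B b.
  split; first by rewrite b0 lexx.
  move=> Lb; apply: nb; rewrite LEb.
  by apply: posdefD => //; apply: posdefZ => //; exact: posdef1.
have Binf : has_inf B by split; [exists b|exists 0 => s [/andP[]]].
pose tau := inf B.
have tau0 : 0 <= tau by apply: lb_le_inf; [exists b|move=> s [/andP[]]].
have taub : tau <= b by apply: ge_inf => //; exact: Binf.2.
have tau_lb s : B s -> tau <= s by apply: ge_inf; exact: Binf.2.
have tau_adh e : 0 < e -> exists2 s, B s & s < tau + e.
  by move=> e0; exact: inf_adherent.
clearbody tau.
have before s : 0 <= s < tau -> posdef (L s).
  move=> /andP[s0 st]; have [//|nl] := pselect (posdef (L s)).
  have : B s by split => //; rewrite s0 (le_trans (ltW st)).
  by move=> /tau_lb; rewrite leNgt st.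
have ntau : ~ posdef (L tau).
  move=> Ltau; have [m' m'0 hm'] := posdef_coercive Ltau.
  have e0 : 0 < m' / (n%:R + 1) by rewrite divr_gt0 // ltr_wpDl.
  have [d d0 hd] := mx_continuous_near tau cL e0.
  have [s [sb ns] sd] := tau_adh _ d0.
  have ts : tau <= s by apply: tau_lb; split.
  apply: ns; apply/posdefP; split; first by apply: Ls; case/andP: sb.
  move=> x x0; have x1 := bil11_gt0 x0.
  have /hd h : `|s - tau| < d by rewrite ger0_norm ?subr_ge0 // ltrBlDl.
  have -> : L s = L tau + (L s - L tau) by rewrite addrC subrK.
  rewrite bilD; have := bil_norm (L s - L tau) x; rewrite ler_norml => /andP[+ _].
  have h1 := psd_sub_scalar x hm'; move=> h2.
  have : n%:R * `|L s - L tau| * bil 1%:M x x < m' * bil 1%:M x x.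
    rewrite ltr_pM2r //; apply: (@le_lt_trans _ _ (n%:R * (m' / (n%:R + 1)))).
      by apply: ler_wpM2l.
    by rewrite mulrCA gtr_pMr // ltr_pdivrMr ?ltr_wpDl // mul1r ltrDl.
  lra.
have tau_gt0 : 0 < tau.
  by rewrite lt_neqAle tau0 andbT; apply: contra_notN ntau => /eqP <-.
have Ltau : psd (L tau).
  apply/psdP; split=> [|x]; first exact: Ls.
  rewrite leNgt; apply/negP => neg.
  have [d d0 hd] := continuous_lt (continuous_bil (x := x) (y := x) cL) neg.
  pose s := Num.max 0 (tau - d / 2).
  have s0 : 0 <= s by rewrite le_max lexx.
  have st : s < tau by rewrite gt_max tau_gt0 ltrBlDr ltrDl divr_gt0.
  have sd : `|s - tau| < d.
    rewrite ltr0_norm ?subr_lt0 // opprB ltrBlDr.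
    have : tau - d / 2 <= s by rewrite le_max lexx orbT.
    lra.
  have := hd _ sd; have /posdef_psd/psdP[_ /(_ x)] : posdef (L s).
    by apply: before; rewrite s0.
  by rewrite leNgt => /negP.
have [v v0 Lv] : exists2 v : 'cV_n, v != 0 & bil (L tau) v v = 0.
  have [//|nv] := pselect (exists2 v : 'cV_n, v != 0 & bil (L tau) v v = 0).
  exfalso; apply: ntau; apply/posdefP; split=> [|x x0]; first exact: Ls.
  have := ((psdP _).1 Ltau).2 x; rewrite le_eqVlt => /predU1P[/esym e|//].
  by exfalso; apply: nv; exists x.
have Lv0 := psd_ker Ltau Lv.
have v1 := bil11_gt0 v0.
(* [M0] fixes how small [L s *m v] must be to the left of [tau] for the two drift terms together not
   to exceed [E b] times [|v|^2]. *)
pose M0 := 2 * (n%:R * (n%:R * `|v^T| * g)) + 1.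
have M00 : 0 < M0 by rewrite ltr_wpDl // !mulr_ge0.
have M0E : M0 = 2 * (n%:R * (n%:R * `|v^T| * g)) + 1 by [].
clearbody M0.
have e0 : 0 < E b * bil 1%:M v v / M0 by rewrite divr_gt0 // mulr_gt0.
have cLv : mx_continuous (fun s => L s *m v).
  apply: mx_continuous_mul => //; exact: mx_continuous_const.
have [d d0 hd] := mx_continuous_near tau cLv e0.
pose a := Num.max 0 (tau - d / 2).
have a0 : 0 <= a by rewrite le_max lexx.
have at' : a < tau by rewrite gt_max tau_gt0 ltrBlDr ltrDl divr_gt0.
(* [tau] may be a switching time, so the sign of the derivative is used on [[a, tau]] rather than at
   [tau]: the form at [v] does not decrease there, although it is positive at [a] and zero at
   [tau]. *)
have : - bil (L tau) v v <= - bil (L a) v v.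
  apply: (@nonincreasing_off _ sw (fun s => - bil (L s) v v)) => //.
  - exact: ltW.
  - by apply: continuous_opp; exact: continuous_bil.
  move=> s /andP[as' st] sws; have s0 : 0 < s by exact: le_lt_trans as'.
  have dL : mx_derive L s (G s *m L s + L s *m (G s)^T + W + E s *: (G s + (G s)^T + K%:M)).
    have H := mx_derive_sub (dSigma s0 sws) (mx_derive_scalel 1%:M (dE s)).
    move=> i j; under eq_fun do rewrite LE.
    apply: (mx_derive_eq H); rewrite LE GE; apply: riccati_shift.
      by rewrite riccati_sym // ltW.
    exact: (Sp s0).1.
  eexists; first exact: is_derive_opp (is_derive_bil v v dL).
  rewrite oppr_le0 !bilD bilZ !bilD -[K%:M]scalemx1 bilZ.
  have Wv := ((psdP _).1 Wp).2 v.
  have sb : 0 < s <= b by rewrite s0 (le_trans (ltW st)).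
  have GL : `|bil (G s *m L s) v v| <= n%:R * (n%:R * `|v^T| * g) * `|L s *m v|.
    rewrite /bil mulmxA -mulmxA; apply: le_trans (mx_entry_norm _ _ _) _.
    apply: le_trans (mulmx_norm _ _) _; apply: ler_wpM2r => //.
    apply: ler_wpM2l => //; apply: le_trans (mulmx_norm _ _) _.
    by apply: ler_wpM2l; rewrite ?mulr_ge0 // Gg.
  have GG : `|bil (G s) v v| <= n%:R * g * bil 1%:M v v.
    apply: le_trans (bil_norm _ _) _; apply: ler_wpM2r; first exact: ltW.
    by apply: ler_wpM2l => //; exact: Gg.
  have -> : bil (L s *m (G s)^T) v v = bil (G s *m L s) v v.
    by rewrite -bil_tr trmx_mul trmxK Ls // ltW.
  rewrite bil_tr.
  have hLv : `|L s *m v| <= E b * bil 1%:M v v / M0.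
    have := hd s; rewrite Lv0 subr0; apply.
    rewrite ltr0_norm ?subr_lt0 // opprB ltrBlDr.
    have : tau - d / 2 <= a by rewrite le_max lexx orbT.
    lra.
  have Esb : E b <= E s by apply: Emono; case/andP: sb.
  have k1 : 2 * (n%:R * (n%:R * `|v^T| * g) * `|L s *m v|) <= E s * bil 1%:M v v.
    apply: (@le_trans _ _ (M0 * `|L s *m v|)).
      by rewrite mulrA M0E; apply: ler_wpM2r => //; rewrite lerDl.
    apply: (@le_trans _ _ (E b * bil 1%:M v v)).
      by rewrite mulrC -ler_pdivlMr.
    by rewrite ler_wpM2r // ltW.
  have k2 : 0 <= bil (G s) v v + bil (G s) v v + K * bil 1%:M v v - bil 1%:M v v.
    by move: GG; rewrite ler_norml Keq => /andP[+ _]; lra.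
  move: GL; rewrite ler_norml => /andP[GL _].
  have k3 := mulr_ge0 (ltW (E0 s)) k2.
  set p := bil (G s) v v in k3 *; set q := bil 1%:M v v in k1 k3 *.
  lra.
have /posdefP[_ /(_ v v0)] : posdef (L a) by apply: before; rewrite a0.
by rewrite Lv oppr0 oppr_ge0 => h1 /(lt_le_trans h1); rewrite ltxx.
Qed.

End Riccati.

(** * Cost of a filter driven by a rapidly oscillating information rate *)

Section Barrier.
Variable R : realType.

(** After the last time [u] with [g <= G] the function stays above [G], where it cannot increase;
    the derivative is therefore needed only there. *)
Lemma barrier (sw : set R) (g : R -> R) (G t : R) : locally_finite sw ->
  continuous g -> 0 <= t -> g 0 <= G ->
  (forall s : R, 0 < s < t -> ~ sw s -> G < g s ->
     exists2 d, is_derive s 1 g d & d <= 0) ->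
  g t <= G.
Proof.
move=> swf cg t0 g0 h; rewrite leNgt; apply/negP => gt.
pose B := [set s | 0 <= s <= t /\ g s <= G].
have Bsup : has_sup B.
  by split; [exists 0; split; rewrite ?lexx ?t0|exists t => s [/andP[]]].
pose u := sup B.
have u_ub s : B s -> s <= u by exact: ub_le_sup Bsup.2 _.
have u_adh e : 0 < e -> exists2 s, B s & u - e < s.
  by move=> e0; exact: sup_adherent.
have u0 : 0 <= u by apply: u_ub; split; rewrite ?lexx ?t0.
have ut : u <= t by apply: ge_sup; [case: Bsup|move=> s [/andP[]]].
clearbody u.
have gu : g u <= G.
  rewrite leNgt; apply/negP => gu.
  have [|d d0 hd] := continuous_lt (c := - G) (x := u) (continuous_opp cg).
    by rewrite ltrN2.
  have [s [/andP[s0 st] gs] us] := u_adh _ d0.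
  have su : s <= u by apply: u_ub; split; rewrite ?s0.
  have sd : `|s - u| < d by rewrite ler0_norm ?subr_le0 // opprB ltrBlDr -ltrBlDl.
  by have := hd _ sd; rewrite ltrN2 ltNge gs.
have : g t <= g u.
  apply: (nonincreasing_off swf) => // s /andP[us st] sws; apply: h => //.
    by rewrite st (le_lt_trans u0).
  rewrite ltNge; apply/negP => gs.
  have : s <= u by apply: u_ub; split => //; rewrite (ltW st) (le_trans u0) // ltW.
  by rewrite leNgt us.
by move=> /le_trans/(_ gu); rewrite leNgt gt.
Qed.

End Barrier.

Section TraceBounds.
Variable R : realType.

Lemma mxtrace_mul4_norml n (P X B Z : 'M[R]_n) :
  `|\tr (P *m (X *m B *m Z))| <= n%:R ^+ 4 * `|P| * `|X| * `|B| * `|Z|.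
Proof.
apply: le_trans (mxtrace_norm _) _.
have -> : n%:R ^+ 4 * `|P| * `|X| * `|B| * `|Z| =
  n%:R * (n%:R * `|P| * (n%:R * (n%:R * `|X| * `|B|) * `|Z|)) by ring.
apply: ler_wpM2l => //; apply: le_trans (mulmx_norm _ _) _.
apply: ler_wpM2l; first exact: mulr_ge0.
apply: le_trans (mulmx_norm _ _) _; apply: ler_wpM2r => //.
by apply: ler_wpM2l => //; exact: mulmx_norm.
Qed.

Lemma mxtrace_mul4_normr n (P X B Z : 'M[R]_n) :
  `|\tr (P *m (Z *m B *m X))| <= n%:R ^+ 4 * `|P| * `|X| * `|B| * `|Z|.
Proof. by apply: le_trans (mxtrace_mul4_norml _ _ _ _) _; rewrite le_eqVlt; apply/orP; left; apply/eqP; ring. Qed.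

Lemma mxtrace_mul2_norm n (P Z : 'M[R]_n) : `|\tr (P *m Z)| <= n%:R ^+ 2 * `|P| * `|Z|.
Proof.
apply: le_trans (mxtrace_norm _) _; rewrite expr2 -!mulrA; apply: ler_wpM2l => //.
by rewrite !mulrA; exact: mulmx_norm.
Qed.

Lemma riccati_rhs_norm n (A W S Z : 'M[R]_n) cS L : `|S| <= cS -> `|Z| <= L ->
  `|A *m Z + Z *m A^T + W - Z *m S *m Z| <=
  2 * (n%:R * `|A| * L) + `|W| + n%:R * (n%:R * L * cS) * L.
Proof.
move=> Sb Zb; have L0 : 0 <= L by exact: le_trans Zb.
have cS0 : 0 <= cS by exact: le_trans Sb.
have h1 : `|A *m Z| <= n%:R * `|A| * L.
  by apply: le_trans (mulmx_norm _ _) _; apply: ler_wpM2l => //; exact: mulr_ge0.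
have h2 : `|Z *m A^T| <= n%:R * `|A| * L.
  by rewrite -trmx_norm trmx_mul trmxK; apply: le_trans (mulmx_norm _ _) _; rewrite trmx_norm;
    apply: ler_wpM2l => //; exact: mulr_ge0.
have h3 : `|Z *m S *m Z| <= n%:R * (n%:R * L * cS) * L.
  apply: le_trans (mulmx_norm _ _) _; apply: ler_pM => //.
  apply: ler_wpM2l => //; apply: le_trans (mulmx_norm _ _) _.
  by apply: ler_pM => //; exact: ler_wpM2l.
apply: le_trans (ler_normB _ _) _; apply: lerD => //.
apply: le_trans (ler_normD _ _) _; apply: lerD => //.
by apply: le_trans (ler_normD _ _) _; rewrite mulr2n mulrDl mul1r; exact: lerD.
Qed.

End TraceBounds.

(** * Upper bound through a storage function *)

Section Upper.
Variables (R : realType) (n : nat) (A W Sb X E : 'M[R]_n).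
Hypotheses (Wp : psd W) (Sbp : psd Sb) (Xp : posdef X) (Ep : psd E).
Hypothesis ric : A *m X + X *m A^T + W - X *m Sb *m X = - E.
Let F := A - X *m Sb.

(* Completing the square at the supersolution [X]: the cross terms in [S - Sb]
   are exact derivatives up to an error of the size of the primitive of [S - Sb]. *)
Lemma riccati_completed_square (T P S Z : 'M[R]_n) : psd P -> psd S -> Z^T = Z ->
  F^T *m P + P *m F = - T ->
  \tr (P *m (A *m Z + Z *m A^T + W - Z *m S *m Z)) +
  \tr (P *m (X *m (S - Sb) *m Z + Z *m (S - Sb) *m X - X *m (S - Sb) *m X))
  <= \tr (T *m X) - \tr (T *m Z).
Proof.
move=> Pp Sp Zs FP.
have XE : (A *m Z + Z *m A^T + W - Z *m S *m Z) +
   (X *m (S - Sb) *m Z + Z *m (S - Sb) *m X - X *m (S - Sb) *m X) =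
   (F *m (Z - X) + (Z - X) *m F^T) - (E + (Z - X) *m S *m (Z - X)).
  have -> : E = - (A *m X + X *m A^T + W - X *m Sb *m X) by rewrite ric opprK.
  have -> : F^T = A^T - Sb *m X by rewrite /F linearB /= trmx_mul Sbp.1 Xp.1.
  rewrite /F !(mulmxDr, mulmxDl, mulmxN, mulNmx) !mulmxA.
  by apply/matrixP => i j; rewrite !mxE; ring.
rewrite -mxtraceD -mulmxDr XE mulmxBr raddfB /=.
have ZXs : (Z - X)^T = Z - X by rewrite linearB /= Zs Xp.1.
have q0 : 0 <= \tr (P *m (E + (Z - X) *m S *m (Z - X))).
  by apply: psd_tr_ge0 => //; apply: psdD => //; exact: psd_congr_sym.
suff -> : \tr (P *m (F *m (Z - X) + (Z - X) *m F^T)) = \tr (T *m X) - \tr (T *m Z).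
  by rewrite gerBl.
transitivity (\tr ((F^T *m P + P *m F) *m (Z - X))).
  by rewrite mulmxDr mulmxDl !mxtraceD addrC !mulmxA [in LHS]mxtrace_mulC !mulmxA.
by rewrite FP mulNmx mulmxBr raddfN raddfB /= opprB.
Qed.

Hypothesis ctrl : forall Z L : 'M[R]_n, Z *m A = L *m Z -> Z *m W = 0 -> Z = 0.
Variables (cS cB : R) (Z0 : 'M[R]_n).
Hypothesis Z0p : posdef Z0.

(* A filter driven by information rate [S] with mean [Sb]; [B] is the primitive
   of the fluctuation [S - Sb]. *)
Definition driven_filter (eps : R) (sw : set R) (S B Z : R -> 'M[R]_n) :=
  [/\ locally_finite sw,
      forall t : R, 0 < t -> psd (S t) /\ `|S t| <= cS,
      [/\ mx_continuous B, B 0 = 0, forall t : R, 0 <= t -> `|B t| <= eps * cB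
        & forall t : R, 0 < t -> ~ sw t -> mx_derive B t (S t - Sb)],
      mx_continuous Z /\ Z 0 = Z0
    & forall t : R, 0 < t -> ~ sw t ->
        mx_derive Z t (A *m Z t + Z t *m A^T + W - Z t *m S t *m Z t)].

Section Functional.
Variables (eps : R) (sw : set R) (S B Z : R -> 'M[R]_n).
Hypothesis filt : driven_filter eps sw S B Z.
Variables (T P : 'M[R]_n).
Hypotheses (Pp : psd P) (FP : F^T *m P + P *m F = - T).

(** An integration by parts: differentiating [B] in the correction reproduces the cross terms of the
    completed square, while differentiating [Z] leaves terms with a factor [B], of order [eps]. *)
Definition filter_storage (t : R) : R :=
  \tr (P *m Z t) + \tr (P *m (X *m B t *m Z t + Z t *m B t *m X - X *m B t *m X)).

Definition storage_error (L : R) : R := n%:R ^+ 4 * `|P| * `|X| * cB * (2 * L + `|X|).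

(** The last factor is twice a bound on [Z'] valid when [\tr Z <= L], for the two terms [X B Z'] and
    [Z' B X]; [cB] comes from [|B| <= eps * cB]. *)
Definition storage_rate_error (L : R) : R :=
  n%:R ^+ 4 * `|P| * `|X| * cB *
    (2 * (2 * (n%:R * `|A| * L) + `|W| + n%:R * (n%:R * L * cS) * L)).

Lemma filter_posdef t : 0 <= t -> posdef (Z t).
Proof.
case: filt => swf hS _ [cZ Z00] dZ t0.
apply: (riccati_posdef (sw := sw) (A := A) (W := W) (S := S) (cS := cS)) => //.
- by move=> s /hS[].
- by move=> s /hS[].
- by rewrite Z00.
Qed.

Lemma filter_sym t : 0 <= t -> (Z t)^T = Z t.
Proof. by move/filter_posdef => -[]. Qed.

Lemma filter_storage_continuous : continuous filter_storage.
Proof.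
case: filt => swf hS [cB' _ _ _] [cZ _] dZ.
have cc (M : 'M[R]_n) : mx_continuous (fun _ : R => M) by exact: mx_continuous_const.
apply: continuous_add; apply: continuous_mxtrace; first exact: mx_continuous_mul.
apply: mx_continuous_mul => //; apply: mx_continuous_sub.
  apply: mx_continuous_add.
    by apply: mx_continuous_mul => //; exact: mx_continuous_mul.
  by apply: mx_continuous_mul => //; exact: mx_continuous_mul.
by apply: mx_continuous_mul => //; exact: mx_continuous_mul.
Qed.

Lemma filter_storage_near t L : 0 <= t -> \tr (Z t) <= L ->
  `|filter_storage t - \tr (P *m Z t)| <= eps * storage_error L.
Proof.
move=> t0 ZL; have Zp := posdef_psd (filter_posdef t0).
have nZ : `|Z t| <= L by apply: le_trans (psd_norm Zp) ZL.
case: filt => _ _ [_ _ Bb _] _ _; have nB := Bb _ t0.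
rewrite /filter_storage addrAC subrr add0r mulmxBr mulmxDr raddfB raddfD /=.
have pre : 0 <= n%:R ^+ 4 * `|P| * `|X| by rewrite !mulr_ge0 ?exprn_ge0.
have step (V : 'M[R]_n) v : `|V| <= v -> n%:R ^+ 4 * `|P| * `|X| * `|B t| * `|V| <=
    eps * (n%:R ^+ 4 * `|P| * `|X| * cB * v).
  move=> Vv; have -> : eps * (n%:R ^+ 4 * `|P| * `|X| * cB * v) =
    n%:R ^+ 4 * `|P| * `|X| * (eps * cB) * v by ring.
  by apply: ler_pM; rewrite ?mulr_ge0 //; exact: ler_wpM2l.
have h1 := le_trans (mxtrace_mul4_norml P X (B t) (Z t)) (step _ _ nZ).
have h2 := le_trans (mxtrace_mul4_normr P X (B t) (Z t)) (step _ _ nZ).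
have h3 := le_trans (mxtrace_mul4_norml P X (B t) X) (step _ _ (lexx _)).
apply: le_trans (ler_normB _ _) _.
have h4 := ler_normD (\tr (P *m (X *m B t *m Z t))) (\tr (P *m (Z t *m B t *m X))).
rewrite /storage_error; lra.
Qed.

Lemma filter_storage_derive (t : R) L : 0 < t -> ~ sw t -> \tr (Z t) <= L ->
  exists2 d, is_derive t 1 filter_storage d &
    d <= \tr (T *m X) - \tr (T *m Z t) + eps * storage_rate_error L.
Proof.
move=> t0 swt ZL; have t0' := ltW t0; have Zp := posdef_psd (filter_posdef t0').
have nZ : `|Z t| <= L by apply: le_trans (psd_norm Zp) ZL.
case: filt => _ hS [_ _ Bb dB] _ dZ; have nB := Bb _ t0'.
have {hS}[Sp Sn] := hS _ t0; have {}dB := dB _ t0 swt; have {}dZ := dZ _ t0 swt.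
pose Z' := A *m Z t + Z t *m A^T + W - Z t *m S t *m Z t; rewrite -/Z' in dZ.
have nZ' : `|Z'| <= 2 * (n%:R * `|A| * L) + `|W| + n%:R * (n%:R * L * cS) * L.
  exact: riccati_rhs_norm.
have dX := mx_derive_mull X dB; have dX' := mx_derive_mulr X dX.
have d1 := mx_derive_mul dX dZ.
have d2 := mx_derive_mulr X (mx_derive_mul dZ dB).
have d3 := is_derive_mxtrace (mx_derive_mull P (mx_derive_sub (mx_derive_add d1 d2) dX')).
have d4 := is_derive_add (is_derive_mxtrace (mx_derive_mull P dZ)) d3.
eexists; first exact: d4.
have sq := riccati_completed_square Pp Sp (filter_sym t0') FP.
rewrite -/Z' in sq.
have e : X *m (S t - Sb) *m Z t + X *m B t *m Z' +
    (Z' *m B t + Z t *m (S t - Sb)) *m X - X *m (S t - Sb) *m X =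
    (X *m (S t - Sb) *m Z t + Z t *m (S t - Sb) *m X - X *m (S t - Sb) *m X) +
    (X *m B t *m Z' + Z' *m B t *m X).
  rewrite mulmxDl; set a := X *m (S t - Sb) *m Z t; set b := X *m B t *m Z'.
  set c := Z' *m B t *m X; set d := Z t *m _ *m X; set f := X *m _ *m X.
  by apply/matrixP => i j; rewrite !mxE; ring.
rewrite e mulmxDr mxtraceD addrA; apply: lerD => //.
rewrite mulmxDr mxtraceD.
have pre : 0 <= n%:R ^+ 4 * `|P| * `|X| by rewrite !mulr_ge0 ?exprn_ge0.
have step (V : 'M[R]_n) v : `|V| <= v -> n%:R ^+ 4 * `|P| * `|X| * `|B t| * `|V| <=
    eps * (n%:R ^+ 4 * `|P| * `|X| * cB * v).
  move=> Vv; have -> : eps * (n%:R ^+ 4 * `|P| * `|X| * cB * v) =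
    n%:R ^+ 4 * `|P| * `|X| * (eps * cB) * v by ring.
  by apply: ler_pM; rewrite ?mulr_ge0 //; exact: ler_wpM2l.
have := le_trans (mxtrace_mul4_norml P X (B t) Z') (step _ _ nZ').
have := le_trans (mxtrace_mul4_normr P X (B t) Z') (step _ _ nZ').
rewrite /storage_rate_error !ler_norml => /andP[_ h1] /andP[_ h2]; lra.
Qed.

End Functional.

(* While [\tr (Z t) <= L] the storage stays below [G], which does not depend on
   [L], and this in turn gives [\tr (Z t) <= L - 1]. *)
Lemma filter_trace_bounded : exists L e0, 0 < e0 /\
  forall eps sw S B Z, 0 < eps < e0 -> driven_filter eps sw S B Z ->
  forall t : R, 0 <= t -> \tr (Z t) <= L.
Proof.
have [P Pp FP] := stable_lyap_adj1 Wp Sbp Xp Ep ric ctrl.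
have Ppsd := posdef_psd Pp.
have [a a0 Pa] := posdef_coercive Pp.
pose b := n%:R ^+ 2 * `|P| + 1.
have b0 : 0 < b by rewrite ltr_wpDl // mulr_ge0 ?exprn_ge0.
have m00 : 0 <= \tr Z0 by apply: le_trans (psd_norm (posdef_psd Z0p)).
have mX0 : 0 <= \tr X by apply: le_trans (psd_norm (posdef_psd Xp)).
(* The outer 1 absorbs the error of the correction: storage above [G] forces [\tr Z >= \tr X + 1].
   This inner 1 absorbs the rate error, so the storage does not increase. The summand [\tr Z0] puts
   the initial storage below [G]. *)
pose G := b * (\tr Z0 + \tr X + 1) + 1.
(* From [a * \tr Z <= \tr (P Z) <= G + 1] the middle summand bounds [\tr Z]. The last 1 is the gap
   that the continuous trace would have to jump in order to reach [L], and [\tr Z0] keeps the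
   initial trace below [L]. *)
pose L := \tr Z0 + (G + 1) / a + 1.
have Ga : 0 <= (G + 1) / a.
  rewrite divr_ge0 ?addr_ge0 ?(ltW a0) // mulr_ge0 ?(ltW b0) //.
  by rewrite !addr_ge0.
have aL : (G + 1) / a + 1 <= L by rewrite /L; lra.
have m0L : \tr Z0 < L by rewrite /L; lra.
(* For [eps] below [e1^-1] each of the three errors, multiplied by [eps], is at most 1. *)
pose e1 := `|storage_error P L| + `|storage_rate_error P L| + `|storage_error P (\tr Z0)| + 1.
have e10 : 0 < e1 by rewrite ltr_wpDl // !addr_ge0.
exists L, e1^-1; split; first by rewrite invr_gt0.
move=> eps sw S B Z /andP[eps0 epse] filt.
have small (c : R) : `|c| <= e1 -> eps * c <= 1.
  move=> ce; apply: le_trans (ler_norm _) _; rewrite normrM (gtr0_norm eps0).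
  rewrite -(mulVf (lt0r_neq0 e10)).
  by apply: ler_pM => //; exact: ltW.
have n1 := normr_ge0 (storage_error P L).
have n2 := normr_ge0 (storage_rate_error P L).
have n3 := normr_ge0 (storage_error P (\tr Z0)).
have s1 : eps * storage_error P L <= 1.
  by apply: small; rewrite /e1; lra.
have s2 : eps * storage_rate_error P L <= 1.
  by apply: small; rewrite /e1; lra.
have s3 : eps * storage_error P (\tr Z0) <= 1.
  by apply: small; rewrite /e1; lra.
clearbody e1.
have Zp t (t0 : 0 <= t) := posdef_psd (filter_posdef filt t0).
have mZ t (t0 : 0 <= t) : 0 <= \tr (Z t) by apply: le_trans (psd_norm (Zp t t0)).
have lowP t : 0 <= t -> a * \tr (Z t) <= \tr (P *m Z t).
  move=> t0; have := psd_tr_ge0 Pa (Zp t t0).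
  by rewrite mulmxBl mul_scalar_mx raddfB /= mxtraceZ subr_ge0.
have uppP t : 0 <= t -> \tr (P *m Z t) <= b * \tr (Z t).
  move=> t0; apply: le_trans (ler_norm _) _; apply: le_trans (mxtrace_mul2_norm _ _) _.
  apply: ler_pM; rewrite ?mulr_ge0 ?exprn_ge0 //; first by rewrite lerDl.
  exact: psd_norm (Zp t t0).
have [swf _ _ [cZ Z00] _] := filt.
pose g := filter_storage B Z P.
have cg : continuous g by exact: (filter_storage_continuous filt).
have g0 : g 0 <= G.
  have := filter_storage_near filt P (lexx 0) (L := \tr Z0).
  rewrite Z00 lexx => /(_ isT); rewrite ler_norml -/g => /andP[_ h].
  have := uppP 0 (lexx 0); rewrite Z00 => h'.
  have : b * \tr Z0 <= b * (\tr Z0 + \tr X + 1).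
    by rewrite ler_pM2l // -addrA lerDl addr_ge0.
  rewrite /G; lra.
move=> t t0; rewrite leNgt; apply/negP => Lt.
pose D := [set s | 0 <= s <= t /\ L < \tr (Z s)].
have Dinf : has_inf D.
  by split; [exists t; split; rewrite ?lexx ?t0|exists 0 => s [/andP[]]].
pose tau := inf D.
have tau0 : 0 <= tau by apply: lb_le_inf; [case: Dinf|move=> s [/andP[]]].
have tau_lb s : D s -> tau <= s by apply: ge_inf; exact: Dinf.2.
have tau_adh e : 0 < e -> exists2 s, D s & s < tau + e.
  by move=> e0; exact: inf_adherent.
have taut : tau <= t by apply: tau_lb; split; rewrite ?lexx ?t0.
clearbody tau.
have before s : 0 <= s < tau -> \tr (Z s) <= L.
  move=> /andP[s0 st]; rewrite leNgt; apply/negP => Ls.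
  have : D s by split => //; rewrite s0 (le_trans (ltW st)).
  by move=> /tau_lb; rewrite leNgt st.
have cm : continuous (fun s => \tr (Z s)) by exact: continuous_mxtrace.
have tauL : L <= \tr (Z tau).
  rewrite leNgt; apply/negP => tL.
  have [d d0 hd] := continuous_lt (x := tau) (c := L) cm tL.
  have [s [sb Ls] sd] := tau_adh _ d0.
  have ts : tau <= s by exact: tau_lb.
  have sd' : `|s - tau| < d by rewrite ger0_norm ?subr_ge0 // ltrBlDl.
  by have := hd _ sd'; rewrite ltNge (ltW Ls).
have tau_gt0 : 0 < tau.
  rewrite lt_neqAle tau0 andbT; apply/eqP => tauE.
  by move: tauL; rewrite -tauE Z00 leNgt m0L.
have beforeG s : 0 <= s < tau -> g s <= G.
  move=> /andP[s0 st]; apply: (barrier (sw := sw)) => // u /andP[u0 us] swu Gu.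
  have uL : \tr (Z u) <= L by apply: before; rewrite ltW //= (lt_trans us).
  have [d dg hd] := filter_storage_derive filt Ppsd FP u0 swu uL.
  exists d => //; apply: le_trans hd _; rewrite !mul1mx.
  have := filter_storage_near filt P (ltW u0) uL.
  rewrite ler_norml -/g => /andP[_ h]; have h' := uppP u (ltW u0).
  have : b * (\tr X + 1) <= b * \tr (Z u).
    have : b * (\tr X + 1) <= b * (\tr Z0 + \tr X + 1).
      by rewrite ler_pM2l // lerD2r lerDr.
    by rewrite /G in Gu *; lra.
  rewrite ler_pM2l // => h2; lra.
have beforeL s : 0 <= s < tau -> \tr (Z s) <= L - 1.
  move=> sb; have s0 : 0 <= s by case/andP: sb.
  have := filter_storage_near filt P s0 (before s sb).
  rewrite ler_norml -/g => /andP[h _]; have h1 := lowP s s0; have h2 := beforeG s sb.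
  rewrite -lerBrDr in aL; apply: le_trans aL.
  by rewrite ler_pdivlMr // mulrC; lra.
have [|d d0 hd] := continuous_lt (c := - (L - 1)) (x := tau) (continuous_opp cm).
  by rewrite ltrN2; apply: lt_le_trans tauL; rewrite gtrBl.
pose s := Num.max 0 (tau - d / 2).
have s0 : 0 <= s by rewrite le_max lexx.
have st : s < tau by rewrite gt_max tau_gt0 ltrBlDr ltrDl divr_gt0.
have sd : `|s - tau| < d.
  rewrite ltr0_norm ?subr_lt0 // opprB ltrBlDr.
  have : tau - d / 2 <= s by rewrite le_max lexx orbT.
  lra.
have := hd _ sd; rewrite ltrN2 ltNge => /negP; apply; apply: beforeL.
by rewrite s0.
Qed.

(** The storage built from the Lyapunov solution for [T] is integrated in time. [c] is the rate
    error at the uniform trace bound and does not depend on [eps]; [c'] collects the boundary terms,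
    may depend on [eps], and vanishes after division by [t]. *)
Lemma filter_cost_upper (T : 'M[R]_n) : psd T -> exists c e0, [/\ 0 <= c, 0 < e0 &
  forall eps sw S B Z, 0 < eps < e0 -> driven_filter eps sw S B Z ->
  exists c', forall t : R, 0 <= t ->
    primitive (fun s => \tr (T *m Z s)) t <= t * (\tr (T *m X) + c * eps) + c'].
Proof.
move=> Tp.
have [P Pp FP] := stable_lyap_adj Wp Sbp Xp Ep ric ctrl Tp.
have [L [e0 [e00 hL]]] := filter_trace_bounded.
exists (`|storage_rate_error P L|), e0; split => // eps sw S B Z eb filt.
have eps0 : 0 < eps by case/andP: eb.
have ZL t := hL _ _ _ _ _ eb filt t.
have [swf _ _ [cZ Z00] _] := filt.
pose g := filter_storage B Z P.
exists (g 0 + eps * storage_error P L) => t t0.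
have cT : continuous (fun s => \tr (T *m Z s)).
  by apply: continuous_mxtrace; apply: mx_continuous_mul => //; exact: mx_continuous_const.
have iT := continuous_locally_integrable0 cT.
pose k := \tr (T *m X) + `|storage_rate_error P L| * eps.
pose h s := primitive (fun s => \tr (T *m Z s)) s + g s - k * s.
have : h t <= h 0.
  apply: (nonincreasing_off swf) => //.
    apply: continuous_add; last first.
      apply: continuous_opp; apply: continuous_mul; first exact: continuous_const.
      by move=> ?; exact: cvg_id.
    apply: continuous_add; first exact: primitive_continuous.
    exact: (filter_storage_continuous filt).
  move=> s /andP[s0 st] sws.
  have [d dg hd] := filter_storage_derive filt Pp FP s0 sws (ZL s (ltW s0)).
  have dk := is_derive_mul (is_derive_const k s) (is_derive_id s 1).
  have dp := is_derive_primitive iT s0 (cT s).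
  eexists; first exact: is_derive_add (is_derive_add dp dg) (is_derive_opp dk).
  have : eps * storage_rate_error P L <= `|storage_rate_error P L| * eps.
    by rewrite mulrC ler_pM2r // ler_norm.
  rewrite /k; lra.
rewrite /h [primitive _ 0]primitive_le0 // mulr0 subr0 add0r /k.
have := filter_storage_near filt P t0 (ZL t t0).
have := psd_tr_ge0 Pp (posdef_psd (filter_posdef filt t0)).
rewrite ler_norml -/g => h1 /andP[h2 _] h3; lra.
Qed.

End Upper.

(** * Averages of the information matrix *)

Section Convexity.
Variables (R : realType) (n : nat).

Lemma psd_scalar_sub (M : 'M[R]_n) : M^T = M -> psd ((n%:R * `|M|)%:M - M).
Proof.
move=> Ms; apply/psdP; split=> [|x]; first by rewrite linearB /= tr_scalar_mx Ms.
rewrite bilB -[(n%:R * _)%:M]scalemx1 bilZ subr_ge0.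
exact: le_trans (ler_norm _) (bil_norm _ _).
Qed.

(** For invertible [V], [2 V - V Z^-1 V] is the tangent of the convex map [Y |-> Y^-1] at [V^-1],
    evaluated at [Z^-1]; the gap is the square [(Z - V) Z^-1 (Z - V)]. *)
Lemma inv_tangent (V Z : 'M[R]_n) : V^T = V -> posdef Z ->
  psd (Z - 2 *: V + V *m invmx Z *m V).
Proof.
move=> Vs Zp; have Zu := posdef_unit Zp.
have -> : Z - 2 *: V + V *m invmx Z *m V = (Z - V) *m invmx Z *m (Z - V).
  rewrite !(mulmxBl, mulmxBr) mulmxV // !mul1mx mulmxKV //.
  by apply/matrixP => i j; rewrite !mxE; ring.
apply: psd_congr_sym; first by rewrite linearB /= Zp.1 Vs.
exact: posdef_psd (posdef_inv Zp).
Qed.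

Lemma mxtrace_inv_tangent (T V Z : 'M[R]_n) : psd T -> V^T = V -> posdef Z ->
  2 * \tr (T *m V) - \tr (T *m (V *m invmx Z *m V)) <= \tr (T *m Z).
Proof.
move=> Tp Vs Zp; have := psd_tr_ge0 Tp (inv_tangent Vs Zp).
rewrite mulmxDr mulmxBr -scalemxAr raddfD raddfB /= mxtraceZ; lra.
Qed.

Lemma posdef_convex (Q1 Q2 : 'M[R]_n) th : 0 <= th <= 1 -> posdef Q1 -> posdef Q2 ->
  posdef ((1 - th) *: Q1 + th *: Q2).
Proof.
move=> /andP[th0 th1] Q1p Q2p; have [->|th_neq] := eqVneq th 0.
  by rewrite subr0 scale1r scale0r addr0.
rewrite addrC; apply: posdefDpsd; first by apply: posdefZ => //; rewrite lt_neqAle eq_sym th_neq.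
by apply: psdZ; [rewrite subr_ge0|exact: posdef_psd].
Qed.

(** Both tangents are taken at the combination [Q]; weighted by [1 - th] and [th], their linear
    parts add up to [\tr (T V)]. *)
Lemma mxtrace_inv_convex (T Q1 Q2 : 'M[R]_n) th : psd T -> 0 <= th <= 1 ->
  posdef Q1 -> posdef Q2 ->
  \tr (T *m invmx ((1 - th) *: Q1 + th *: Q2)) <=
  (1 - th) * \tr (T *m invmx Q1) + th * \tr (T *m invmx Q2).
Proof.
move=> Tp thb Q1p Q2p; have Qp := posdef_convex thb Q1p Q2p.
set Q := _ + _ in Qp *; have Qu := posdef_unit Qp; have Vp := posdef_inv Qp.
set V := invmx Q in Vp *.
have h1 := mxtrace_inv_tangent Tp Vp.1 (posdef_inv Q1p).
have h2 := mxtrace_inv_tangent Tp Vp.1 (posdef_inv Q2p).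
have VQV : V *m Q *m V = V by rewrite /V mulVmx // mul1mx.
have e : (1 - th) * \tr (T *m (V *m Q1 *m V)) + th * \tr (T *m (V *m Q2 *m V)) =
    \tr (T *m V).
  rewrite -[in RHS]VQV /Q mulmxDr mulmxDl -!scalemxAr -!scalemxAl mulmxDr -!scalemxAr.
  by rewrite mxtraceD !mxtraceZ.
rewrite !invmxK in h1 h2.
case/andP: thb => th0 th1.
have th1' : 0 <= 1 - th by rewrite subr_ge0.
have := ler_wpM2l th1' h1; have := ler_wpM2l th0 h2; lra.
Qed.

Definition lmi (A W Sb Q : 'M[R]_n) : 'M[R]_n := Q *m A + A^T *m Q + Q *m W *m Q - Sb.

Lemma lmi_sym (A W Sb Q : 'M[R]_n) : W^T = W -> Sb^T = Sb -> Q^T = Q ->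
  (lmi A W Sb Q)^T = lmi A W Sb Q.
Proof.
move=> Ws Sbs Qs; rewrite /lmi linearB /= !linearD /= !trmx_mul trmxK Ws Sbs Qs.
by rewrite mulmxA [A^T *m Q + _]addrC.
Qed.

(** All terms but [Q W Q] are affine in [Q], and the convexity gap of that one is
    [th (1 - th) (Q1 - Q2) W (Q1 - Q2)]. *)
Lemma lmi_convex (A W Sb Q1 Q2 : 'M[R]_n) th : psd W -> 0 <= th <= 1 ->
  Q1^T = Q1 -> Q2^T = Q2 ->
  psd ((1 - th) *: lmi A W Sb Q1 + th *: lmi A W Sb Q2 -
       lmi A W Sb ((1 - th) *: Q1 + th *: Q2)).
Proof.
move=> Wp /andP[th0 th1] Q1s Q2s.
have -> : (1 - th) *: lmi A W Sb Q1 + th *: lmi A W Sb Q2 -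
    lmi A W Sb ((1 - th) *: Q1 + th *: Q2) =
    (th * (1 - th)) *: ((Q1 - Q2) *m W *m (Q1 - Q2)).
  rewrite /lmi !(mulmxDr, mulmxDl, mulmxN, mulNmx) -!scalemxAr -!scalemxAl.
  by apply/matrixP => i j; rewrite !mxE; ring.
apply: psdZ; first by rewrite mulr_ge0 // subr_ge0.
by apply: psd_congr_sym => //; rewrite linearB /= Q1s Q2s.
Qed.

End Convexity.

(** * Lower bound through the averaged information matrix *)

Section Lower.
Variables (R : realType) (n : nat) (A W Sb : 'M[R]_n) (sw : set R).
Variables (S B Z : R -> 'M[R]_n) (T : 'M[R]_n).
Hypotheses (Wp : psd W) (Sbp : psd Sb) (Tp : psd T) (swf : locally_finite sw).
Hypotheses (cB : mx_continuous B) (B0 : B 0 = 0).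
Hypothesis dB : forall t : R, 0 < t -> ~ sw t -> mx_derive B t (S t - Sb).
Hypotheses (cZ : mx_continuous Z) (Zp : forall t : R, posdef (Z t)).
Hypothesis dZ : forall t : R, 0 < t -> ~ sw t ->
  mx_derive Z t (A *m Z t + Z t *m A^T + W - Z t *m S t *m Z t).

Let Y (t : R) := invmx (Z t).
Let Zu (t : R) : Z t \in unitmx := posdef_unit (Zp t).
Let Yp (t : R) : posdef (Y t) := posdef_inv (Zp t).
Let J (t : R) : 'M[R]_n := \matrix_(i, j) primitive (fun s => Y s i j) t.

Let cY : mx_continuous Y.
Proof. exact: mx_continuous_inv. Qed.

Let cJ : mx_continuous J.
Proof.
move=> i j; under eq_fun do rewrite mxE; apply: primitive_continuous.
exact: continuous_locally_integrable0.
Qed.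

Let dJ (t : R) : 0 < t -> mx_derive J t (Y t).
Proof.
move=> t0 i j; under eq_fun do rewrite mxE; apply: is_derive_primitive => //.
  exact: continuous_locally_integrable0.
exact: cY.
Qed.

Let J0 : J 0 = 0.
Proof. by apply/matrixP => i j; rewrite !mxE primitive_le0. Qed.

Let Js (t : R) : (J t)^T = J t.
Proof.
apply/matrixP => i j; rewrite !mxE; congr (primitive _ t); apply/funext => s.
by rewrite -[in LHS](Yp s).1 mxE.
Qed.

(** In this form the rate [S] enters additively, so it averages exactly, and the quadratic term is
    the [Q W Q] of the program. *)
Let dY (t : R) : 0 < t -> ~ sw t ->
  mx_derive Y t (- (Y t *m A) - A^T *m Y t - Y t *m W *m Y t + S t).
Proof.
move=> t0 swt; apply: (mx_derive_eq (mx_derive_inv Zu (dZ t0 swt))).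
have YZ : Y t *m Z t = 1%:M by exact: mulVmx.
have ZY : Z t *m Y t = 1%:M by exact: mulmxV.
rewrite -/(Y t) !(mulmxDr, mulmxDl, mulmxN, mulNmx) !mulmxA YZ !mul1mx.
rewrite -[_ *m Z t *m Y t]mulmxA ZY mulmx1 -[S t *m Z t *m Y t]mulmxA ZY mulmx1.
by apply/matrixP => i j; rewrite !mxE; ring.
Qed.

Lemma average_posdef (t : R) : 0 < t -> posdef (t^-1 *: J t).
Proof.
move=> t0; apply: posdefZ; first by rewrite invr_gt0.
apply/posdefP; split=> [|x x0]; first exact: Js.
have cf : {within `[0, t], continuous (fun s => bil (Y s) x x)}.
  by apply: continuous_subspaceT; exact: continuous_bil.
have [c _ hc] := EVT_min (ltW t0) cf.
have m0 : 0 < bil (Y c) x x by exact: (Yp c).2.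
set m := bil (Y c) x x in m0 hc.
have h : m * t - bil (J t) x x <= m * 0 - bil (J 0) x x.
  apply: (@nonincreasing_off _ sw (fun s => m * s - bil (J s) x x)) => //; first exact: ltW.
    apply: continuous_add; last by apply: continuous_opp; exact: continuous_bil.
    by apply: continuous_mul; [exact: continuous_const|move=> ?; exact: cvg_id].
  move=> s /andP[s0 st] _.
  have dm := is_derive_mul (is_derive_const m s) (is_derive_id s 1).
  eexists; first exact: is_derive_add dm (is_derive_opp (is_derive_bil x x (dJ s0))).
  by rewrite mul0r add0r mulr1 subr_le0; apply: hc; rewrite in_itv /= !ltW.
move: h; rewrite J0 bil0 mulr0 subr0 subr_le0; apply: lt_le_trans; exact: mulr_gt0.
Qed.

(** [B t = 0] says that [S] has mean exactly [Sb] on [[0, t]]. Averaging the equation of [Y] then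
    leaves the boundary terms, of which [Y t] has the favourable sign, and the convexity gap of
    [Y W Y]. *)
Lemma average_lmi (t : R) : 0 < t -> B t = 0 ->
  psd (t^-1 *: Y 0 - lmi A W Sb (t^-1 *: J t)).
Proof.
move=> t0 Bt; set Q := t^-1 *: J t.
have Qs : Q^T = Q by rewrite linearZ /= Js.
have JQ : J t = t *: Q by rewrite scalerA divff ?gt_eqF // scale1r.
apply/psdP; split=> [|x].
  by rewrite linearB /= linearZ /= (Yp 0).1 lmi_sym //; [case: Wp|case: Sbp].
(* [Y W Y] is replaced by its tangent at the final average [Q]: the derivative of [U] is
   [- (Y - Q) W (Y - Q)], with [U 0 = Y 0] and [U t = t lmi Q + Y t]. *)
pose U (s : R) := J s *m A + A^T *m J s + (J s *m (W *m Q) + (Q *m W) *m J s)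
  - s *: (Q *m W *m Q) - (B s + s *: Sb) + Y s.
have cid : continuous (fun s : R => s) by move=> ?; exact: cvg_id.
have cc (M : 'M[R]_n) : mx_continuous (fun _ : R => M) by exact: mx_continuous_const.
have cU : mx_continuous U.
  apply: mx_continuous_add => //; apply: mx_continuous_sub; last first.
    by apply: mx_continuous_add => //; exact: mx_continuous_scale.
  apply: mx_continuous_sub; last exact: mx_continuous_scale.
  by apply: mx_continuous_add; apply: mx_continuous_add; exact: mx_continuous_mul.
have h : bil (U t) x x <= bil (U 0) x x.
  apply: (@nonincreasing_off _ sw (fun s => bil (U s) x x)) => //; first exact: ltW.
    exact: continuous_bil.
  move=> s /andP[s0 st] sws.
  have dJs := dJ s0; have did := is_derive_id s (1 : R).
  have d1 := mx_derive_add (mx_derive_mulr A dJs) (mx_derive_mull A^T dJs).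
  have d2 := mx_derive_add (mx_derive_mulr (W *m Q) dJs) (mx_derive_mull (Q *m W) dJs).
  have d3 := mx_derive_sub (mx_derive_add d1 d2) (mx_derive_scalel (Q *m W *m Q) did).
  have d4 := mx_derive_sub d3 (mx_derive_add (dB s0 sws) (mx_derive_scalel Sb did)).
  have d5 := is_derive_bil x x (mx_derive_add d4 (dY s0 sws)).
  eexists; first exact: d5.
  set D := (X in bil X x x).
  have -> : D = - ((Y s - Q) *m W *m (Y s - Q)).
    rewrite /D !scale1r !(mulmxDr, mulmxDl, mulmxN, mulNmx) !mulmxA.
    by apply/matrixP => i j; rewrite !mxE; ring.
  rewrite bilN oppr_le0; apply: (psd_congr_sym _ Wp).2.
  by rewrite linearB /= (Yp s).1 Qs.
have U0 : U 0 = Y 0.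
  by rewrite /U J0 B0 !mul0mx !mulmx0 !scale0r !addr0 !subr0 add0r.
have Ut : U t = t *: lmi A W Sb Q + Y t.
  rewrite /U JQ Bt /lmi -!scalemxAr -!scalemxAl !mulmxA; congr (_ + _).
  by apply/matrixP => i j; rewrite !mxE; ring.
move: h; rewrite U0 Ut bilD bilZ => h.
have := (posdef_psd (Yp t)).2 x; rewrite -/(bil (Y t) x x) => Yt.
rewrite bilB bilZ subr_ge0 ler_pdivlMl //; lra.
Qed.

(** Jensen's inequality for the inverse, from its tangent at the final average: at time [t] the two
    linear terms of [g] combine to [t] times [\tr (T V)]. *)
Lemma average_cost (t : R) : 0 < t ->
  \tr (T *m invmx (t^-1 *: J t)) <= t^-1 * primitive (fun s => \tr (T *m Z s)) t.
Proof.
move=> t0; have Qp := average_posdef t0; set Q := t^-1 *: J t in Qp *.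
have JQ : J t = t *: Q by rewrite scalerA divff ?gt_eqF // scale1r.
have Vp := posdef_inv Qp; set V := invmx Q in Vp *.
have VQV : V *m Q *m V = V by rewrite /V mulVmx ?mul1mx // posdef_unit.
have cid : continuous (fun s : R => s) by move=> ?; exact: cvg_id.
have cc (M : 'M[R]_n) : mx_continuous (fun _ : R => M) by exact: mx_continuous_const.
have cT : continuous (fun s => \tr (T *m Z s)).
  by apply: continuous_mxtrace; exact: mx_continuous_mul.
have iT := continuous_locally_integrable0 cT.
pose g (s : R) := 2 * \tr (T *m V) * s - \tr (T *m (V *m J s *m V))
   - primitive (fun s => \tr (T *m Z s)) s.
have : g t <= g 0.
  apply: (nonincreasing_off swf) => //; first exact: ltW.
    apply: continuous_add; last by apply: continuous_opp; exact: primitive_continuous.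
    apply: continuous_add; first by apply: continuous_mul => //; exact: continuous_const.
    apply: continuous_opp; apply: continuous_mxtrace; apply: mx_continuous_mul => //.
    by apply: mx_continuous_mul => //; exact: mx_continuous_mul.
  move=> s /andP[s0 st] sws.
  have d1 := is_derive_mul (is_derive_const (2 * \tr (T *m V)) s) (is_derive_id s 1).
  have d2 := is_derive_mxtrace (mx_derive_mull T (mx_derive_mulr V (mx_derive_mull V (dJ s0)))).
  have d3 := is_derive_primitive iT s0 (cT s).
  eexists; first exact: is_derive_add (is_derive_add d1 (is_derive_opp d2)) (is_derive_opp d3).
  have := mxtrace_inv_tangent Tp Vp.1 (Zp s); rewrite -/(Y s); lra.
rewrite /g J0 [primitive _ 0]primitive_le0 // mulmx0 mul0mx mulmx0 mxtrace0 mulr0 !subr0 JQ.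
rewrite -scalemxAr -scalemxAl VQV -scalemxAr mxtraceZ => h.
rewrite ler_pdivlMl //; lra.
Qed.

(* The average [t^-1 *: J t] of the information matrix is feasible up to
   [O(1/t)]; mixing in the strictly feasible [Qs] makes it feasible. *)
Lemma filter_cost_lower (Qs : 'M[R]_n) c : 0 < c -> posdef Qs ->
  psd (- lmi A W Sb Qs - c%:M) ->
  exists c' t0 : R, forall t, 0 < t -> t0 <= t -> B t = 0 ->
    exists Q, [/\ posdef Q, psd (- lmi A W Sb Q) &
      \tr (T *m invmx Q) <= t^-1 * (primitive (fun s => \tr (T *m Z s)) t + c')].
Proof.
move=> c0 Qsp Qsc; pose y := n%:R * `|Y 0|.
have y0 : 0 <= y by rewrite mulr_ge0.
exists (y / c * \tr (T *m invmx Qs)), (y / c) => t t0 tt0 Bt.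
(* [th * c = y / t], so the slack of [Qs] pays exactly for the defect of the average, at most
   [y / t]; the condition [y / c <= t] makes [th] a weight. *)
pose th := y / c / t.
have thb : 0 <= th <= 1.
  by rewrite !divr_ge0 ?(ltW c0) ?(ltW t0) //= ler_pdivrMr // mul1r.
have [th0 th1] := andP thb.
have Qp := average_posdef t0; have Ql := average_lmi t0 Bt; have Qc := average_cost t0.
set Q := t^-1 *: J t in Qp Ql Qc.
exists ((1 - th) *: Q + th *: Qs); split.
- exact: posdef_convex.
- have conv := lmi_convex A Sb Wp thb Qp.1 Qsp.1.
  have th1' : 0 <= 1 - th by rewrite subr_ge0.
  have p1 := psdZ th1' Ql; have p2 := psdZ th0 Qsc.
  have ti : 0 <= t^-1 by rewrite invr_ge0 ltW.
  have p3 := psdZ ti (psd_scalar_sub (Yp 0).1).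
  have p4 := psdZ (mulr_ge0 th0 ti) (posdef_psd (Yp 0)).
  have := psdD (psdD conv p1) (psdD p2 (psdD p3 p4)).
  rewrite -/y -[y%:M]scalemx1 -[c%:M]scalemx1; set l := lmi _ _ _ (_ + _).
  congr psd; apply/matrixP => i j; rewrite !mxE /th; field.
  by rewrite !gt_eqF.
- have u0 : 0 <= \tr (T *m invmx Q) by exact: psd_tr_ge0 Tp (posdef_psd (posdef_inv Qp)).
  apply: le_trans (mxtrace_inv_convex Tp thb Qp Qsp) _.
  rewrite mulrDr; apply: lerD.
    by apply: le_trans Qc; rewrite ler_piMl // gerBl.
  by rewrite /th mulrCA mulrA.
Qed.

End Lower.

Section Feasibility.
Variables (R : realType) (n : nat) (A W Sb : 'M[R]_n).
Hypotheses (Wp : psd W) (Sbp : psd Sb).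

Lemma lmi_riccati (Q : 'M[R]_n) : posdef Q ->
  A *m invmx Q + invmx Q *m A^T + W - invmx Q *m Sb *m invmx Q =
  invmx Q *m lmi A W Sb Q *m invmx Q.
Proof.
move=> Qp; have Qu := posdef_unit Qp; rewrite /lmi.
rewrite !(mulmxDr, mulmxDl, mulmxN, mulNmx) !mulmxA mulVmx // !mul1mx.
rewrite -[_ *m Q *m invmx Q]mulmxA mulmxV // mulmx1.
by rewrite -[W *m Q *m invmx Q]mulmxA mulmxV // mulmx1.
Qed.

Hypothesis ctrl : forall Z L : 'M[R]_n, Z *m A = L *m Z -> Z *m W = 0 -> Z = 0.

(** Adding to [X] the certificate [D] with [F D + D F^T = - I] lowers the Riccati residual from
    [- E] to [- (E + I + D Sb D)], which is definite; congruence by [Q = (X + D)^-1] returns to the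
    matrix inequality. *)
Lemma strictly_feasible (X E : 'M[R]_n) : posdef X -> psd E ->
  A *m X + X *m A^T + W - X *m Sb *m X = - E ->
  exists Q c, [/\ 0 < c, posdef Q & psd (- lmi A W Sb Q - c%:M)].
Proof.
move=> Xp Ep ric; have [D Dp FD] := stable_lyap Wp Sbp Xp Ep ric ctrl.
have XDp := posdefD Xp Dp; pose Q := invmx (X + D).
have Qp : posdef Q by exact: posdef_inv.
pose H := E + 1%:M + D *m Sb *m D.
have Hp : posdef H.
  apply: posdefDpsd; last by apply: psd_congr_sym => //; exact: Dp.1.
  by rewrite addrC; apply: posdefDpsd => //; exact: posdef1.
have XDH : A *m (X + D) + (X + D) *m A^T + W - (X + D) *m Sb *m (X + D) = - H.
  have -> : H = - (A *m X + X *m A^T + W - X *m Sb *m X)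
     - ((A - X *m Sb) *m D + D *m (A - X *m Sb)^T) + D *m Sb *m D.
    by rewrite ric FD !opprK.
  have -> : (A - X *m Sb)^T = A^T - Sb *m X by rewrite linearB /= trmx_mul Sbp.1 Xp.1.
  rewrite !(mulmxDr, mulmxDl, mulmxN, mulNmx) !mulmxA.
  by apply/matrixP => i j; rewrite !mxE; ring.
have lQ : - lmi A W Sb Q = Q *m H *m Q.
  have QI : invmx Q = X + D by rewrite /Q invmxK.
  have QXD : Q *m (X + D) = 1%:M by rewrite -QI mulmxV // posdef_unit.
  have XDQ : (X + D) *m Q = 1%:M by rewrite -QI mulVmx // posdef_unit.
  have := lmi_riccati Qp; rewrite QI XDH => e.
  by rewrite -[H]opprK e mulmxN mulNmx !mulmxA QXD mul1mx -mulmxA XDQ mulmx1.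
have QHQ : posdef (Q *m H *m Q).
  by have := posdef_congr (posdef_unit Qp) Hp; rewrite Qp.1.
have [c c0 hc] := posdef_coercive QHQ.
by exists Q, c; rewrite lQ.
Qed.

End Feasibility.

Section Information.
Variables (R : realType) (n M : nat) (q : 'I_M -> nat).
Variables (C : forall j, 'M[R]_(q j, n)) (V : forall j, 'M[R]_(q j)).
Hypothesis Vp : forall j, posdef (V j).

Let c := \sum_(j < M) `|(C j)^T *m invmx (V j) *m C j|.

Lemma info_psd (w : 'I_M -> R) : (forall j, 0 <= w j) -> psd (info C V w).
Proof.
move=> w0; rewrite /info; elim/big_ind: _ => [||j _]; [exact: psd0|exact: psdD|].
by apply: psdZ => //; apply: psd_congr; exact: posdef_psd (posdef_inv _).
Qed.

Lemma infoB (w w' : 'I_M -> R) :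
  info C V (fun j => w j - w' j) = info C V w - info C V w'.
Proof. by rewrite /info -sumrB; apply: eq_bigr => j _; rewrite scalerBl. Qed.

Lemma info_norm (w : 'I_M -> R) e : (forall j, `|w j| <= e) -> `|info C V w| <= e * c.
Proof.
move=> we; apply: le_trans (ler_norm_sum _ _ _) _; rewrite mulr_sumr.
by apply: ler_sum => j _; rewrite normrZ; apply: ler_wpM2r.
Qed.

Lemma info_derive (w : 'I_M -> R -> R) (t : R) dw :
  (forall j, is_derive t 1 (w j) (dw j)) ->
  mx_derive (fun s => info C V (fun j => w j s)) t (info C V dw).
Proof. by move=> h; apply: mx_derive_sum => j _; exact: mx_derive_scalel. Qed.

Lemma info_continuous (w : 'I_M -> R -> R) : (forall j, continuous (w j)) ->
  mx_continuous (fun s => info C V (fun j => w j s)).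
Proof.
move=> h; apply: mx_continuous_sum => j _; apply: mx_continuous_scale => //.
exact: mx_continuous_const.
Qed.

Lemma info0 : info C V (fun _ => 0) = 0.
Proof. by rewrite /info big1 // => j _; rewrite scale0r. Qed.

End Information.

Section PrimitiveLinear.
Variable R : realType.
Implicit Types f g : R -> R.

Lemma locally_integrable0D f g : locally_integrable0 f -> locally_integrable0 g ->
  locally_integrable0 (fun s => f s + g s).
Proof.
move=> hf hg T; rewrite (_ : EFin \o _ = ((EFin \o f) \+ (EFin \o g))%E) //.
by apply: integrableD; [exact: measurable_itv|exact: hf|exact: hg].
Qed.

Lemma locally_integrable0Z (k : R) f : locally_integrable0 f ->
  locally_integrable0 (fun s => k * f s).
Proof.
move=> hf T; rewrite (_ : EFin \o _ = (fun s => k%:E * (EFin \o f) s)%E) //.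
by apply: integrableZl; [exact: measurable_itv|exact: hf].
Qed.

Lemma primitiveD f g t : locally_integrable0 f -> locally_integrable0 g ->
  primitive (fun s => f s + g s) t = primitive f t + primitive g t.
Proof. by move=> hf hg; rewrite /primitive /parameterized_integral RintegralD. Qed.

Lemma primitiveZ (k : R) f t : locally_integrable0 f ->
  primitive (fun s => k * f s) t = k * primitive f t.
Proof. by move=> hf; rewrite /primitive /parameterized_integral RintegralZl. Qed.

Lemma locally_integrable0_sum (I : Type) (r : seq I) (F : I -> R -> R) :
  (forall i, locally_integrable0 (F i)) ->
  locally_integrable0 (fun s => \sum_(i <- r) F i s).
Proof.
move=> h; elim: r => [|i r IH].
  under eq_fun do rewrite big_nil; apply: continuous_locally_integrable0.
  exact: continuous_const.
by under eq_fun do rewrite big_cons; exact: locally_integrable0D.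
Qed.

Lemma primitive_sum (I : Type) (r : seq I) (F : I -> R -> R) t :
  (forall i, locally_integrable0 (F i)) ->
  primitive (fun s => \sum_(i <- r) F i s) t = \sum_(i <- r) primitive (F i) t.
Proof.
move=> h; elim: r => [|i r IH].
  rewrite big_nil; under eq_fun do rewrite big_nil.
  by rewrite /primitive /parameterized_integral Rintegral_cst // mul0r.
under eq_fun do rewrite big_cons.
by rewrite big_cons primitiveD // ?IH //; exact: locally_integrable0_sum.
Qed.

Lemma primitiveE f t : locally_integrable0 f ->
  (\int[lebesgue_measure]_(s in `[0%R, t]) (f s)%:E)%E = (primitive f t)%:E.
Proof.
move=> hf; rewrite /primitive /parameterized_integral /Rintegral fineK //.
by apply: integrable_fin_num.
Qed.

End PrimitiveLinear.

(** * The periodic switching policy *)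

Section Policy.
Variables (R : realType) (N M K : nat) (P : 'M[R]_(N, M)).
Variables (phi : 'I_K -> R) (Pk : 'I_K -> 'M[R]_(maxn M N)) (eps : R).
Hypothesis dec : is_decomposition P phi Pk.
Hypothesis P01 : forall i j, 0 <= P i j <= 1.
Hypothesis eps0 : 0 < eps.

Let pol := switching_policy phi Pk eps.

Definition start (k : nat) : R := \sum_(h < K | (h < k)%N) phi h.
Definition corner (k : 'I_K) : 'M[R]_(N, M) :=
  mxsub (widen_ord (leq_maxr M N)) (widen_ord (leq_maxl M N)) (Pk k).
(** The end of a period is the start of the next, so [k < K] suffices. At positive times the policy
    can be discontinuous only here, but need not jump at each of these times. *)
Definition switch_times : set R :=
  [set t | exists l k : nat, (k < K)%N /\ t = (l%:R + start k) * eps].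

Lemma start0 : start 0 = 0.
Proof. by rewrite /start big_pred0. Qed.

Lemma startK : start K = 1.
Proof.
by case: dec => _ <- _ _; apply: eq_bigl => h; rewrite ltn_ord.
Qed.

Lemma sum_prefixS (V : nmodType) (F : 'I_K -> V) (k : 'I_K) :
  \sum_(h < K | (h < k.+1)%N) F h = \sum_(h < K | (h < k)%N) F h + F k.
Proof.
rewrite (bigD1 k) //= addrC; congr (_ + _); apply: eq_bigl => h.
by rewrite ltnS [in RHS]ltn_neqAle andbC -val_eqE.
Qed.

Lemma startS (k : 'I_K) : start k.+1 = start k + phi k.
Proof. exact: sum_prefixS. Qed.

Lemma start_le k1 k2 : (k1 <= k2)%N -> start k1 <= start k2.
Proof.
move=> k12; have [phi0 _ _ _] := dec; rewrite /start [leRHS](bigID (fun h : 'I_K => (h < k1)%N)) /=.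
have -> : \sum_(i < K | (i < k2)%N && (i < k1)%N) phi i = \sum_(h < K | (h < k1)%N) phi h.
  apply: eq_bigl => h; apply/andP/idP => [[]//|hk]; split => //.
  exact: leq_trans hk k12.
by rewrite lerDl sumr_ge0 // => h _; exact: ltW.
Qed.

Lemma start_bounds k : (k <= K)%N -> 0 <= start k <= 1.
Proof. by move=> kK; rewrite -start0 -startK !start_le. Qed.

(** [l] is the integer part of [t / eps], and [k.+1] is the least index whose start lies beyond the
    fractional part. *)
Lemma slot_cover (t : R) : 0 <= t -> exists (l : nat) (k : 'I_K),
  (l%:R + start k) * eps <= t < (l%:R + start k.+1) * eps.
Proof.
move=> t0; pose u := t / eps; have u0 : 0 <= u by rewrite divr_ge0 // ltW.
have tu : t = u * eps by rewrite divfK // gt_eqF.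
have [l /andP[lu ul]] : exists l : nat, l%:R <= u < l.+1%:R.
  by exists (Num.truncn u); exact: truncn_itv.
have ex : exists k : nat, u < l%:R + start k by exists K; rewrite startK -natr1 in ul *.
have := ex_minnP ex; case: ex_minnP => k uk kmin _.
case: k uk kmin => [|k] uk kmin; first by rewrite start0 addr0 ltNge lu in uk.
have kK : (k < K)%N.
  rewrite ltnNge; apply/negP => Kk.
  have : u < l%:R + start K.
    by rewrite startK -natr1 in ul *.
  by move/kmin; rewrite ltnNge Kk.
exists l, (Ordinal kK); rewrite tu ler_pM2r // ltr_pM2r // uk andbT /= leNgt.
by apply/negP => /kmin; rewrite ltnn.
Qed.

Lemma slot_unique (t : R) (l l' : nat) (k k' : 'I_K) :
  (l%:R + start k) * eps <= t < (l%:R + start k.+1) * eps ->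
  (l'%:R + start k') * eps <= t < (l'%:R + start k'.+1) * eps -> l = l' /\ k = k'.
Proof.
have main (m m' : nat) (h h' : 'I_K) : (m%:R + start h) * eps <= t ->
    t < (m'%:R + start h'.+1) * eps -> (m <= m')%N /\ (m = m' -> (h <= h')%N).
  move=> h1 h2; have := le_lt_trans h1 h2; rewrite ltr_pM2r // => {h1 h2}h3; split.
    rewrite leqNgt; apply/negP => mm.
    have : (m'%:R : R) + 1 <= m%:R by rewrite natr1 ler_nat.
    have /andP[_ b1] := start_bounds (ltn_ord h').
    have /andP[b2 _] := start_bounds (ltnW (ltn_ord h)).
    lra.
  move=> mm; move: h3; rewrite mm ltrD2l => h3; rewrite leqNgt; apply/negP => hh.
  by move: (start_le hh); rewrite leNgt h3.
move=> /andP[a1 a2] /andP[b1 b2].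
have [c1 c2] := main _ _ _ _ a1 b2; have [c3 c4] := main _ _ _ _ b1 a2.
have ll : l = l' by apply/eqP; rewrite eqn_leq c1 c3.
split => //; apply/val_inj/eqP; rewrite /= eqn_leq c2 //= c4 //.
Qed.

Lemma slotP k (t : R) : slot phi eps k t <->
  exists l : nat, (l%:R + start k) * eps <= t < (l%:R + start k.+1) * eps.
Proof.
rewrite /slot /bigcup /=; split => [[l _]|[l]]; rewrite ?in_itv /= => h; exists l => //=.
Qed.

Lemma switching_policyE (t : R) (l : nat) (k : 'I_K) :
  (l%:R + start k) * eps <= t < (l%:R + start k.+1) * eps -> pol t = corner k.
Proof.
move=> tlk; rewrite /pol /switching_policy (bigD1 k) //= big1 => [|k' k'k].
  rewrite addr0 indicE mem_set ?scale1r //; apply/slotP; by exists l.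
rewrite indicE memNset ?scale0r // => /slotP[l' tlk'].
by have [_ kk] := slot_unique tlk tlk'; rewrite kk eqxx in k'k.
Qed.

Lemma switch_times_locally_finite : locally_finite switch_times.
Proof.
move=> T; exists [seq (l%:R + start k) * eps | l <- iota 0 (Num.truncn (T / eps)).+1, k <- iota 0 K].
move=> t /andP[t0 tT] [l [k [kK tlk]]]; rewrite tlk; apply: allpairs_f.
  rewrite mem_iota add0n ltnS /= truncn_ge_nat; last first.
    by rewrite divr_ge0 ?ltW // (lt_trans t0).
  rewrite ler_pdivlMr //; apply: le_trans (ltW tT); rewrite tlk ler_pM2r // lerDl.
  by case/andP: (start_bounds (ltnW kK)).
by rewrite mem_iota.
Qed.

Lemma slot_interior (t : R) : 0 < t -> ~ switch_times t -> exists (l : nat) (k : 'I_K),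
  (l%:R + start k) * eps < t < (l%:R + start k.+1) * eps.
Proof.
move=> t0 nt; have [l [k /andP[h1 h2]]] := slot_cover (ltW t0); exists l, k.
rewrite h2 andbT lt_neqAle h1 andbT; apply/eqP => e; apply: nt.
by exists l, k; rewrite ltn_ord e.
Qed.

Lemma switching_policy_near (t : R) : 0 < t -> ~ switch_times t ->
  \forall s \near t, pol s = pol t.
Proof.
move=> t0 nt; have [l [k /andP[h1 h2]]] := slot_interior t0 nt.
near=> s; rewrite (@switching_policyE s l k) ?(@switching_policyE t l k) // ?h2 ?(ltW h1) //.
apply/andP; split; [apply: ltW; near: s; exact: lt_nbhsr|near: s; exact: lt_nbhsl].
Unshelve. all: by end_near. Qed.

Lemma switching_policy_continuous (t : R) : 0 < t -> ~ switch_times t ->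
  {for t, continuous pol}.
Proof.
move=> t0 nt; apply: (cvg_trans (near_eq_cvg _) (cvg_cst (pol t))).
near=> s; rewrite /= -/pol; apply/esym; near: s; exact: switching_policy_near.
Unshelve. all: by end_near. Qed.

Lemma corner01 k i j : 0 <= corner k i j <= 1.
Proof.
have [_ _ /(_ k)[h _ _] _] := dec; rewrite mxE.
by case: (h (widen_ord (leq_maxr M N) i) (widen_ord (leq_maxl M N) j)) => ->; rewrite ?lexx ler01.
Qed.

Lemma switching_policy01 (t : R) i j : 0 <= t -> 0 <= pol t i j <= 1.
Proof. by move=> /slot_cover[l [k /switching_policyE ->]]; exact: corner01. Qed.

Lemma mean_corner i j : \sum_(k < K) phi k * corner k i j = P i j.
Proof.
have [_ _ _ /matrixP /(_ (widen_ord (leq_maxr M N) i) (widen_ord (leq_maxl M N) j))] := dec.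
rewrite mxE !insubT //= => hj hi.
rewrite summxE => e; transitivity (P (Sub (nat_of_ord i) hi) (Sub (nat_of_ord j) hj)).
  by rewrite e; apply: eq_bigr => k _; rewrite !mxE.
by congr (P _ _); exact: val_inj.
Qed.

Let polE i j (s : R) : pol s i j =
  \sum_(k < K) corner k i j * \1_(slot phi eps k) s.
Proof.
by rewrite /pol /switching_policy summxE; apply: eq_bigr => k _; rewrite mxE mulrC.
Qed.

Lemma switching_policy_integrable i j : locally_integrable0 (fun s => pol s i j).
Proof.
under eq_fun do rewrite polE; apply: locally_integrable0_sum => k.
apply: locally_integrable0Z => T; apply: measurable_bounded_integrable => //.
- rewrite /= lebesgue_measure_itv /=.
  by case: ifPn => // _; rewrite -EFinB ltry.
- apply: measurable_realfun.measurable_indic; apply: bigcup_measurable => l _; exact: measurable_itv.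
exists 1; split => // y y1 s _ /=; rewrite indicE; case: (_ \in _) => /=.
  by rewrite normr1 ltW.
by rewrite normr0 ltW // (lt_trans ltr01).
Qed.

(** Used as weights in [info], these scalars give the matrix [B] of the filter estimates. *)
Definition fluctuation i j (t : R) : R := primitive (fun s => pol s i j) t - t * P i j.

Lemma fluctuation_continuous i j : continuous (fluctuation i j).
Proof.
apply: continuous_add; first exact/primitive_continuous/switching_policy_integrable.
apply: continuous_opp; apply: continuous_mul; last exact: continuous_const.
by move=> ?; exact: cvg_id.
Qed.

Lemma fluctuation_derive i j (t : R) : 0 < t -> ~ switch_times t ->
  is_derive t 1 (fluctuation i j) (pol t i j - P i j).
Proof.
move=> t0 nt; apply: is_derive_add.
  apply: is_derive_primitive => //; first exact: switching_policy_integrable.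
  apply: (@continuous_comp _ _ _ pol (fun Z : 'M[R]_(N, M) => Z i j)).
    exact: switching_policy_continuous.
  exact: coord_continuous.
apply: is_derive_opp.
have := is_derive_mul (is_derive_id t (1 : R)) (is_derive_const (P i j) t).
by move=> h; apply: (is_derive_eq h); rewrite mulr0 addr0 mul1r.
Qed.

Lemma fluctuation0 i j : fluctuation i j 0 = 0.
Proof. by rewrite /fluctuation primitive_le0 // mul0r subr0. Qed.

Lemma fluctuation_slot i j (l : nat) (k : 'I_K) :
  fluctuation i j ((l%:R + start k.+1) * eps) =
  fluctuation i j ((l%:R + start k) * eps) + eps * (phi k * (corner k i j - P i j)).
Proof.
set a := (_ + start k) * eps; set b := (_ + start k.+1) * eps.
have a0 : 0 <= a.
  apply: mulr_ge0; last exact: ltW.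
  apply: addr_ge0 => //.
  by case/andP: (start_bounds (ltnW (ltn_ord k))).
have phik : 0 < phi k by case: dec.
have ba : b - a = eps * phi k by rewrite /a /b startS; ring.
pose d := corner k i j - P i j.
have : fluctuation i j b - d * b = fluctuation i j a - d * a.
  apply: (@constant_off _ switch_times (fun s => fluctuation i j s - d * s)) => //.
  - exact: switch_times_locally_finite.
  - by rewrite -subr_ge0 ba mulr_ge0 // ltW.
  - apply: continuous_add; first exact: fluctuation_continuous.
    apply: continuous_opp; apply: continuous_mul; first exact: continuous_const.
    by move=> ?; exact: cvg_id.
  move=> t /andP[at' tb] nt; have t0 : 0 < t by exact: le_lt_trans at'.
  have tE : pol t = corner k.
    by apply: (@switching_policyE t l); rewrite (ltW at') tb.
  have h1 := fluctuation_derive i j t0 nt.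
  have h2 := is_derive_opp (is_derive_mul (is_derive_const d t) (is_derive_id t (1 : R))).
  apply: (is_derive_eq (is_derive_add h1 h2)).
  by rewrite tE /d mul0r add0r mulr1 subrr.
have e : eps * (phi k * d) = d * (b - a) by rewrite ba; ring.
rewrite -/d e; lra.
Qed.

(** Each slot adds [eps * phi k * (corner k i j - P i j)], and over a period these increments cancel
    because the corners have mean [P]. *)
Lemma fluctuation_period i j (l : nat) : fluctuation i j (l%:R * eps) = 0.
Proof.
elim: l => [|l IH]; first by rewrite mul0r fluctuation0.
have step k : (k <= K)%N -> fluctuation i j ((l%:R + start k) * eps) =
    eps * \sum_(h < K | (h < k)%N) phi h * (corner h i j - P i j).
  elim: k => [|k IHk] kK; first by rewrite start0 addr0 IH big_pred0 // mulr0.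
  rewrite (fluctuation_slot i j l (Ordinal kK)) IHk; last exact: ltnW.
  by rewrite -mulrDr -(sum_prefixS _ (Ordinal kK)).
have := step K (leqnn K); rewrite startK natr1 => ->.
rewrite (eq_bigl xpredT); last by move=> h; rewrite ltn_ord.
under eq_bigr do rewrite mulrBr.
rewrite sumrB mean_corner -mulr_suml; have [_ -> _ _] := dec.
by rewrite mul1r subrr mulr0.
Qed.

(** It vanishes at the start of the current period, at most [eps] earlier, and its slope is at most
    1 in absolute value because the policy and [P] both lie in [[0, 1]]. *)
Lemma fluctuation_bound i j (t : R) : 0 <= t -> `|fluctuation i j t| <= eps.
Proof.
move=> t0; have [l [k /andP[h1 h2]]] := slot_cover t0.
have lt : l%:R * eps <= t.
  apply: le_trans h1; rewrite ler_pM2r // lerDl.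
  by case/andP: (start_bounds (ltnW (ltn_ord k))).
have tl : t <= l%:R * eps + eps.
  apply: le_trans (ltW h2) _; rewrite mulrDl lerD2l -[leRHS]mul1r ler_pM2r //.
  by case/andP: (start_bounds (ltn_ord k)).
have l0 : 0 <= l%:R * eps by rewrite mulr_ge0 // ltW.
have b01 (s : R) : 0 < s -> `|pol s i j - P i j| <= 1.
  move=> s0; have := switching_policy01 i j (ltW s0); have := P01 i j.
  by rewrite ler_norml => /andP[? ?] /andP[? ?]; apply/andP; split; lra.
have key (sg : R) : `|sg| <= 1 -> sg * fluctuation i j t <= t - l%:R * eps.
  move=> sg1; have : sg * fluctuation i j t - t <=
      sg * fluctuation i j (l%:R * eps) - l%:R * eps.
    apply: (@nonincreasing_off _ switch_times (fun s => sg * fluctuation i j s - s)) => //.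
    - exact: switch_times_locally_finite.
    - apply: continuous_add.
        by apply: continuous_mul; [exact: continuous_const|exact: fluctuation_continuous].
      by apply: continuous_opp => ?; exact: cvg_id.
    move=> s /andP[ls st] ns; have s0 : 0 < s by exact: le_lt_trans ls.
    have d1 := is_derive_mul (is_derive_const sg s) (fluctuation_derive i j s0 ns).
    have d2 := is_derive_opp (is_derive_id s (1 : R)).
    eexists; first exact: (is_derive_add d1 d2).
    rewrite mul0r add0r subr_le0; apply: le_trans (ler_norm _) _.
    by rewrite normrM mulr_ile1 // b01.
  by rewrite fluctuation_period mulr0; lra.
have k1 := key 1; have k2 := key (-1); rewrite normrN normr1 lexx in k1 k2.
have {}k1 := k1 isT; have {}k2 := k2 isT.
rewrite ler_norml; apply/andP; split; lra.
Qed.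

End Policy.

(** * Performance *)

Section LimSup.
Variable R : realType.
Implicit Types (f : R -> \bar R) (u : R -> R).

Lemma limf_esup_le f u z c : (forall t, 0 < t -> f t = (u t)%:E) ->
  (forall t, 0 < t -> u t <= z + c / t) -> (limf_esup f (pinfty_nbhs R) <= z%:E)%E.
Proof.
move=> fu uz; apply/lee_addgt0Pr => e e0.
pose M := (`|c| + 1) / e; have M0 : 0 < M by rewrite divr_gt0 // ltr_wpDl.
apply: (@le_trans _ _ (ereal_sup (f @` `]M, +oo[%classic))).
  apply: ereal_inf_lbound => /=; exists `]M, +oo[%classic => //.
  exists M; split; first exact: num_real.
  by move=> x Mx /=; rewrite in_itv /= Mx.
apply: ge_ereal_sup => _ [t /= +] <-; rewrite in_itv /= andbT => Mt.
have t0 : 0 < t by exact: lt_trans Mt.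
rewrite fu // -EFinD lee_fin; apply: le_trans (uz t t0) _; rewrite lerD2l.
rewrite ler_pdivrMr // mulrC -ler_pdivrMr //; apply: le_trans (ltW Mt).
by rewrite ler_pM2r ?invr_gt0 // (le_trans (ler_norm _)) // lerDl.
Qed.

(** An unbounded set of times suffices to bound a limit superior from below, which permits sampling
    at whole periods. *)
Lemma limf_esup_ge f u z c : (forall t, 0 < t -> f t = (u t)%:E) ->
  (forall M : R, exists2 t, 0 < t /\ M < t & z - c / t <= u t) ->
  (z%:E <= limf_esup f (pinfty_nbhs R))%E.
Proof.
move=> fu uz; apply: le_ereal_inf_tmp => _ [V [M [_ MV]] <-].
apply/lee_subgt0Pr => e e0.
have [t [t0 Mt] zt] := uz (Num.max M ((`|c| + 1) / e)).
move: Mt; rewrite gt_max => /andP[Mt et].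
apply: (@le_trans _ _ (f t)); last by apply: ereal_sup_ubound; exists t => //; exact: MV.
rewrite fu // -EFinB lee_fin; apply: le_trans zt; rewrite lerD2l lerN2.
rewrite ler_pdivrMr // mulrC -ler_pdivrMr //; apply: le_trans (ltW et).
by rewrite ler_pM2r ?invr_gt0 // (le_trans (ler_norm _)) // lerDl.
Qed.

Lemma squeeze_linear (Z : R -> \bar R) z c e0 : 0 < e0 -> 0 <= c ->
  (forall e, 0 < e < e0 -> (z%:E <= Z e /\ Z e <= (z + c * e)%:E)%E) ->
  [/\ \forall eps \near 0^'+, Z eps \is a fin_num,
      (fun eps => fine (Z eps) - z) =O_ (0^'+) (fun eps : R => eps)
    & Z eps @[eps --> 0^'+] --> z%:E].
Proof.
move=> e00 c0 hZ.
have near0 : \forall e \near 0^'+, 0 < e < e0.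
  by near=> e; apply/andP; split; near: e; [exact: nbhs_right_gt|exact: nbhs_right_lt].
have Zfin : \forall eps \near 0^'+, Z eps \is a fin_num.
  near=> e; have /hZ[h1 h2] : 0 < e < e0 by near: e.
  rewrite fin_numElt (lt_le_trans _ h1) ?ltNyr // (le_lt_trans h2) ?ltry //.
have bnd : \forall e \near 0^'+, z <= fine (Z e) <= z + c * e.
  near=> e; have /hZ[h1 h2] : 0 < e < e0 by near: e.
  have fe : Z e \is a fin_num by near: e.
  by rewrite -!lee_fin fineK // h1.
have cvgf : fine (Z e) @[e --> 0^'+] --> z.
  apply: (squeeze_cvgr bnd); first exact: cvg_cst.
  rewrite -[X in _ --> X]addr0 -[X in _ --> _ + X](mulr0 c).
  apply: cvgD; first exact: cvg_cst.
  apply: cvgM; first exact: cvg_cst.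
  exact/cvg_at_right_filter/cvg_id.
split => //.
- apply/eqOP; near=> k; have ck : c <= k.
    by near: k; apply: nbhs_pinfty_ge; exact: num_real.
  near=> e.
  have /andP[h1 h2] : z <= fine (Z e) <= z + c * e by near: e.
  have /andP[e0' _] : 0 < e < e0 by near: e.
  rewrite ger0_norm ?subr_ge0 // (gtr0_norm e0').
  by rewrite lerBlDl (le_trans h2) // lerD2l ler_pM2r.
- apply: (@cvg_trans _ ((fine (Z e))%:E @[e --> 0^'+])); last first.
    exact: (cvg_comp _ _ cvgf).
  apply: near_eq_cvg; near=> e; rewrite fineK //; near: e; exact: Zfin.
Unshelve. all: by end_near. Qed.

End LimSup.

(** * Two-sided bounds on the performance of the switching policy *)

Section Assembly.
Variables (R : realType) (N M : nat) (n : 'I_N -> nat) (q : 'I_N -> 'I_M -> nat).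
Variables (A W T Sigma0 : forall i, 'M[R]_(n i)).
Variables (C : forall i j, 'M[R]_(q i j, n i)) (V : forall i j, 'M[R]_(q i j)).
Variable kappa : 'M[R]_(N, M).
Hypotheses (W_psd : forall i, psd (W i)) (T_psd : forall i, psd (T i)).
Hypothesis V_pd : forall i j, posdef (V i j).
Hypothesis Sigma0_pd : forall i, posdef (Sigma0 i).
Hypothesis noinv : forall i (Z L : 'M[R]_(n i)),
  Z *m A i = L *m Z -> Z *m W i = 0 -> Z = 0.
Variables (Q : forall i, 'M[R]_(n i)) (P : 'M[R]_(N, M)).
Hypothesis QP_optimal : is_optimal A W T C V kappa Q P.
Variables (K : nat) (phi : 'I_K -> R) (Pk : 'I_K -> 'M[R]_(maxn M N)).
Hypothesis P_decomp : is_decomposition P phi Pk.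
Variable Sigma : R -> forall i, R -> 'M[R]_(n i).
Hypothesis Sigma_cov : forall eps : R, 0 < eps -> forall i,
  filter_covariance i (A i) (W i) (C i) (V i) (Sigma0 i)
    (switching_policy phi Pk eps) (Sigma eps i).

Let feas : feasible A W C V Q P := QP_optimal.1.
Let Qp i : posdef (Q i). Proof. by case: feas. Qed.
Let P01 i j : 0 <= P i j <= 1. Proof. by case: feas. Qed.
Let pol (eps : R) := switching_policy (N := N) (M := M) phi Pk eps.
Let Sb i := info (C i) (V i) (P i).
Let cI i : R := \sum_(j < M) `|(C i j)^T *m invmx (V i j) *m C i j|.
Let rate (eps : R) i (t : R) := info (C i) (V i) (pol eps t i).
Let fluct (eps : R) i (t : R) :=
  info (C i) (V i) (fun j => fluctuation P phi Pk eps i j t).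
Let Z (eps : R) i (t : R) := Sigma eps i (Num.max 0 t).
Let sw (eps : R) := switch_times phi eps.

(** Optimality makes the objective both a member and a lower bound of the set, so [inf] is not a
    default value here. *)
Lemma optimal_valueE : optimal_value A W T C V kappa = objective T kappa Q P.
Proof.
rewrite /optimal_value; set D := [set z | _].
have lb : lbound D (objective T kappa Q P).
  by move=> _ [Q' [P' [f ->]]]; exact: QP_optimal.2.
apply/eqP; rewrite eq_le; apply/andP; split.
  by apply: ge_inf; [exists (objective T kappa Q P)|exists Q, P].
by apply: lb_le_inf => //; exists (objective T kappa Q P), Q, P.
Qed.

Let Sb_psd i : psd (Sb i).
Proof. by apply: info_psd => // j; case/andP: (P01 i j). Qed.

Let X i := invmx (Q i).
Let Xp i : posdef (X i). Proof. exact: posdef_inv. Qed.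
(** The slack of the matrix inequality, carried to the covariance side by congruence. *)
Let E i := X i *m (- lmi (A i) (W i) (Sb i) (Q i)) *m X i.

Let Ep i : psd (E i).
Proof.
apply: psd_congr_sym; first exact: (Xp i).1.
by case: feas => /(_ i) + _ _ _ _; rewrite /loewner_le sub0r.
Qed.

Let ric i : A i *m X i + X i *m (A i)^T + W i - X i *m Sb i *m X i = - E i.
Proof. by rewrite /X lmi_riccati // /E mulmxN mulNmx opprK. Qed.

Let pol01 (eps t : R) i j : 0 < eps -> 0 < t -> 0 <= pol eps t i j <= 1.
Proof. by move=> e0 t0; apply: (switching_policy01 P_decomp e0); exact: ltW. Qed.

Let fluct_derive (eps : R) i (t : R) : 0 < eps -> 0 < t -> ~ sw eps t ->
  mx_derive (fluct eps i) t (rate eps i t - Sb i).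
Proof.
move=> e0 t0 nt; rewrite /rate /Sb -infoB; apply: info_derive => j.
exact: (fluctuation_derive P_decomp).
Qed.

Let fluct_continuous (eps : R) i : 0 < eps -> mx_continuous (fluct eps i).
Proof. by move=> e0; apply: info_continuous => j; exact: fluctuation_continuous. Qed.

Let fluct0 (eps : R) i : fluct eps i 0 = 0.
Proof.
rewrite /fluct -[RHS](info0 (C i) (V i)); congr info; apply/funext => j.
exact: fluctuation0.
Qed.

Let Z_derive (eps : R) i (t : R) : 0 < eps -> 0 < t -> ~ sw eps t ->
  mx_derive (Z eps i) t (A i *m Z eps i t + Z eps i t *m (A i)^T + W i
    - Z eps i t *m rate eps i t *m Z eps i t).
Proof.
move=> e0 t0 nt; have [_ _ h] := Sigma_cov e0 i.
have ct := switching_policy_continuous P_decomp e0 t0 nt.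
have := is_derive_mx_derive (is_derive_max0 t0 (h t t0 ct)).
by rewrite /Z (max_idPr (ltW t0)).
Qed.

(** [cI i] serves as both constants: the policy weights lie in [[0, 1]], their fluctuations within
    [eps], and [info] is at most the largest weight times [cI i]. *)
Let filt (eps : R) i : 0 < eps ->
  driven_filter (A i) (W i) (Sb i) (cI i) (cI i) (Sigma0 i) eps
    (sw eps) (rate eps i) (fluct eps i) (Z eps i).
Proof.
move=> e0; have [s0 cs _] := Sigma_cov e0 i; split.
- exact: (switch_times_locally_finite P_decomp e0).
- move=> t t0; split.
    by apply: info_psd => // j; case/andP: (pol01 i j e0 t0).
  rewrite -[cI i]mul1r; apply: info_norm => j.
  by have /andP[h0 h1] := pol01 i j e0 t0; rewrite ger0_norm.
- split; [exact: fluct_continuous|exact: fluct0| |].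
    by move=> t t0; apply: info_norm => j; exact: (fluctuation_bound P_decomp).
  by move=> t t0 nt; exact: fluct_derive.
- split; last by rewrite /Z maxxx.
  by apply: continuous_mx; exact: continuous_max0.
- by move=> t t0 nt; exact: Z_derive.
Qed.

Let Zp (eps : R) i (t : R) : 0 < eps -> posdef (Z eps i t).
Proof.
move=> e0; have t0 : 0 <= Num.max 0 t by rewrite le_max lexx.
have -> : Z eps i t = Z eps i (Num.max 0 t) by rewrite /Z (max_idPr t0).
exact: (filter_posdef _ _ (filt i e0)).
Qed.

Let cost (eps : R) i (t : R) := primitive (fun s => \tr (T i *m Z eps i s)) t.
Let usage (eps : R) i j (t : R) := primitive (fun s => pol eps s i j) t.
Let total (eps t : R) :=
  \sum_(i < N) (cost eps i t + \sum_(j < M) kappa i j * usage eps i j t).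

Let cost_integrable (eps : R) i : 0 < eps ->
  locally_integrable0 (fun s => \tr (T i *m Z eps i s)).
Proof.
move=> e0; have [_ _ _ [cZ _] _] := filt i e0.
apply: continuous_locally_integrable0; apply: continuous_mxtrace.
by apply: mx_continuous_mul => //; exact: mx_continuous_const.
Qed.

Let usage_integrable (eps : R) i j : 0 < eps ->
  locally_integrable0 (fun s => pol eps s i j).
Proof. by move=> e0; exact: switching_policy_integrable. Qed.

Let integral_total (eps t : R) : 0 < eps ->
  (\int[lebesgue_measure]_(s in `[0%R, t])
       (\sum_(i < N) (\tr (T i *m Sigma eps i s)
                      + \sum_(j < M) kappa i j * pol eps s i j))%:E)%E =
  (total eps t)%:E.
Proof.
move=> e0; have iu i j := locally_integrable0Z (kappa i j) (usage_integrable i j e0).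
have ius i := locally_integrable0_sum (index_enum 'I_M) (iu i).
have ii i := locally_integrable0D (cost_integrable i e0) (ius i).
have iis := locally_integrable0_sum (index_enum 'I_N) ii.
transitivity (\int[lebesgue_measure]_(s in `[0%R, t])
    (\sum_(i < N) (\tr (T i *m Z eps i s) + \sum_(j < M) kappa i j * pol eps s i j))%:E)%E.
  apply: eq_integral => s; rewrite inE /= in_itv /= => /andP[s0 _].
  by rewrite /Z (max_idPr s0).
rewrite primitiveE //; congr (_%:E); rewrite primitive_sum //.
apply: eq_bigr => i _; rewrite primitiveD //; last exact: cost_integrable.
congr (_ + _); rewrite primitive_sum //; apply: eq_bigr => j _.
by rewrite primitiveZ //; exact: usage_integrable.
Qed.

Lemma performance_upper : exists c e0, [/\ 0 <= c, 0 < e0 &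
  forall eps, 0 < eps < e0 -> exists c', forall t : R, 0 < t ->
    t^-1 * total eps t <= objective T kappa Q P + c * eps + c' / t].
Proof.
have up i := filter_cost_upper (W_psd i) (Sb_psd i) (Xp i) (Ep i) (ric i) (@noinv i)
  (cI i) (cI i) (Sigma0_pd i) (T_psd i).
have /choice[ce hce] : forall i, exists ce : R * R, [/\ 0 <= ce.1, 0 < ce.2 &
  forall eps, 0 < eps < ce.2 -> exists c', forall t, 0 <= t ->
    cost eps i t <= t * (\tr (T i *m X i) + ce.1 * eps) + c'].
  move=> i; have [c [e0 [c0 e00 h]]] := up i; exists (c, e0); split=> //= eps eb.
  by have e0' : 0 < eps by [case/andP: eb]; exact: h eb (filt i e0').
(* One threshold for all systems; the value 1 keeps it positive when there are none. *)
exists (\sum_i (ce i).1), (\big[Num.min/1]_i (ce i).2); split.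
- by apply: sumr_ge0 => i _; case: (hce i).
- by apply: lt_bigmin => // i _; case: (hce i).
move=> eps /andP[eps0 epse].
have /choice[c' hc'] : forall i, exists c', forall t, 0 <= t ->
    cost eps i t <= t * (\tr (T i *m X i) + (ce i).1 * eps) + c'.
  move=> i; have [_ _ h] := hce i; apply: h; rewrite eps0 (lt_le_trans epse) //.
  exact: bigmin_le_cond.
(* The usage stays within [eps] of [t * P i j], so the sensor costs add only to the constant and not
   to the coefficient of [t]. *)
exists (\sum_i (c' i + \sum_j `|kappa i j| * eps)) => t t0.
rewrite ler_pdivrMl // mulrDr mulrCA divff ?gt_eqF // mulr1 mulrDr.
rewrite /total /objective mulr_suml !mulr_sumr -!big_split /=; apply: ler_sum => i _.
have := hc' i t (ltW t0); rewrite -/(X i) => hi.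
have hj : \sum_j kappa i j * usage eps i j t <=
    t * \sum_j kappa i j * P i j + \sum_j `|kappa i j| * eps.
  rewrite mulr_sumr -big_split; apply: ler_sum => j _ /=.
  have := fluctuation_bound P_decomp P01 eps0 i j (ltW t0).
  rewrite /fluctuation -/(usage eps i j t) => fb.
  have : kappa i j * (usage eps i j t - t * P i j) <= `|kappa i j| * eps.
    by apply: le_trans (ler_norm _) _; rewrite normrM; exact: ler_wpM2l.
  lra.
lra.
Qed.

(** At whole periods the usage is exactly [t * P i j] and the fluctuation of the rate vanishes, so
    the matrices obtained from the filters form, together with the same [P], a competitor in the
    program. *)
Lemma performance_lower (eps : R) : 0 < eps -> exists c' t0 : R,
  forall l : nat, 0 < l%:R * eps -> t0 <= l%:R * eps ->
    objective T kappa Q P - c' / (l%:R * eps) <= (l%:R * eps)^-1 * total eps (l%:R * eps).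
Proof.
move=> eps0.
have low i : exists ct : R * R, forall t : R, 0 < t -> ct.2 <= t -> fluct eps i t = 0 ->
    exists Q', [/\ posdef Q', psd (- lmi (A i) (W i) (Sb i) Q') &
      \tr (T i *m invmx Q') <= t^-1 * (cost eps i t + ct.1)].
  have [Qs [c [c0 Qsp Qsc]]] :=
    strictly_feasible (W_psd i) (Sb_psd i) (@noinv i) (Xp i) (Ep i) (ric i).
  have [swf _ _ [cZ _] _] := filt i eps0.
  have cB : mx_continuous (fluct eps i) by exact: fluct_continuous.
  have dB (t : R) : 0 < t -> ~ sw eps t ->
      mx_derive (fluct eps i) t (rate eps i t - Sb i).
    by move=> t0 nt; exact: fluct_derive.
  have Zpos (t : R) : posdef (Z eps i t) by exact: Zp.
  have dZ (t : R) (t0 : 0 < t) (nt : ~ sw eps t) := @Z_derive eps i t eps0 t0 nt.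
  have [c' [t0 h]] := filter_cost_lower (W_psd i) (Sb_psd i) (T_psd i) swf
    cB (fluct0 eps i) dB cZ Zpos dZ c0 Qsp Qsc.
  by exists (c', t0).
have /choice[ct hct] := low.
exists (\sum_i (ct i).1), (\sum_i `|(ct i).2|) => l; set t := l%:R * eps => t0 tt.
have exQ i : exists Q' : 'M[R]_(n i),
    [/\ posdef Q', psd (- lmi (A i) (W i) (Sb i) Q') &
      \tr (T i *m invmx Q') <= t^-1 * (cost eps i t + (ct i).1)].
  apply: hct => //.
    apply: le_trans (ler_norm _) _; apply: le_trans tt.
    by rewrite (bigD1 i) //= lerDl sumr_ge0.
  rewrite /fluct -[RHS](info0 (C i) (V i)); congr info; apply/funext => j.
  exact: (fluctuation_period P_decomp).
pose Q' i := sval (cid (exQ i)); have hQ' i := svalP (cid (exQ i)).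
have feas' : feasible A W C V Q' P.
  have [_ _ h1 h2 h3] := feas; split=> // i; last by case: (hQ' i).
  by rewrite /loewner_le sub0r; case: (hQ' i).
have := QP_optimal.2 _ _ feas'.
rewrite lerBlDr => /le_trans; apply.
have us i j : usage eps i j t = t * P i j.
  by apply/eqP; rewrite -subr_eq0; apply/eqP; exact: (fluctuation_period P_decomp).
rewrite /objective /total mulr_suml mulr_sumr -big_split /=; apply: ler_sum => i _.
have [_ _ hi] := hQ' i.
under [in leRHS]eq_bigr do rewrite us mulrCA.
rewrite -mulr_sumr mulrDr mulKf ?gt_eqF // addrAC lerD2r.
by apply: le_trans hi _; rewrite mulrDr [(ct i).1 / t]mulrC.
Qed.

(** The lower bound carries no term in [eps]: for fixed [eps] its defect [c' / t] vanishes as the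
    time grows. *)
Lemma performance_bounds : exists c e0, [/\ 0 <= c, 0 < e0 &
  forall eps : R, 0 < eps < e0 ->
    ((objective T kappa Q P)%:E <=
       performance T kappa (switching_policy phi Pk eps) (Sigma eps))%E /\
    (performance T kappa (switching_policy phi Pk eps) (Sigma eps) <=
       (objective T kappa Q P + c * eps)%:E)%E].
Proof.
have [c [e0 [c0 e00 up]]] := performance_upper.
exists c, e0; split=> // eps eb; have eps0 : 0 < eps by case/andP: eb.
have avg (t : R) : 0 < t -> ((t^-1)%:E * \int[lebesgue_measure]_(s in `[0%R, t])
       (\sum_(i < N) (\tr (T i *m Sigma eps i s)
                      + \sum_(j < M) kappa i j * pol eps s i j))%:E)%E =
  (t^-1 * total eps t)%:E by move=> _; rewrite integral_total.
split; last by have [c' h] := up eps eb; exact: limf_esup_le avg h.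
have [c' [t0 low]] := performance_lower eps0.
apply: (limf_esup_ge (c := c') avg) => B.
(* The first integer [l] above [b] makes [l * eps] positive, larger than [B] and past the threshold
   [t0]. *)
pose b := Num.max 0 (Num.max B t0) / eps.
have b0 : 0 <= b by rewrite divr_ge0 ?le_max ?lexx // ltW.
have : b < (Num.truncn b).+1%:R by have /andP[] := truncn_itv b0.
set l := (Num.truncn b).+1; rewrite ltr_pdivrMr // !gt_max => /and3P[l0 lB lt0].
by exists (l%:R * eps) => //; apply: low => //; exact: ltW.
Qed.

End Assembly.

Theorem theorem11 (R : realType) (N M : nat) (n : 'I_N -> nat)
  (q : 'I_N -> 'I_M -> nat)
  (A W T Sigma0 : forall i, 'M[R]_(n i))
  (C : forall i j, 'M[R]_(q i j, n i))
  (V : forall i j, 'M[R]_(q i j))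
  (kappa : 'M[R]_(N, M))
  (W_psd : forall i, psd (W i))
  (T_psd : forall i, psd (T i))
  (V_pd : forall i j, posdef (V i j))
  (Sigma0_pd : forall i, posdef (Sigma0 i))
  (AC_detectable : forall i, exists (m : nat) (js : 'I_m -> 'I_M),
     detectable (A i) (\mxcol_(k < m) C i (js k)))
  (AW_controllable : forall i, exists H : 'M[R]_(n i),
     is_psd_sqrt (W i) H /\ controllable (A i) H)
  (Q : forall i, 'M[R]_(n i)) (P : 'M[R]_(N, M))
  (QP_optimal : is_optimal A W T C V kappa Q P)
  (K : nat) (phi : 'I_K -> R) (Pk : 'I_K -> 'M[R]_(maxn M N))
  (P_decomp : is_decomposition P phi Pk)
  (Sigma : R -> forall i, R -> 'M[R]_(n i))
  (Sigma_cov : forall eps : R, 0 < eps -> forall i,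
     filter_covariance i (A i) (W i) (C i) (V i) (Sigma0 i)
       (switching_policy phi Pk eps) (Sigma eps i)) :
  let Zstar : R := optimal_value A W T C V kappa in
  let Z : R -> \bar R := fun eps =>
    performance T kappa (switching_policy phi Pk eps) (Sigma eps) in
  [/\ \forall eps \near 0^'+, Z eps \is a fin_num,
      (fun eps => fine (Z eps) - Zstar) =O_ (0^'+) (fun eps : R => eps)
    & Z eps @[eps --> 0^'+] --> Zstar%:E].
Proof.
rewrite /= (optimal_valueE QP_optimal).
have noinv i (Z L : 'M[R]_(n i)) : Z *m A i = L *m Z -> Z *m W i = 0 -> Z = 0.
  have [H [HW ctrl]] := AW_controllable i; exact: (@controllable_noinv _ _ _ _ _ HW ctrl Z L).
have [c [e0 [c0 e00 h]]] :=
  performance_bounds W_psd T_psd V_pd Sigma0_pd noinv QP_optimal P_decomp Sigma_cov.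
exact: squeeze_linear e00 c0 h.
Qed.
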